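(* The left $\mathbf U$-action and the right $\mathbf H_d$-action on $\mathbf V^{\otimes d}$ described in the context commute. If $n\ge d$, they form a double centralizer: the right action identifies $\mathbf H_d\simeq \mathrm{End}_{\mathbf U}(\mathbf V^{\otimes d})$, and the algebra homomorphism $\mathbf U\to \mathrm{End}_{\mathbf H_d}(\mathbf V^{\otimes d})$ given by the left action is surjective.
   Context: Fix integers $n\ge 1$, $d\ge 2$; $[a,b]$ denotes the set of integers from $a$ to $b$. Algebra $\mathbf U$: the unital associative $\mathbb Q(v)$-algebra generated by $E_i,F_i,H_a^{\pm1},J_\alpha$ ($i\in[1,n]$, $a\in[1,n+1]$, $\alpha\in\{+,0,-\}$) with relations (for all $i,j\in[1,n]$, $a,b\in[1,n+1]$, $\alpha,\beta\in\{+,0,-\}$): $J_++J_0+J_-=1$, $J_\alpha J_\beta=\delta_{\alpha,\beta}J_\alpha$, $J_\alpha H_a=H_aJ_\alpha$; $J_\pm E_i=(1-\delta_{in})E_iJ_\pm$, $F_iJ_\pm=(1-\delta_{in})J_\pm F_i$; $J_\pm F_nE_n-F_nE_nJ_\mp=\frac{H_n^{-1}H_{n+1}-H_nH_{n+1}^{-1}}{v-v^{-1}}(J_\pm-J_\mp)$; $H_aH_b=H_bH_a$, $H_aH_a^{-1}=1$; $H_aE_i=v^{\delta_{ai}-\delta_{a,i+1}-\delta_{a,n+1}\delta_{i,n}}E_iH_a$, $H_aF_i=v^{-\delta_{ai}+\delta_{a,i+1}+\delta_{a,n+1}\delta_{i,n}}F_iH_a$; $E_iF_j-F_jE_i=\delta_{ij}\frac{H_iH_{i+1}^{-1}-H_i^{-1}H_{i+1}}{v-v^{-1}}$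 if $(i,j)\ne(n,n)$; $E_iE_j=E_jE_i$, $F_iF_j=F_jF_i$ if $|i-j|>1$; $E_i^2E_j-(v+v^{-1})E_iE_jE_i+E_jE_i^2=0$ and $F_i^2F_j-(v+v^{-1})F_iF_jF_i+F_jF_i^2=0$ if $|i-j|=1$; $E_n^2F_n+F_nE_n^2=(v+v^{-1})\big(E_nF_nE_n-E_n(vH_nH_{n+1}^{-1}+v^{-1}H_n^{-1}H_{n+1})\big)$; $F_n^2E_n+E_nF_n^2=(v+v^{-1})\big(F_nE_nF_n-(vH_nH_{n+1}^{-1}+v^{-1}H_n^{-1}H_{n+1})F_n\big)$. Hecke algebra $\mathbf H_d$ (type $D_d$): the unital associative $\mathbb Q(v)$-algebra generated by $\tau_1,\dots,\tau_d$ with relations $\tau_i^2=(v^2-1)\tau_i+v^2$ ($1\le i\le d$); $\tau_j\tau_{j+1}\tau_j=\tau_{j+1}\tau_j\tau_{j+1}$ ($1\le j\le d-2$); $\tau_i\tau_j=\tau_j\tau_i$ ($1\le j\le i-2\le d-3$); $\tau_d\tau_l=\tau_l\tau_d$ ($l\ne d-2$); $\tau_d\tau_{d-2}\tau_d=\tau_{d-2}\tau_d\tau_{d-2}$ (when $d\geq 3$). Tensor space: $\mathbf V$ is a $\mathbb Q(v)$-vector space with basis $\mathbf v_1,\dots,\mathbf v_{2n+1}$. For $\mathbf r=(r_1,\dots,r_d)\in[1,2n+1]^d$ let $\mathbf v_{\mathbf r}=\mathbf v_{r_1}\otimes\cdots\otimes\mathbf v_{r_d}$. Extend $\mathbf r$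 to a sequence of length $2d$ by $r_{2d+1-i}=2n+2-r_i$; $\mathbf r$ is identified with its extension. For $p\in[1,2d]$, $\mathbf r'_p$ (resp. $\mathbf r''_p$) is obtained from the extended $\mathbf r$ by replacing $r_p$ by $r_p+1$ and $r_{2d+1-p}$ by $r_{2d+1-p}-1$ (resp. $r_p$ by $r_p-1$ and $r_{2d+1-p}$ by $r_{2d+1-p}+1$). Left $\mathbf U$-action: $E_i\mathbf v_{\mathbf r}=v^{-\sum_{1\le j\le 2d}\delta_{i+1,r_j}}\sum_{p\in[1,2d]:r_p=i}v^{2\sum_{j<p}\delta_{i+1,r_j}}\mathbf v_{\mathbf r'_p}$; $F_i\mathbf v_{\mathbf r}=v^{-\sum_{1\le j\le 2d}\delta_{i,r_j}}\sum_{p\in[1,2d]:r_p=i+1}v^{2\sum_{j>p}\delta_{i,r_j}}\mathbf v_{\mathbf r''_p}$; $H_a^{\pm1}\mathbf v_{\mathbf r}=v^{\mp\sum_{1\le j\le 2d}\delta_{a,r_j}}\mathbf v_{\mathbf r}$; $J_+\mathbf v_{\mathbf r}=\mathbf v_{\mathbf r}$ if no $r_i$ equals $n+1$ and $\#\{j\in[1,d]: r_j\ge n+1\}$ is even, and $0$ otherwise; $J_-\mathbf v_{\mathbf r}=\mathbf v_{\mathbf r}$ if no $r_i$ equals $n+1$ and that number is odd, and $0$ otherwise; $J_0\mathbf v_{\mathbf r}=\mathbf v_{\mathbf r}$ if some $r_i=n+1$, and $0$ otherwise. Right $\mathbf H_d$-action: for $1\le j\le d-1$ let $\mathbf r s_j$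 be obtained from $(r_1,\dots,r_d)$ by exchanging $r_j$ and $r_{j+1}$, and let $\mathbf r s_d$ be obtained by replacing $(r_{d-1},r_d)$ by $(2n+2-r_d,\,2n+2-r_{d-1})$. For $1\le j\le d-1$: $\mathbf v_{\mathbf r}\tau_j$ equals $\mathbf v_{\mathbf rs_j}$ if $r_j<r_{j+1}$, $v^2\mathbf v_{\mathbf r}$ if $r_j=r_{j+1}$, $(v^2-1)\mathbf v_{\mathbf r}+v^2\mathbf v_{\mathbf rs_j}$ if $r_j>r_{j+1}$. And $\mathbf v_{\mathbf r}\tau_d$ equals $\mathbf v_{\mathbf rs_d}$ if $r_{d-1}+r_d<2n+2$, $v^2\mathbf v_{\mathbf r}$ if $r_{d-1}+r_d=2n+2$, $(v^2-1)\mathbf v_{\mathbf r}+v^2\mathbf v_{\mathbf rs_d}$ if $r_{d-1}+r_d>2n+2$. *)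

(* Defs.v *)
From HB Require Import structures.
From mathcomp Require Import all_boot all_order all_algebra.
From mathcomp Require Import monalg boolp classical_sets functions.

Set Implicit Arguments.
Unset Strict Implicit.
Unset Printing Implicit Defensive.

Import GRing.Theory.
Local Open Scope ring_scope.
Local Open Scope quotient_scope.

(* The free algebra K<X> is the algebra of the free monoid on X. *)
Notation free_alg K X := {malg K[{fmonom X}]}.

Definition fgen (K : fieldType) (X : choiceType) (x : X) : free_alg K X :=
  mkmalgU (fmu x) 1.

(* The algebra generated by X subject to the relations [a = b] for [rels a b],*)
(* as the quotient of K<X> by the two-sided ideal generated by the [a - b].   *)
Section Presentation.
Variables (K : fieldType) (X : choiceType).
Variable rels : free_alg K X -> free_alg K X -> Prop.

(* K is central in K<X>, so that no clause is needed for opposite or scaling. *)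
Inductive rel_ideal : free_alg K X -> Prop :=
| RelIdeal_rel a b of rels a b : rel_ideal (a - b)
| RelIdeal_0 : rel_ideal 0
| RelIdeal_D a b of rel_ideal a & rel_ideal b : rel_ideal (a + b)
| RelIdeal_Ml c a of rel_ideal a : rel_ideal (c * a)
| RelIdeal_Mr a c of rel_ideal a : rel_ideal (a * c).

Definition rel_eqv (a b : free_alg K X) : bool := `[< rel_ideal (a - b) >].

Lemma rel_idealN a : rel_ideal a -> rel_ideal (- a).
Proof. by rewrite -mulN1r; apply: RelIdeal_Ml. Qed.

Lemma rel_idealZ k a : rel_ideal a -> rel_ideal (k *: a).
Proof. by rewrite -mul_malgC; apply: RelIdeal_Ml. Qed.

Lemma rel_eqv_is_equiv : equiv_class_of rel_eqv.
Proof.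
split=> [a|a b|b a c].
- by apply/asboolP; rewrite subrr; apply: RelIdeal_0.
- by apply/asboolP/asboolP => /rel_idealN; rewrite opprB.
- move=> /asboolP ab /asboolP bc; apply/asboolP.
  by rewrite -(subrKA b); apply: RelIdeal_D.
Qed.

Canonical rel_eqv_equiv := EquivRelPack rel_eqv_is_equiv.
Canonical rel_eqv_encModRel := defaultEncModRel rel_eqv.

Definition presented_alg := {eq_quot rel_eqv}.

HB.instance Definition _ := Choice.on presented_alg.
HB.instance Definition _ := EqQuotient.on presented_alg.

Local Notation A := presented_alg.
Local Notation pi := (\pi_A).

Lemma pi_eqP (a b : free_alg K X) : pi a = pi b <-> rel_ideal (a - b).
Proof.
split=> [/eqP|ab]; first by rewrite piE => /asboolP.
by apply/eqP; rewrite piE; apply/asboolP.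
Qed.

Definition presented_zero : A := pi 0.
Definition presented_one : A := pi 1.
Definition presented_opp := locked (fun x : A => pi (- repr x)).
Definition presented_add := locked (fun x y : A => pi (repr x + repr y)).
Definition presented_mul := locked (fun x y : A => pi (repr x * repr y)).
Definition presented_scale := locked (fun (k : K) (x : A) => pi (k *: repr x)).

Lemma repr_pi a : rel_ideal (repr (pi a) - a).
Proof. by apply/pi_eqP; rewrite reprK. Qed.

Lemma presented_oppE a : presented_opp (pi a) = pi (- a).
Proof.
by rewrite /presented_opp; unlock; apply/pi_eqP; rewrite -opprD; apply/rel_idealN/repr_pi.
Qed.

Lemma presented_addE a b : presented_add (pi a) (pi b) = pi (a + b).
Proof.
rewrite /presented_add; unlock; apply/pi_eqP; rewrite opprD addrACA.
by apply: RelIdeal_D; apply: repr_pi.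
Qed.

Lemma presented_mulE a b : presented_mul (pi a) (pi b) = pi (a * b).
Proof.
rewrite /presented_mul; unlock; apply/pi_eqP.
rewrite -(subrKA (a * repr (pi b))) -mulrBl -mulrBr.
by apply: RelIdeal_D; [apply: RelIdeal_Mr|apply: RelIdeal_Ml]; apply: repr_pi.
Qed.

Lemma presented_scaleE k a : presented_scale k (pi a) = pi (k *: a).
Proof.
rewrite /presented_scale; unlock; apply/pi_eqP.
by rewrite -scalerBr; apply/rel_idealZ/repr_pi.
Qed.

Let piE' := (presented_oppE, presented_addE, presented_mulE, presented_scaleE).

Lemma presented_addA : associative presented_add.
Proof. by move=> x y z; rewrite -[x]reprK -[y]reprK -[z]reprK !piE' addrA. Qed.
Lemma presented_addC : commutative presented_add.
Proof. by move=> x y; rewrite -[x]reprK -[y]reprK !piE' addrC. Qed.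
Lemma presented_add0 : left_id presented_zero presented_add.
Proof. by move=> x; rewrite -[x]reprK !piE' add0r. Qed.
Lemma presented_addN : left_inverse presented_zero presented_opp presented_add.
Proof. by move=> x; rewrite -[x]reprK !piE' addNr. Qed.

HB.instance Definition _ := GRing.isZmodule.Build A
  presented_addA presented_addC presented_add0 presented_addN.

Lemma presented_mulA : associative presented_mul.
Proof. by move=> x y z; rewrite -[x]reprK -[y]reprK -[z]reprK !piE' mulrA. Qed.
Lemma presented_mul1l : left_id presented_one presented_mul.
Proof. by move=> x; rewrite -[x]reprK !piE' mul1r. Qed.
Lemma presented_mul1r : right_id presented_one presented_mul.
Proof. by move=> x; rewrite -[x]reprK !piE' mulr1. Qed.
Lemma presented_mulDl : left_distributive presented_mul presented_add.
Proof. by move=> x y z; rewrite -[x]reprK -[y]reprK -[z]reprK !piE' mulrDl. Qed.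
Lemma presented_mulDr : right_distributive presented_mul presented_add.
Proof. by move=> x y z; rewrite -[x]reprK -[y]reprK -[z]reprK !piE' mulrDr. Qed.

HB.instance Definition _ := GRing.Zmodule_isPzRing.Build A
  presented_mulA presented_mul1l presented_mul1r presented_mulDl presented_mulDr.

Lemma presented_scaleA k l x :
  presented_scale k (presented_scale l x) = presented_scale (k * l) x.
Proof. by rewrite -[x]reprK !piE' scalerA. Qed.
Lemma presented_scale1 : left_id 1 presented_scale.
Proof. by move=> x; rewrite -[x]reprK !piE' scale1r. Qed.
Lemma presented_scaleDr : right_distributive presented_scale +%R.
Proof.
by move=> k x y; rewrite -[x]reprK -[y]reprK /+%R /= !piE' scalerDr.
Qed.
Lemma presented_scaleDl x : {morph presented_scale^~ x : k l / k + l}.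
Proof. by move=> k l; rewrite -[x]reprK [RHS]/+%R /= !piE' scalerDl. Qed.

HB.instance Definition _ := GRing.Zmodule_isLmodule.Build K A
  presented_scaleA presented_scale1 presented_scaleDr presented_scaleDl.

(* MathComp algebras are nontrivial rings, which a presentation need not give:*)
(* the next two lemmas complete the K-algebra structure of [presented_alg].   *)
Lemma presented_scaleAl (k : K) (x y : A) : k *: (x * y) = k *: x * y.
Proof.
rewrite -[x]reprK -[y]reprK.
by rewrite /*:%R /*%R /= !piE' scalerAl.
Qed.

Lemma malg_scaleAr (k : K) (a b : free_alg K X) : k *: (a * b) = a * (k *: b).
Proof.
have kC : k%:MP * a = a * k%:MP.
  rewrite [a]monalgE mulr_sumr mulr_suml; apply: eq_bigr => m _.
  by rewrite !malgM_def !fgmulUU mulrC Monoid.mul1m Monoid.mulm1.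
by rewrite -!mul_malgC !mulrA kC.
Qed.

Lemma presented_scaleAr (k : K) (x y : A) : k *: (x * y) = x * (k *: y).
Proof.
rewrite -[x]reprK -[y]reprK.
by rewrite /*:%R /*%R /= !piE' malg_scaleAr.
Qed.

Definition pgen (x : X) : presented_alg := pi (fgen K x).

End Presentation.

(* From here on all indices are shifted down by one with respect to the usual *)
(* ones: E_i, F_i are indexed by [i : 'I_n], H_a by [a : 'I_n.+1], tau_j by   *)
(* [j : 'I_d] and the basis of V by ['I_(2n+1)]; thus E_n is E_i for          *)
(* [i.+1 = n], the middle basis vector v_(n+1) has index n, and the involution*)
(* r |-> 2n+2-r is [rev_ord].                                                 *)

Notation Qv := {fraction {poly rat}}.

Definition v : Qv := tofrac 'X.

(* The index of J_+, J_-, J_0 is [Some true], [Some false], [None]. *)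
Inductive Ugen (n : nat) : Type :=
| UgenE of 'I_n
| UgenF of 'I_n
| UgenH of 'I_n.+1
| UgenHinv of 'I_n.+1
| UgenJ of option bool.

Definition Ugen_code n (x : Ugen n) :
    'I_n + 'I_n + ('I_n.+1 + 'I_n.+1) + option bool :=
  match x with
  | UgenE i => inl (inl (inl i))
  | UgenF i => inl (inl (inr i))
  | UgenH a => inl (inr (inl a))
  | UgenHinv a => inl (inr (inr a))
  | UgenJ al => inr al
  end.

Definition Ugen_decode n
    (x : 'I_n + 'I_n + ('I_n.+1 + 'I_n.+1) + option bool) : Ugen n :=
  match x with
  | inl (inl (inl i)) => UgenE i
  | inl (inl (inr i)) => UgenF i
  | inl (inr (inl a)) => UgenH a
  | inl (inr (inr a)) => UgenHinv a
  | inr al => UgenJ n al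
  end.

Lemma Ugen_codeK n : cancel (@Ugen_code n) (@Ugen_decode n).
Proof. by case. Qed.

HB.instance Definition _ n := Choice.copy (Ugen n) (can_type (@Ugen_codeK n)).

Section URelations.
Variable n : nat.

Local Notation A := (free_alg Qv (Ugen n)).
Local Notation E i := (fgen Qv (UgenE i)).
Local Notation F i := (fgen Qv (UgenF i)).
Local Notation H a := (fgen Qv (UgenH a)).
Local Notation Hinv a := (fgen Qv (UgenHinv a)).
Local Notation J al := (fgen Qv (UgenJ n al)).
Local Notation JJ s := (fgen Qv (UgenJ n (Some s))).
(* H_i and H_(i+1) for [i : 'I_n] *)
Local Notation at0 i := (inord i : 'I_n.+1).
Local Notation at1 i := (inord i.+1 : 'I_n.+1).

Implicit Types (i j : 'I_n) (a b : 'I_n.+1) (al be : option bool) (s : bool).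

Definition HE_weight a i : int :=
  (a == i :> nat)%:Z - (a == i.+1 :> nat)%:Z - ((a == n :> nat) && (i.+1 == n))%:Z.

Inductive U_rel : A -> A -> Prop :=
| Urel_Jsum : U_rel (JJ true + J None + JJ false) 1
| Urel_JJ al be : U_rel (J al * J be) (J al *+ (al == be))
| Urel_JH al a : U_rel (J al * H a) (H a * J al)
| Urel_JE s i : U_rel (JJ s * E i) (E i * JJ s *+ (i.+1 != n))
| Urel_FJ s i : U_rel (F i * JJ s) (JJ s * F i *+ (i.+1 != n))
| Urel_JFE s i of i.+1 = n :
    U_rel (JJ s * F i * E i - F i * E i * JJ (~~ s))
          ((v - v^-1)^-1 *: (Hinv (at0 i) * H (at1 i) - H (at0 i) * Hinv (at1 i))
           * (JJ s - JJ (~~ s)))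
| Urel_HH a b : U_rel (H a * H b) (H b * H a)
| Urel_HHinv a : U_rel (H a * Hinv a) 1
| Urel_HinvH a : U_rel (Hinv a * H a) 1
| Urel_HE a i : U_rel (H a * E i) (v ^ HE_weight a i *: (E i * H a))
| Urel_HF a i : U_rel (H a * F i) (v ^ (- HE_weight a i) *: (F i * H a))
| Urel_EF i j of ~ (i.+1 = n /\ j.+1 = n) :
    U_rel (E i * F j - F j * E i)
          ((v - v^-1)^-1 *: (H (at0 i) * Hinv (at1 i) - Hinv (at0 i) * H (at1 i))
           *+ (i == j))
| Urel_EE i j of (i.+1 < j)%N || (j.+1 < i)%N : U_rel (E i * E j) (E j * E i)
| Urel_FF i j of (i.+1 < j)%N || (j.+1 < i)%N : U_rel (F i * F j) (F j * F i)
| Urel_SerreE i j of (i.+1 == j) || (j.+1 == i) :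
    U_rel (E i ^+ 2 * E j - (v + v^-1) *: (E i * E j * E i) + E j * E i ^+ 2) 0
| Urel_SerreF i j of (i.+1 == j) || (j.+1 == i) :
    U_rel (F i ^+ 2 * F j - (v + v^-1) *: (F i * F j * F i) + F j * F i ^+ 2) 0
| Urel_EEF i of i.+1 = n :
    U_rel (E i ^+ 2 * F i + F i * E i ^+ 2)
          ((v + v^-1) *: (E i * F i * E i
             - E i * (v *: (H (at0 i) * Hinv (at1 i))
                      + v^-1 *: (Hinv (at0 i) * H (at1 i)))))
| Urel_FFE i of i.+1 = n :
    U_rel (F i ^+ 2 * E i + E i * F i ^+ 2)
          ((v + v^-1) *: (F i * E i * F i
             - (v *: (H (at0 i) * Hinv (at1 i))
                + v^-1 *: (Hinv (at0 i) * H (at1 i))) * F i)).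

End URelations.

Definition U (n : nat) := presented_alg (@U_rel n).
HB.instance Definition _ n := GRing.PzRing.on (U n).
HB.instance Definition _ n := GRing.Lmodule.on (U n).

Inductive Hecke_rel (d : nat) :
    free_alg Qv 'I_d -> free_alg Qv 'I_d -> Prop :=
| Hrel_quad (i : 'I_d) :
    Hecke_rel (fgen Qv i ^+ 2) ((v ^+ 2 - 1) *: fgen Qv i + (v ^+ 2)%:MP)
| Hrel_braid (j k : 'I_d) of k = j.+1 :> nat & (k.+1 < d)%N :
    Hecke_rel (fgen Qv j * fgen Qv k * fgen Qv j)
              (fgen Qv k * fgen Qv j * fgen Qv k)
| Hrel_comm (i j : 'I_d) of (j.+2 <= i)%N & (i.+1 < d)%N :
    Hecke_rel (fgen Qv i * fgen Qv j) (fgen Qv j * fgen Qv i)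
| Hrel_comm_last (k l : 'I_d) of k.+1 = d & l.+3 <> d :
    Hecke_rel (fgen Qv k * fgen Qv l) (fgen Qv l * fgen Qv k)
| Hrel_braid_last (k l : 'I_d) of k.+1 = d & l.+3 = d :
    Hecke_rel (fgen Qv k * fgen Qv l * fgen Qv k)
              (fgen Qv l * fgen Qv k * fgen Qv l).

Definition Hecke (d : nat) := presented_alg (@Hecke_rel d).
HB.instance Definition _ d := GRing.PzRing.on (Hecke d).
HB.instance Definition _ d := GRing.Lmodule.on (Hecke d).

Definition genE n (i : 'I_n) : U n := pgen _ (UgenE i).
Definition genF n (i : 'I_n) : U n := pgen _ (UgenF i).
Definition genH n (a : 'I_n.+1) : U n := pgen _ (UgenH a).
Definition genHinv n (a : 'I_n.+1) : U n := pgen _ (UgenHinv a).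
Definition genJ n (al : option bool) : U n := pgen _ (UgenJ n al).
Definition gentau d (j : 'I_d) : Hecke d := pgen _ j.

Notation multi n d := {ffun 'I_d -> 'I_(n.*2).+1}.

(* The d-th tensor power of V, as the vector space with basis (v_r)_r. *)
Notation tensor n d := {ffun multi n d -> Qv^o}.

Section Action.
Variables n d : nat.
Implicit Types (r : multi n d) (p : 'I_(d + d)).

Definition vb r : tensor n d := [ffun s => (s == r)%:R].

Definition ext r p : 'I_(n.*2).+1 :=
  match fintype.split p with inl i => r i | inr i => rev_ord (r (rev_ord i)) end.

(* r'_p and r''_p; [rev_ord p] is the position 2d+1-p. [inord] is only applied*)
(* to in-range values in the formulas for E and F below.                      *)
Definition raise r p : multi n d :=
  [ffun k => if lshift d k == p then inord (r k).+1
             else if lshift d k == rev_ord p then inord (r k).-1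
             else r k].

Definition lower r p : multi n d :=
  [ffun k => if lshift d k == p then inord (r k).-1
             else if lshift d k == rev_ord p then inord (r k).+1
             else r k].

Definition E_vb (i : 'I_n) r : tensor n d :=
  v ^- (\sum_j (ext r j == i.+1 :> nat)) *:
  \sum_(p | ext r p == i :> nat)
     v ^+ (2 * \sum_(j < d + d | (j < p)%N) (ext r j == i.+1 :> nat))
     *: vb (raise r p).

Definition F_vb (i : 'I_n) r : tensor n d :=
  v ^- (\sum_j (ext r j == i :> nat)) *:
  \sum_(p | ext r p == i.+1 :> nat)
     v ^+ (2 * \sum_(j < d + d | (p < j)%N) (ext r j == i :> nat))
     *: vb (lower r p).

Definition H_vb (a : 'I_n.+1) r : tensor n d :=
  v ^- (\sum_j (ext r j == a :> nat)) *: vb r.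

Definition Hinv_vb (a : 'I_n.+1) r : tensor n d :=
  v ^+ (\sum_j (ext r j == a :> nat)) *: vb r.

Definition J_type r : option bool :=
  if [exists j, r j == n :> nat] then None
  else Some (~~ odd #|[pred j | (n <= r j)%N]|).

Definition J_vb (al : option bool) r : tensor n d :=
  if J_type r == al then vb r else 0.

Definition swap r (j k : 'I_d) : multi n d :=
  [ffun i => if i == j then r k else if i == k then r j else r i].

Definition swap_rev r (j k : 'I_d) : multi n d :=
  [ffun i => if i == j then rev_ord (r k)
             else if i == k then rev_ord (r j) else r i].

(* v_r tau_j for [k = j + 1 < d] *)
Definition tau_vb r (j k : 'I_d) : tensor n d :=
  if (r j < r k)%N then vb (swap r j k)
  else if r j == r k then v ^+ 2 *: vb r
  else (v ^+ 2 - 1) *: vb r + v ^+ 2 *: vb (swap r j k).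

(* v_r tau_d, where j and k are the last two positions *)
Definition tau_last_vb r (j k : 'I_d) : tensor n d :=
  if (r j + r k < n.*2)%N then vb (swap_rev r j k)
  else if (r j + r k == n.*2)%N then v ^+ 2 *: vb r
  else (v ^+ 2 - 1) *: vb r + v ^+ 2 *: vb (swap_rev r j k).

Definition is_U_action (L : {linear U n -> 'End(tensor n d)}) : Prop :=
  [/\ L 1 = \1%VF /\ (forall x y, L (x * y) = (L x \o L y)%VF),
      forall i r, L (genE i) (vb r) = E_vb i r,
      forall i r, L (genF i) (vb r) = F_vb i r,
      forall a r, L (genH a) (vb r) = H_vb a r /\
                  L (genHinv a) (vb r) = Hinv_vb a r
    & forall al r, L (genJ n al) (vb r) = J_vb al r].

(* [R h] is the operator of right multiplication by h, so R reverses products.*)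
Definition is_Hecke_action (R : {linear Hecke d -> 'End(tensor n d)}) : Prop :=
  [/\ R 1 = \1%VF /\ (forall x y, R (x * y) = (R y \o R x)%VF),
      forall r (j k : 'I_d), k = j.+1 :> nat ->
        R (gentau j) (vb r) = tau_vb r j k
    & forall r (j k : 'I_d), j.+2 = d -> k.+1 = d ->
        R (gentau k) (vb r) = tau_last_vb r j k].

End Action.

Definition commutant (A : Type) (W : vectType Qv) (rho : A -> 'End(W)) :
    set 'End(W) :=
  [set f | forall x, (f \o rho x = rho x \o f)%VF].

(* Main.v *)
Require Import Defs.
From HB Require Import structures.
From mathcomp Require Import all_boot all_order all_algebra perm finmap ring zify.
From mathcomp Require Import monalg boolp classical_sets functions.

(* Decomposing a tensor along its first factor, the action of E_i, F_i is given *)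
(* by a coproduct formula (op below); the relations of U, and the commutation  *)
(* with the Hecke operators, then follow by induction on d.                    *)
(*   Let d <= n and r0 = (n-d+1, ..., n). The orbit of r0 under the Weyl group *)
(* of type D is regular, so h |-> v_r0 h has a retraction and H_d acts         *)
(* faithfully. The vector v_r0 generates the tensor space over U: the          *)
(* submodule U v_r0 is H_d-stable because it contains each v_r0 tau_j, descents*)
(* reduce to weakly increasing r, and such r are reached from r0 by moving one *)
(* letter at a time with E_i and F_i. An endomorphism f that commutes with U   *)
(* preserves weights, which forces f(v_r0) to lie in v_r0 H_d, and so f is the *)
(* action of an element of H_d.                                                *)
(*   For the form with orthogonal basis (v_r) and |v_r|^2 = v^(2 len r), the   *)
(* adjoint of E_i is a multiple of F_i H_(i+1) / H_i. The image B of U is thus *)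
(* closed under adjunction, and the form is anisotropic since Q(v) is formally *)
(* real, so B is its own bicommutant by von Neumann's argument. As the         *)
(* commutant of B is the image of H_d, B is the commutant of H_d.              *)

Set Implicit Arguments.
Unset Strict Implicit.
Unset Printing Implicit Defensive.

Import Order.TTheory GRing.Theory Num.Theory.
Local Open Scope ring_scope.

(** * Presented algebras *)

(** Each action is built by lifting operators from generators and checking the defining relations.
    Up to its parameters every [E_i] and [F_i] is one operator [op q x y], which turns a letter [x]
    into [y], or the mirror image of [x] into that of [y]. It obeys a coproduct rule ([del_op]), so
    by induction on [d] each relation of U becomes, for each possible first letter, an identity
    between rational functions of [q] ([U_rel_hold]). The Hecke operators come from involutions on
    words together with an integer that plays the role of the value of a simple root ([tau],
    [Hecke_rel_hold]). Their commutation with [op] is a computation in two adjacent tensor factors;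
    the last Hecke generator reduces to the preceding one by conjugation with the sign change of the
    last letter ([op_pair_tau_last]).

    For [d <= n] the word [r0 = base_point n d] has letters of distinct absolute values below the
    middle one, so no simple root vanishes along its Weyl orbit. This gives three facts. An
    equivariant map from the tensor space to the right regular module of the Hecke algebra sends the
    vector of [r0] to 1, so the right action is faithful ([base_retraction], [R_injective]). The
    vector of [r0] generates the tensor space over U ([orbit_all]), so an operator commuting with U
    is determined by its value there. That value has the weight and the [J]-type of [r0], which
    forces it into the Hecke submodule generated by [r0] ([commutant_at_base]). Hence the commutant
    of U is the image of the Hecke algebra ([commutant_is_R]).

    For the remaining surjectivity, the image of U is closed under adjoints for a diagonal form
    ([raise_adjoint], [L_adjoint]), and that form is anisotropic because a sum of squares vanishes
    in Q(v) only trivially ([fractions_sum_sqr_eq0]). The bicommutant theorem ([bicommutant]) then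
    identifies the image of U with the commutant of its commutant ([commutant_is_L]). *)

Section FreeLift.
Variables (K : fieldType) (X : choiceType) (E : lmodType K).
Variables (mul : E -> E -> E) (one : E) (h : X -> E).
Hypothesis mulA : associative mul.
Hypothesis mul1l : left_id one mul.
Hypothesis mulDl : left_distributive mul +%R.
Hypothesis mulDr : right_distributive mul +%R.
Hypothesis mulZl : forall k x y, mul (k *: x) y = k *: mul x y.
Hypothesis mulZr : forall k x y, mul x (k *: y) = k *: mul x y.

(** The product on the target is a parameter and not a ring structure, so that the same lift serves
    for composition of operators in either order. *)
Definition word_lift (m : seq X) : E := foldr (fun x => mul (h x)) one m.

Lemma word_lift_cat s t : word_lift (s ++ t) = mul (word_lift s) (word_lift t).
Proof. by elim: s => [|x s IH] /=; rewrite ?mul1l // IH mulA. Qed.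

Definition free_lift (g : free_alg K X) : E :=
  \sum_(k <- msupp g) g@_k *: word_lift k.

Lemma free_liftEw (d : {fset {fmonom X}}) g : (msupp g `<=` d)%fset ->
  free_lift g = \sum_(k <- d) g@_k *: word_lift k.
Proof.
move=> le; rewrite [LHS](big_fset_incl _ le) => //= x xd /mcoeff_outdom ->.
by rewrite scale0r.
Qed.

Lemma free_liftU c m : free_lift (mkmalgU m c) = c *: word_lift m.
Proof. by rewrite (free_liftEw msuppU_le) big_seq_fset1 mcoeffUU. Qed.

Lemma free_lift_is_linear : linear free_lift.
Proof.
move=> a g1 g2; set d := (msupp g1 `|` msupp g2 `|` msupp (a *: g1 + g2))%fset.
rewrite (free_liftEw (d := d) (g := g1)); last first.
  by rewrite /d -fsetUA fsubsetUl.
rewrite (free_liftEw (d := d) (g := g2)); last first.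
  by rewrite /d fsetUAC fsubsetUr.
rewrite (free_liftEw (d := d)) ?fsubsetUr // scaler_sumr -big_split /=.
apply: eq_bigr => k _; rewrite mcoeffD mcoeffZ scalerDl.
by rewrite -scalerA.
Qed.

HB.instance Definition _ := GRing.isLinear.Build K (free_alg K X) E _ free_lift
  free_lift_is_linear.

Let mul0l y : mul 0 y = 0.
Proof. by have := mulZl 0 0 y; rewrite !scale0r. Qed.

Let mul0r y : mul y 0 = 0.
Proof. by have := mulZr 0 y 0; rewrite !scale0r. Qed.

Let mul_suml (I : Type) (r : seq I) (F : I -> E) y :
  mul (\sum_(i <- r) F i) y = \sum_(i <- r) mul (F i) y.
Proof.
by elim/big_rec2: _ => [|i x z _ <-]; rewrite ?mul0l // mulDl.
Qed.

Let mul_sumr (I : Type) (r : seq I) (F : I -> E) y :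
  mul y (\sum_(i <- r) F i) = \sum_(i <- r) mul y (F i).
Proof.
by elim/big_rec2: _ => [|i x z _ <-]; rewrite ?mul0r // mulDr.
Qed.

Lemma free_liftM g1 g2 : free_lift (g1 * g2) = mul (free_lift g1) (free_lift g2).
Proof.
rewrite malgME linear_sum mul_suml; apply: eq_bigr => i _.
rewrite linear_sum mul_sumr; apply: eq_bigr => j _ /=.
rewrite free_liftU mulZl mulZr scalerA -word_lift_cat.
by rewrite /mmul /= fmmulE.
Qed.

Lemma free_liftD a b : free_lift (a + b) = free_lift a + free_lift b.
Proof. exact: linearD. Qed.
Lemma free_liftN a : free_lift (- a) = - free_lift a.
Proof. exact: linearN. Qed.
Lemma free_liftZ k a : free_lift (k *: a) = k *: free_lift a.
Proof. exact: linearZ. Qed.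
Lemma free_lift0 : free_lift 0 = 0.
Proof. exact: linear0. Qed.

Lemma free_lift1 : free_lift 1 = one.
Proof. by rewrite free_liftU scale1r fm1. Qed.

Lemma free_lift_gen x : mul (h x) one = h x -> free_lift (fgen K x) = h x.
Proof. by move=> hx; rewrite free_liftU scale1r fmuE. Qed.

Variable rels : free_alg K X -> free_alg K X -> Prop.
Hypothesis relsP : forall a b, rels a b -> free_lift a = free_lift b.

Lemma free_lift_ideal a : rel_ideal rels a -> free_lift a = 0.
Proof.
elim => [x y /relsP xy||x y _ x0 _ y0|c x _ x0|x c _ x0].
- by rewrite linearB /= xy subrr.
- by rewrite linear0.
- by rewrite linearD /= x0 y0 addr0.
- by rewrite free_liftM x0 mul0r.
- by rewrite free_liftM x0 mul0l.
Qed.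

Local Notation A := (presented_alg rels).

Definition presented_lift (x : A) : E := free_lift (repr x).

Lemma presented_liftE a : presented_lift (\pi_A a)%qT = free_lift a.
Proof.
apply/eqP; rewrite -subr_eq0 -linearB; apply/eqP/free_lift_ideal.
exact: repr_pi.
Qed.

Lemma presented_piD a b : (\pi_A (a + b) = \pi_A a + \pi_A b :> A)%qT.
Proof. by rewrite [RHS]presented_addE. Qed.

Lemma presented_piM a b : (\pi_A (a * b) = (\pi_A a : A) * \pi_A b :> A)%qT.
Proof. by rewrite [RHS]presented_mulE. Qed.

Lemma presented_piZ k a : (\pi_A (k *: a) = k *: (\pi_A a : A))%qT.
Proof. by rewrite [RHS]presented_scaleE. Qed.

Lemma presented_lift_is_linear : linear presented_lift.
Proof.
move=> k x y; rewrite -[x]reprK -[y]reprK -presented_piZ -presented_piD.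
by rewrite !presented_liftE linearP.
Qed.

HB.instance Definition _ := GRing.isLinear.Build K A E _ presented_lift
  presented_lift_is_linear.

Lemma presented_liftM x y :
  presented_lift (x * y) = mul (presented_lift x) (presented_lift y).
Proof.
rewrite -[x]reprK -[y]reprK -presented_piM !presented_liftE.
exact: free_liftM.
Qed.

Lemma presented_lift1 : presented_lift 1 = one.
Proof. by rewrite [1]/(presented_one _) presented_liftE free_lift1. Qed.

Lemma presented_lift_gen x :
  mul (h x) one = h x -> presented_lift (pgen rels x) = h x.
Proof. by move=> hx; rewrite presented_liftE free_lift_gen. Qed.

End FreeLift.

Section PresentedInd.
Variables (K : fieldType) (X : choiceType).
Variable rels : free_alg K X -> free_alg K X -> Prop.
Local Notation A := (presented_alg rels).

(** Words span the free algebra, and a word is built from 1 by multiplying generators on the left;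
    properties of the two actions are thus reduced to generators. *)
Lemma presented_ind (P : A -> Prop) :
    P 1 -> (forall k x, P x -> P (k *: x)) ->
    (forall x y, P x -> P y -> P (x + y)) ->
    (forall g x, P x -> P (pgen rels g * x)) ->
  forall x, P x.
Proof.
move=> P1 PZ PD PM x; rewrite -[x]reprK; move: (repr x) => a.
rewrite [a]monalgE.
have P0 : P 0 by rewrite -(scale0r (1 : A)); apply: PZ.
elim/big_rec: _ => [//|m y _ Py].
rewrite presented_piD; apply: PD => //.
have -> : mkmalgU m a@_m = a@_m *: mkmalgU m 1.
  by apply/malgP => k; rewrite mcoeffZ !mcoeffU mulrnAr mulr1.
rewrite presented_piZ; apply: PZ; case: m => s.
elim: s => [|g s IH].
  by rewrite -fmoneE.
suff -> : mkmalgU (FMonom (g :: s)) 1 = fgen K g * mkmalgU (FMonom s) 1.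
  by rewrite presented_piM; apply: PM.
rewrite malgM_def fgmulUU mulr1; congr mkmalgU.
by rewrite /mmul /= fmmulE fmuE.
Qed.

End PresentedInd.

(** * The tensor space, one factor at a time *)

Section Pointwise.
Variables (K : fieldType) (X : finType).
Implicit Types t u : {ffun X -> K^o}.
Lemma addTE t u r : (t + u) r = t r + u r. Proof. by rewrite ffunE. Qed.
Lemma oppTE t r : (- t) r = - t r. Proof. by rewrite ffunE. Qed.
Lemma scaleTE k t r : (k *: t) r = k * t r. Proof. by rewrite ffunE. Qed.
Lemma zeroTE r : (0 : {ffun X -> K^o}) r = 0. Proof. by rewrite ffunE. Qed.
Definition TE := (addTE, oppTE, scaleTE, zeroTE).
End Pointwise.

Section Recursion.
Variables (n : nat) (K : fieldType).

Local Notation letter := 'I_(n.*2).+1.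
Local Notation T d := {ffun multi n d -> K^o}.

Definition mcons d (a : letter) (r : multi n d) : multi n d.+1 :=
  [ffun k => if unlift ord0 k is Some j then r j else a].

Definition mtail d (r : multi n d.+1) : multi n d := [ffun j => r (lift ord0 j)].

Lemma mcons0 d a (r : multi n d) : mcons a r ord0 = a.
Proof. by rewrite ffunE unlift_none. Qed.

Lemma mconsS d a (r : multi n d) j : mcons a r (lift ord0 j) = r j.
Proof. by rewrite ffunE liftK. Qed.

Lemma mconsK d a (r : multi n d) : mtail (mcons a r) = r.
Proof. by apply/ffunP => j; rewrite ffunE mconsS. Qed.

Lemma mtailK d (r : multi n d.+1) : mcons (r ord0) (mtail r) = r.
Proof. by apply/ffunP => k; rewrite ffunE; case: unliftP => [j|] ->; rewrite ?ffunE. Qed.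

Lemma eq_mcons d a b (r s : multi n d) :
  (mcons a r == mcons b s) = (a == b) && (r == s).
Proof.
apply/eqP/andP => [e|[/eqP -> /eqP ->]] //; split; apply/eqP.
  by rewrite -(mcons0 a r) e mcons0.
by rewrite -(mconsK a r) e mconsK.
Qed.

(** The component of [t] along the basis vector [a] in the first tensor factor. By [del_inj] these
    components determine [t], which drives the inductions on [d]. *)
Definition del d (a : letter) (t : T d.+1) : T d := [ffun r => t (mcons a r)].

Lemma del_is_linear d a : linear (@del d a).
Proof. by move=> k x y; apply/ffunP => r; rewrite !ffunE. Qed.
HB.instance Definition _ d a :=
  GRing.isLinear.Build K (T d.+1) (T d) _ (@del d a) (@del_is_linear d a).

Lemma del_inj d (t u : T d.+1) : (forall a, del a t = del a u) -> t = u.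
Proof.
move=> e; apply/ffunP => r; have /ffunP/(_ (mtail r)) := e (r ord0).
by rewrite !ffunE mtailK.
Qed.

Definition diag d (q : K) (c : letter -> int) (t : T d) : T d :=
  [ffun r : multi n d => q ^ (\sum_k c (r k)) * t r].

Lemma diag_is_linear d q c : linear (@diag d q c).
Proof.
by move=> k x y; apply/ffunP => r; rewrite !ffunE mulrDr /= mulrCA.
Qed.
HB.instance Definition _ d q c :=
  GRing.isLinear.Build K (T d) (T d) _ (@diag d q c) (@diag_is_linear d q c).

Lemma del_diag d q c a (t : T d.+1) : q != 0 ->
  del a (diag q c t) = q ^ c a *: diag q c (del a t).
Proof.
move=> q0; apply/ffunP => r; rewrite !ffunE big_ord_recl mcons0 expfzDr //.
by rewrite -mulrA; under eq_bigr do rewrite mconsS.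
Qed.

Lemma diagD d q c c' (t : T d) : q != 0 ->
  diag q c (diag q c' t) = diag q (fun a => c a + c' a) t.
Proof.
by move=> q0; apply/ffunP => r; rewrite !ffunE big_split /= expfzDr // mulrA.
Qed.

Lemma eq_diag d q c c' : c =1 c' -> @diag d q c =1 diag q c'.
Proof.
move=> e t; apply/ffunP => r; rewrite !ffunE.
by under eq_bigr do rewrite e.
Qed.

Lemma diag0 d q (t : T d) : diag q (fun=> 0) t = t.
Proof. by apply/ffunP => r; rewrite ffunE big1 // expr0z mul1r. Qed.

Definition cnt (y a : letter) : int := (a == y)%:Z + (a == rev_ord y)%:Z.

(* gd q false y is the action of H_y, and gd q true y that of its inverse. *)
Definition gd d q (s : bool) y : T d -> T d :=
  diag q (fun a => if s then cnt y a else - cnt y a).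

HB.instance Definition _ d q s y := GRing.Linear.copy (@gd d q s y)
  (@diag d q (fun a => if s then cnt y a else - cnt y a)).

(** The factor contributed by a first letter [a] when [op] changes a later one. In the extended word
    [a] stands before and [rev_ord a] after the changed position, hence the opposite exponents; they
    cancel when [y] is the middle letter. *)
Definition opw (q : K) (y a : letter) : K :=
  (if a == y then q else 1) * (if a == rev_ord y then q^-1 else 1).

(* E_i is op v x y for x = i and y = i+1, and F_i is op v^-1 y x. *)
Fixpoint op q x y d : T d -> T d :=
  match d with
  | 0 => fun=> 0
  | d'.+1 => fun t => [ffun r : multi n d'.+1 =>
      opw q y (r ord0) * op q x y (del (r ord0) t) (mtail r)
      + (r ord0 == y)%:R * gd q false y (del x t) (mtail r)
      + (r ord0 == rev_ord y)%:R * gd q true y (del (rev_ord x) t) (mtail r)]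
  end.

(** The three terms of the coproduct: the changed letter lies in the tail, or the first letter has
    become [y] from [x], or [rev_ord y] from [rev_ord x]. In the last two cases the changed position
    is an end of the extended word, so all letters [y] of the tail are counted with the same
    sign. *)
Lemma del_op q x y d a (t : T d.+1) :
  del a (op q x y t) = opw q y a *: op q x y (del a t)
    + (a == y)%:R *: gd q false y (del x t)
    + (a == rev_ord y)%:R *: gd q true y (del (rev_ord x) t).
Proof. by apply/ffunP => r; rewrite ffunE /= ffunE mcons0 mconsK !TE. Qed.

Lemma op_is_linear q x y d : linear (@op q x y d).
Proof.
elim: d => [|d IH] k t u.
  by rewrite /= scaler0 addr0.
apply: del_inj => a; rewrite linearP /= !del_op !linearP /= IH.
by apply/ffunP => r; rewrite !TE; ring.
Qed.
HB.instance Definition _ q x y d :=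
  GRing.isLinear.Build K (T d) (T d) _ (@op q x y d) (@op_is_linear q x y d).

Lemma delD' d a t u : @del d a (t + u) = @del d a t + @del d a u.
Proof. exact: linearD. Qed.
Lemma delN' d a t : @del d a (- t) = - @del d a t.
Proof. exact: linearN. Qed.
Lemma delZ' d a k t : @del d a (k *: t) = k *: @del d a t.
Proof. exact: linearZ. Qed.
Lemma del0' d a : @del d a 0 = 0.
Proof. exact: linear0. Qed.
Lemma diagD' d q c t u : @diag d q c (t + u) = @diag d q c t + @diag d q c u.
Proof. exact: linearD. Qed.
Lemma diagN' d q c t : @diag d q c (- t) = - @diag d q c t.
Proof. exact: linearN. Qed.
Lemma diagZ' d q c k t : @diag d q c (k *: t) = k *: @diag d q c t.
Proof. exact: linearZ. Qed.
Lemma diag0' d q c : @diag d q c 0 = 0.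
Proof. exact: linear0. Qed.
Lemma gdD' d q s y t u : @gd d q s y (t + u) = @gd d q s y t + @gd d q s y u.
Proof. exact: linearD. Qed.
Lemma gdN' d q s y t : @gd d q s y (- t) = - @gd d q s y t.
Proof. exact: linearN. Qed.
Lemma gdZ' d q s y k t : @gd d q s y (k *: t) = k *: @gd d q s y t.
Proof. exact: linearZ. Qed.
Lemma gd0' d q s y : @gd d q s y 0 = 0.
Proof. exact: linear0. Qed.
Lemma opD' d q x y t u : @op q x y d (t + u) = @op q x y d t + @op q x y d u.
Proof. exact: linearD. Qed.
Lemma opN' d q x y t : @op q x y d (- t) = - @op q x y d t.
Proof. exact: linearN. Qed.
Lemma opZ' d q x y k t : @op q x y d (k *: t) = k *: @op q x y d t.
Proof. exact: linearZ. Qed.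
Lemma op0' d q x y : @op q x y d 0 = 0.
Proof. exact: linear0. Qed.
Lemma op_0 q x y (t : T 0) : op q x y t = 0. Proof. by []. Qed.

Definition linE := (delD', delN', delZ', del0', diagD', diagN', diagZ', diag0',
  gdD', gdN', gdZ', gd0', opD', opN', opZ', op0').

(** Replacing [x] by [y] and replacing [rev_ord x] by [rev_ord y] change the total weight by the
    same amount; this is what the symmetry hypothesis on [c] provides. *)
Lemma diag_op p c q x y d (t : T d) : p != 0 ->
  c (rev_ord y) - c (rev_ord x) = c y - c x ->
  diag p c (op q x y t) = p ^ (c y - c x) *: op q x y (diag p c t).
Proof.
move=> p0 cs; elim: d t => [|d IH] t; first by rewrite /= !linE scaler0.
apply: del_inj => a.
have gC s (u : T d) : diag p c (gd q s y u) = gd q s y (diag p c u).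
  by apply/ffunP => r; rewrite !ffunE mulrCA.
rewrite del_diag // del_op !linE !del_op !del_diag // !linE !gC IH.
apply/ffunP => r; rewrite !TE.
have e1 : p ^ c y = p ^ (c y - c x) * p ^ c x by rewrite -expfzDr // subrK.
have e2 : p ^ c (rev_ord y) = p ^ (c y - c x) * p ^ c (rev_ord x).
  by rewrite -expfzDr // -cs subrK.
move: (p ^ (c y - c x)) e1 e2 => E e1 e2.
case: eqP => [->|_]; case: eqP => [e|_] /=.
- rewrite -e e1 in e2; ring: e1 (esym e2).
- by ring: e1.
- by rewrite e; ring: e2.
- by ring.
Qed.
End Recursion.
Global Opaque op diag gd del.

Local Transparent op diag gd del.
(** * Relations of U *)

Section OpRelations.
Variables (n : nat) (K : fieldType).

Local Notation letter := 'I_(n.*2).+1.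
Local Notation T d := {ffun multi n d -> K^o}.
Implicit Types (x y z w a b : letter) (p q : K).

Definition gdw q (s : bool) b a : K :=
  (if a == b then (if s then q else q^-1) else 1) *
  (if a == rev_ord b then (if s then q else q^-1) else 1).

Lemma gdwE q s b a : q != 0 ->
  gdw q s b a = q ^ (if s then cnt b a else - cnt b a).
Proof.
move=> q0; rewrite /gdw /cnt; case: (a == b); case: (a == rev_ord b); case: s => /=;
  by rewrite ?opprD ?oppr0 ?expfzDr // ?expr0z ?exprN1 ?expr1z ?mulr1.
Qed.

Lemma del_gd q s b d a (t : T d.+1) : q != 0 ->
  del a (gd q s b t) = gdw q s b a *: gd q s b (del a t).
Proof. by move=> q0; rewrite /gd del_diag // gdwE. Qed.

Lemma gd_op q s b p x y d (t : T d) : q != 0 ->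
  gd q s b (op p x y t) = (gdw q s b y / gdw q s b x) *: op p x y (gd q s b t).
Proof.
move=> q0; rewrite /gd diag_op //; last first.
  have cr c : cnt b (rev_ord c) = cnt b c.
    rewrite /cnt (inj_eq rev_ord_inj) addrC; congr (_%:Z + _).
    by rewrite -{1}(rev_ordK b) (inj_eq rev_ord_inj).
  by rewrite !cr.
by rewrite !gdwE // expfzDr // invr_expz.
Qed.

Lemma gdC q s b p s' b' d (t : T d) :
  gd q s b (gd p s' b' t) = gd p s' b' (gd q s b t).
Proof. by apply/ffunP => r; rewrite !ffunE mulrCA. Qed.

Lemma gdK q s b d (t : T d) : q != 0 -> gd q s b (gd q (~~ s) b t) = t.
Proof.
move=> q0; rewrite /gd diagD // -[RHS](diag0 q); apply: eq_diag => a.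
by case: s => /=; rewrite ?subrr ?addNr.
Qed.

End OpRelations.
Local Opaque op diag gd del.

(** The two letters lie in different orbits of the involution [rev_ord]; either one may still be the
    middle letter. *)
Definition farl n (x y : 'I_(n.*2).+1) := (x != y) && (x != rev_ord y).

Lemma farlE n (x y : 'I_(n.*2).+1) : farl x y ->
  [/\ x != y, x != rev_ord y, rev_ord x != y & rev_ord x != rev_ord y].
Proof.
case/andP=> xy xy'; split => //; first by rewrite -(inj_eq rev_ord_inj) rev_ordK.
by rewrite (inj_eq rev_ord_inj).
Qed.

Ltac neqs := repeat match goal with
  | H : is_true (?a != ?b) |- context [?a == ?b] => rewrite (negbTE H)
  | H : is_true (?a != ?b) |- context [?b == ?a] => rewrite [b == a]eq_sym (negbTE H)
  end.

Ltac simpc := rewrite ?rev_ordK ?eqxx; neqs;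
  rewrite /= ?(mulr1, mul1r, invr1, scale1r, scale0r, addr0, add0r).
Ltac opcomp := move=> *; rewrite del_op /opw; simpc.
Ltac gdcomp := move=> *; rewrite gd_op /gdw; [simpc|by []].

Section Serre.
Variables (n : nat) (K : fieldType).
Local Notation letter := 'I_(n.*2).+1.
Local Notation T d := {ffun multi n d -> K^o}.
Variables (q : K) (x y z : letter).
Hypotheses (q0 : q != 0) (xy : farl x y) (yz : farl y z) (xz : farl x z)
  (yy : y != rev_ord y).

(** Induction on [d], comparing components for each position of the first letter [a] relative to
    [x], [y], [z] and their mirror images. All [del] and [gd] are pushed inside the [op], so that
    only normal words in the two operators remain; the induction hypothesis eliminates one of them,
    and the coefficients agree in [K]. *)
Lemma serre_op d (t : T d) :
  op q x y (op q x y (op q y z t)) - (q + q^-1) *: op q x y (op q y z (op q x y t))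
  + op q y z (op q x y (op q x y t)) = 0.
Proof.
have [x1 x2 x3 x4] := farlE xy; have [y1 y2 y3 y4] := farlE yz.
have [z1 z2 z3 z4] := farlE xz.
elim: d t => [|d IH] t; first by rewrite !op_0 scaler0 oppr0 !addr0.
apply: del_inj => a.
have {}IH b : op q x y (op q x y (op q y z (del b t))) = (q + q^-1) *: op q x y (op q y z (op q x y (del b t)))
  - op q y z (op q x y (op q x y (del b t))).
  by apply/eqP; rewrite -subr_eq0 opprB addrA addrAC; apply/eqP/IH.
have Ax u : del x (op q x y u) = op q x y (del x u) by opcomp.
have Ax' u : del (rev_ord x) (op q x y u) = op q x y (del (rev_ord x) u) by opcomp.
have Az u : del z (op q x y u) = op q x y (del z u) by opcomp.
have Az' u : del (rev_ord z) (op q x y u) = op q x y (del (rev_ord z) u) by opcomp.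
have Ay u : del y (op q x y u) = q *: op q x y (del y u) + gd q false y (del x u) by opcomp.
have Ay' u : del (rev_ord y) (op q x y u) =
  q^-1 *: op q x y (del (rev_ord y) u) + gd q true y (del (rev_ord x) u) by opcomp.
have Bx u : del x (op q y z u) = op q y z (del x u) by opcomp.
have Bx' u : del (rev_ord x) (op q y z u) = op q y z (del (rev_ord x) u) by opcomp.
have By u : del y (op q y z u) = op q y z (del y u) by opcomp.
have By' u : del (rev_ord y) (op q y z u) = op q y z (del (rev_ord y) u) by opcomp.
have GA (u : T d) : gd q false y (op q x y u) = q^-1 *: op q x y (gd q false y u) by gdcomp.
have GA' (u : T d) : gd q true y (op q x y u) = q *: op q x y (gd q true y u) by gdcomp.
have GB (u : T d) : gd q false y (op q y z u) = q *: op q y z (gd q false y u) by gdcomp; rewrite invrK.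
have GB' (u : T d) : gd q true y (op q y z u) = q^-1 *: op q y z (gd q true y u) by gdcomp.
have ZA s (u : T d) : gd q s z (op q x y u) = op q x y (gd q s z u) by gdcomp.
have GG s s' (u : T d) : gd q s z (gd q s' y u) = gd q s' y (gd q s z u) by exact: gdC.
(* The letter [z] may be the middle one. [kz] is the value of [opw] at [z], [mz] switches on the
   extra term present only in the middle case, and [cz] below is the weight of [z] under [gd]; [kcz]
   and [kmz] are the relations among them that the final computation uses. *)
pose kz := if z == rev_ord z then 1 else q.
pose mz : K := (z == rev_ord z)%:R.
have kz0 : kz != 0 by rewrite /kz; case: ifP => // _; apply: oner_neq0.
have Bz u : del z (op q y z u) = kz *: op q y z (del z u) + gd q false z (del y u)
    + mz *: gd q true z (del (rev_ord y) u).
  by rewrite del_op /opw /kz /mz !eqxx; case: eqP => _ /=; rewrite ?mulfV ?mulr1 ?scale1r.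
have Bz' u : del (rev_ord z) (op q y z u) = kz^-1 *: op q y z (del (rev_ord z) u)
    + mz *: gd q false z (del y u) + gd q true z (del (rev_ord y) u).
  rewrite del_op /opw /kz /mz !eqxx [rev_ord z == z]eq_sym.
  by case: eqP => _ /=; rewrite ?mulfV ?mul1r ?invr1 ?scale1r.
pose cz := if z == rev_ord z then q ^+ 2 else q.
have cz0 : cz != 0 by rewrite /cz; case: ifP; rewrite ?expf_neq0.
have ZB (u : T d) : gd q false z (op q y z u) = cz^-1 *: op q y z (gd q false z u).
  rewrite gd_op // /gdw /cz; simpc.
  by case: eqP; rewrite ?mulr1 ?exprVn // expr2 invfM.
have ZB' (u : T d) : gd q true z (op q y z u) = cz *: op q y z (gd q true z u).
  by rewrite gd_op // /gdw /cz; simpc; case: eqP; rewrite ?mulr1.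
have kcz : cz = q ^+ 2 / kz by rewrite /kz /cz; case: eqP => _; rewrite ?divr1 // expr2 mulfK.
have kmz : kz = 1 \/ mz = 0 by rewrite /kz /mz; case: eqP; [left|right].
case: (eqVneq a x) => [->|ax].
  by rewrite !(Ax, Bx, linE) IH; apply/ffunP => r; rewrite !TE; ring.
case: (eqVneq a (rev_ord x)) => [->|ax'].
  by rewrite !(Ax', Bx', linE) IH; apply/ffunP => r; rewrite !TE; ring.
case: (eqVneq a y) => [->|ay].
  by rewrite !(Ay, By, linE, Ax, Bx, GA, GB) IH; apply/ffunP => r; rewrite !TE; field.
case: (eqVneq a (rev_ord y)) => [->|ay'].
  by rewrite !(Ay', By', linE, Ax', Bx', GA', GB') IH; apply/ffunP => r; rewrite !TE; field.
case: (eqVneq a z) => [->|az].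
  rewrite !(Az, Bz, linE, Ax, Ax', Bx, Bx', Ay, Ay', By, By', ZA, GA, GA', GB, GB', GG, ZB, ZB') IH; apply/ffunP => r; rewrite !TE.
  by rewrite ?kcz; case: kmz => ->; field; rewrite ?oner_neq0 ?kz0 ?q0 //.
case: (eqVneq a (rev_ord z)) => [->|az'].
  rewrite !(Az', Bz', linE, Ax, Ax', Bx, Bx', Ay, Ay', By, By', ZA, GA, GA', GB, GB', GG, ZB, ZB') IH; apply/ffunP => r; rewrite !TE.
  by rewrite ?kcz; case: kmz => ->; field; rewrite ?oner_neq0 ?kz0 ?q0 //.
have Aa u : del a (op q x y u) = op q x y (del a u) by opcomp.
have Ba u : del a (op q y z u) = op q y z (del a u) by opcomp.
by rewrite !(Aa, Ba, linE) IH; apply/ffunP => r; rewrite !TE; ring.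
Qed.

(** The mirror relation, where the operator with target [z] is repeated. It needs its own
    computation because the hypotheses and the middle case of [z] are not symmetric in the two
    operators. *)
Lemma serre_op' d (t : T d) :
  op q y z (op q y z (op q x y t)) - (q + q^-1) *: op q y z (op q x y (op q y z t))
  + op q x y (op q y z (op q y z t)) = 0.
Proof.
have [x1 x2 x3 x4] := farlE xy; have [y1 y2 y3 y4] := farlE yz.
have [z1 z2 z3 z4] := farlE xz.
elim: d t => [|d IH] t; first by rewrite !op_0 scaler0 oppr0 !addr0.
apply: del_inj => a.
have {}IH b : op q y z (op q y z (op q x y (del b t))) = (q + q^-1) *: op q y z (op q x y (op q y z (del b t)))
  - op q x y (op q y z (op q y z (del b t))).
  by apply/eqP; rewrite -subr_eq0 opprB addrA addrAC; apply/eqP/IH.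
have Ax u : del x (op q x y u) = op q x y (del x u) by opcomp.
have Ax' u : del (rev_ord x) (op q x y u) = op q x y (del (rev_ord x) u) by opcomp.
have Az u : del z (op q x y u) = op q x y (del z u) by opcomp.
have Az' u : del (rev_ord z) (op q x y u) = op q x y (del (rev_ord z) u) by opcomp.
have Ay u : del y (op q x y u) = q *: op q x y (del y u) + gd q false y (del x u) by opcomp.
have Ay' u : del (rev_ord y) (op q x y u) =
  q^-1 *: op q x y (del (rev_ord y) u) + gd q true y (del (rev_ord x) u) by opcomp.
have Bx u : del x (op q y z u) = op q y z (del x u) by opcomp.
have Bx' u : del (rev_ord x) (op q y z u) = op q y z (del (rev_ord x) u) by opcomp.
have By u : del y (op q y z u) = op q y z (del y u) by opcomp.
have By' u : del (rev_ord y) (op q y z u) = op q y z (del (rev_ord y) u) by opcomp.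
have GA (u : T d) : gd q false y (op q x y u) = q^-1 *: op q x y (gd q false y u) by gdcomp.
have GA' (u : T d) : gd q true y (op q x y u) = q *: op q x y (gd q true y u) by gdcomp.
have GB (u : T d) : gd q false y (op q y z u) = q *: op q y z (gd q false y u) by gdcomp; rewrite invrK.
have GB' (u : T d) : gd q true y (op q y z u) = q^-1 *: op q y z (gd q true y u) by gdcomp.
have ZA s (u : T d) : gd q s z (op q x y u) = op q x y (gd q s z u) by gdcomp.
have GG s s' (u : T d) : gd q s z (gd q s' y u) = gd q s' y (gd q s z u) by exact: gdC.
pose kz := if z == rev_ord z then 1 else q.
pose mz : K := (z == rev_ord z)%:R.
have kz0 : kz != 0 by rewrite /kz; case: ifP => // _; apply: oner_neq0.
have Bz u : del z (op q y z u) = kz *: op q y z (del z u) + gd q false z (del y u)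
    + mz *: gd q true z (del (rev_ord y) u).
  by rewrite del_op /opw /kz /mz !eqxx; case: eqP => _ /=; rewrite ?mulfV ?mulr1 ?scale1r.
have Bz' u : del (rev_ord z) (op q y z u) = kz^-1 *: op q y z (del (rev_ord z) u)
    + mz *: gd q false z (del y u) + gd q true z (del (rev_ord y) u).
  rewrite del_op /opw /kz /mz !eqxx [rev_ord z == z]eq_sym.
  by case: eqP => _ /=; rewrite ?mulfV ?mul1r ?invr1 ?scale1r.
pose cz := if z == rev_ord z then q ^+ 2 else q.
have cz0 : cz != 0 by rewrite /cz; case: ifP; rewrite ?expf_neq0.
have ZB (u : T d) : gd q false z (op q y z u) = cz^-1 *: op q y z (gd q false z u).
  rewrite gd_op // /gdw /cz; simpc.
  by case: eqP; rewrite ?mulr1 ?exprVn // expr2 invfM.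
have ZB' (u : T d) : gd q true z (op q y z u) = cz *: op q y z (gd q true z u).
  by rewrite gd_op // /gdw /cz; simpc; case: eqP; rewrite ?mulr1.
have kcz : cz = q ^+ 2 / kz by rewrite /kz /cz; case: eqP => _; rewrite ?divr1 // expr2 mulfK.
have kmz : kz = 1 \/ mz = 0 by rewrite /kz /mz; case: eqP; [left|right].
case: (eqVneq a x) => [->|ax].
  by rewrite !(Ax, Bx, linE) IH; apply/ffunP => r; rewrite !TE; ring.
case: (eqVneq a (rev_ord x)) => [->|ax'].
  by rewrite !(Ax', Bx', linE) IH; apply/ffunP => r; rewrite !TE; ring.
case: (eqVneq a y) => [->|ay].
  by rewrite !(Ay, By, linE, Ax, Bx, GA, GB) IH; apply/ffunP => r; rewrite !TE; field.
case: (eqVneq a (rev_ord y)) => [->|ay'].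
  by rewrite !(Ay', By', linE, Ax', Bx', GA', GB') IH; apply/ffunP => r; rewrite !TE; field.
case: (eqVneq a z) => [->|az].
  rewrite !(Az, Bz, linE, Ax, Ax', Bx, Bx', Ay, Ay', By, By', ZA, GA, GA', GB, GB', GG, ZB, ZB') IH; apply/ffunP => r; rewrite !TE.
  by rewrite ?kcz; case: kmz => ->; field; rewrite ?oner_neq0 ?kz0 ?q0 //.
case: (eqVneq a (rev_ord z)) => [->|az'].
  rewrite !(Az', Bz', linE, Ax, Ax', Bx, Bx', Ay, Ay', By, By', ZA, GA, GA', GB, GB', GG, ZB, ZB') IH; apply/ffunP => r; rewrite !TE.
  by rewrite ?kcz; case: kmz => ->; field; rewrite ?oner_neq0 ?kz0 ?q0 //.
have Aa u : del a (op q x y u) = op q x y (del a u) by opcomp.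
have Ba u : del a (op q y z u) = op q y z (del a u) by opcomp.
by rewrite !(Aa, Ba, linE) IH; apply/ffunP => r; rewrite !TE; ring.
Qed.

End Serre.

Section Commutations.
Variables (n : nat) (K : fieldType).
Local Notation letter := 'I_(n.*2).+1.
Local Notation T d := {ffun multi n d -> K^o}.
Implicit Types (x y z w a : letter) (q p : K).

Lemma gdV q s b d (t : T d) : gd q^-1 s b t = gd q (~~ s) b t.
Proof.
apply/ffunP => r; rewrite [LHS]ffunE [RHS]ffunE exprz_inv; congr (_ ^ _ * _).
rewrite -sumrN; apply: eq_bigr => k _.
by case: s; rewrite ?opprK.
Qed.

Lemma op_far q p x y z w d (t : T d) : q != 0 -> p != 0 ->
    farl x z -> farl x w -> farl y z -> farl y w ->
  op q x y (op p z w t) = op p z w (op q x y t).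
Proof.
move=> q0 p0 /farlE[? ? ? ?] /farlE[? ? ? ?] /farlE[? ? ? ?] /farlE[? ? ? ?].
elim: d t => [|d IH] t; first by rewrite !op_0.
have Gz s (u : T d) : gd q s y (op p z w u) = op p z w (gd q s y u) by gdcomp.
have Gx s (u : T d) : gd p s w (op q x y u) = op q x y (gd p s w u) by gdcomp.
have Bx u : del x (op p z w u) = op p z w (del x u) by opcomp.
have Bx' u : del (rev_ord x) (op p z w u) = op p z w (del (rev_ord x) u) by opcomp.
have By u : del y (op p z w u) = op p z w (del y u) by opcomp.
have By' u : del (rev_ord y) (op p z w u) = op p z w (del (rev_ord y) u) by opcomp.
have Az u : del z (op q x y u) = op q x y (del z u) by opcomp.
have Az' u : del (rev_ord z) (op q x y u) = op q x y (del (rev_ord z) u) by opcomp.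
apply: del_inj => a; rewrite !(del_op _ _ _ a).
rewrite Bx Bx' Az Az' !linE !Gx !Gz IH; apply/ffunP => r; rewrite !TE /opw.
case: (eqVneq a y) => [->|ay]; first by simpc; rewrite !mul0r; ring.
case: (eqVneq a (rev_ord y)) => [->|ay']; first by simpc; rewrite !mul0r; ring.
by simpc; rewrite !mul0r; ring.
Qed.

(** The case of [E_i] and [F_(i+1)], which both create the letter [y]. Their parameters are inverse
    to each other, so the powers of [q] in the cross terms at [y] agree in the two orders. *)
Lemma op_same_target q x y z d (t : T d) : q != 0 ->
    farl x y -> farl y z -> farl x z -> y != rev_ord y ->
  op q x y (op q^-1 z y t) = op q^-1 z y (op q x y t).
Proof.
move=> q0 /farlE[? ? ? ?] /farlE[? ? ? ?] /farlE[? ? ? ?] ?.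
have qi0 : q^-1 != 0 by rewrite invr_eq0.
elim: d t => [|d IH] t; first by rewrite !op_0.
have GB (u : T d) : gd q false y (op q^-1 z y u) = q^-1 *: op q^-1 z y (gd q false y u) by gdcomp.
have GB' (u : T d) : gd q true y (op q^-1 z y u) = q *: op q^-1 z y (gd q true y u) by gdcomp.
have GA (u : T d) : gd q false y (op q x y u) = q^-1 *: op q x y (gd q false y u) by gdcomp.
have GA' (u : T d) : gd q true y (op q x y u) = q *: op q x y (gd q true y u) by gdcomp.
have Bx u : del x (op q^-1 z y u) = op q^-1 z y (del x u) by opcomp.
have Bx' u : del (rev_ord x) (op q^-1 z y u) = op q^-1 z y (del (rev_ord x) u) by opcomp.
have Az u : del z (op q x y u) = op q x y (del z u) by opcomp.
have Az' u : del (rev_ord z) (op q x y u) = op q x y (del (rev_ord z) u) by opcomp.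
apply: del_inj => a; rewrite !(del_op _ _ _ a) !gdV /=.
rewrite Bx Bx' Az Az' !linE !(GA, GA', GB, GB', gdV) IH; apply/ffunP => r.
rewrite !TE /opw !invrK.
case: (eqVneq a y) => [->|ay]; first by simpc; rewrite !mul0r; field.
case: (eqVneq a (rev_ord y)) => [->|ay']; first by simpc; rewrite !mul0r; field.
by simpc; rewrite !mul0r; ring.
Qed.

(** The case of [E_i] and [F_(i-1)], which both consume the letter [x]. The target [y] may be the
    middle letter. *)
Lemma op_same_source q x y z d (t : T d) : q != 0 ->
    farl x y -> farl y z -> farl x z -> x != rev_ord x ->
  op q x y (op q^-1 x z t) = op q^-1 x z (op q x y t).
Proof.
move=> q0 /farlE[? ? ? ?] /farlE[? ? ? ?] /farlE[? ? ? ?] ?.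
elim: d t => [|d IH] t; first by rewrite !op_0.
have GB s (u : T d) : gd q s y (op q^-1 x z u) =
  (gdw q s y x)^-1 *: op q^-1 x z (gd q s y u).
  by rewrite gd_op // /gdw; simpc.
have GA s (u : T d) : gd q s z (op q x y u) =
  (gdw q s z x)^-1 *: op q x y (gd q s z u).
  by rewrite gd_op // /gdw; simpc.
apply: del_inj => a; rewrite !del_op !gdV !linE !(GA, GB, gdV) IH.
apply/ffunP => r; rewrite !TE /opw /gdw !invrK.
case: (eqVneq a y) => [->|ay].
  by case: (eqVneq y (rev_ord y)) => [<-|yy]; simpc; rewrite !mul0r; field.
case: (eqVneq a (rev_ord y)) => [->|ay']; first by simpc; rewrite !mul0r; field.
by simpc; rewrite !mul0r; field.
Qed.

End Commutations.

Section MiddleRelations.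
Variables (n : nat) (K : fieldType).
Local Notation letter := 'I_(n.*2).+1.
Local Notation T d := {ffun multi n d -> K^o}.
Variables (q : K) (x y : letter).
Hypotheses (q0 : q != 0) (q2 : q ^+ 2 - 1 != 0) (xy : farl x y) (xx : x != rev_ord x).
Local Notation A := (op q x y).
Local Notation B := (op q^-1 y x).

(** The usual rank one computation: terms in which the two operators change different letters
    cancel, and those in which one undoes the other produce the diagonal right-hand side. *)
Lemma commutator_op d (t : T d) : y != rev_ord y ->
  A (B t) - B (A t) = (q - q^-1)^-1 *:
    (gd q false x (gd q true y t) - gd q true x (gd q false y t)).
Proof.
move=> yy; have [? ? ? ?] := farlE xy.
elim: d t => [|d IH] t.
  rewrite !op_0 subr0; suff G s b (u : T 0) : gd q s b u = u by rewrite !G subrr scaler0.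
  by apply/ffunP => r; rewrite ffunE big_ord0 expr0z mul1r.
have {}IH (u : T d) : A (B u) = B (A u) + (q - q^-1)^-1 *:
    (gd q false x (gd q true y u) - gd q true x (gd q false y u)).
  by rewrite -IH addrC subrK.
have Ax u : del x (A u) = A (del x u) by opcomp.
have Ax' u : del (rev_ord x) (A u) = A (del (rev_ord x) u) by opcomp.
have Ay u : del y (A u) = q *: A (del y u) + gd q false y (del x u) by opcomp.
have Ay' u : del (rev_ord y) (A u) =
  q^-1 *: A (del (rev_ord y) u) + gd q true y (del (rev_ord x) u) by opcomp.
have By u : del y (B u) = B (del y u) by opcomp.
have By' u : del (rev_ord y) (B u) = B (del (rev_ord y) u) by opcomp.
have Bx u : del x (B u) = q^-1 *: B (del x u) + gd q true x (del y u).
  by rewrite del_op !gdV /opw; simpc.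
have Bx' u : del (rev_ord x) (B u) =
  q *: B (del (rev_ord x) u) + gd q false x (del (rev_ord y) u).
  by rewrite del_op !gdV /opw; simpc; rewrite invrK.
have XA (u : T d) : gd q false x (A u) = q *: A (gd q false x u).
  by rewrite gd_op // /gdw; simpc; rewrite invrK.
have XA' (u : T d) : gd q true x (A u) = q^-1 *: A (gd q true x u) by gdcomp.
have YB (u : T d) : gd q false y (B u) = q *: B (gd q false y u).
  by rewrite gd_op // /gdw; simpc; rewrite invrK.
have YB' (u : T d) : gd q true y (B u) = q^-1 *: B (gd q true y u) by gdcomp.
have GG s s' (u : T d) : gd q s y (gd q s' x u) = gd q s' x (gd q s y u) by exact: gdC.
have D s b a u : del a (gd q s b u) = gdw q s b a *: gd q s b (del a u) by exact: del_gd.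
apply: del_inj => a.
case: (eqVneq a x) => [->|ax].
  rewrite !(Ax, Bx, Ay, D, linE, XA, XA', YB, YB', GG) IH /gdw; simpc.
  by apply/ffunP => r; rewrite !TE; field; rewrite q0 q2.
case: (eqVneq a (rev_ord x)) => [->|ax'].
  rewrite !(Ax', Bx', Ay', D, linE, XA, XA', YB, YB', GG) IH /gdw; simpc.
  by apply/ffunP => r; rewrite !TE; field; rewrite q0 q2.
case: (eqVneq a y) => [->|ay].
  rewrite !(Ay, By, Bx, D, linE, XA, XA', YB, YB', GG) IH /gdw; simpc.
  by apply/ffunP => r; rewrite !TE; field; rewrite q0 q2.
case: (eqVneq a (rev_ord y)) => [->|ay'].
  rewrite !(Ay', By', Bx', D, linE, XA, XA', YB, YB', GG) IH /gdw; simpc.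
  by apply/ffunP => r; rewrite !TE; field; rewrite q0 q2.
have Aa u : del a (A u) = A (del a u) by opcomp.
have Ba u : del a (B u) = B (del a u) by opcomp.
rewrite !(Aa, Ba, D, linE) IH /gdw; simpc.
by apply/ffunP => r; rewrite !TE; ring.
Qed.

End MiddleRelations.

Section MiddleNode.
Variables (n : nat) (K : fieldType).
Local Notation letter := 'I_(n.*2).+1.
Local Notation T d := {ffun multi n d -> K^o}.
Variables (q : K) (x y : letter).
Hypotheses (q0 : q != 0) (q2 : q ^+ 2 - 1 != 0) (xy : farl x y) (xx : x != rev_ord x)
  (yy : rev_ord y = y).
Local Notation A := (op q x y).
Local Notation B := (op q^-1 y x).

Let yx : y != x. Proof. by rewrite eq_sym; case/andP: xy. Qed.
Let yx' : y != rev_ord x. Proof. by rewrite -yy (inj_eq rev_ord_inj). Qed.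

Let Ax d (u : T d.+1) : del x (A u) = A (del x u).
Proof. by rewrite del_op /opw yy; simpc. Qed.
Let Ax' d (u : T d.+1) : del (rev_ord x) (A u) = A (del (rev_ord x) u).
Proof. by rewrite del_op /opw yy; simpc. Qed.
Let Ay d (u : T d.+1) :
  del y (A u) = A (del y u) + gd q false y (del x u) + gd q true y (del (rev_ord x) u).
Proof. by rewrite del_op /opw yy; simpc; rewrite mulfV // scale1r. Qed.
Let By d (u : T d.+1) : del y (B u) = B (del y u).
Proof. by rewrite del_op /opw; simpc. Qed.
Let Bx d (u : T d.+1) : del x (B u) = q^-1 *: B (del x u) + gd q true x (del y u).
Proof. by rewrite del_op !gdV /opw; simpc. Qed.
Let Bx' d (u : T d.+1) :
  del (rev_ord x) (B u) = q *: B (del (rev_ord x) u) + gd q false x (del y u).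
Proof. by rewrite del_op !gdV /opw; simpc; rewrite invrK yy. Qed.
Let XA d (u : T d) : gd q false x (A u) = q *: A (gd q false x u).
Proof. by rewrite gd_op // /gdw; simpc; rewrite invrK. Qed.
Let XA' d (u : T d) : gd q true x (A u) = q^-1 *: A (gd q true x u).
Proof. by gdcomp. Qed.
Let XB d (u : T d) : gd q false x (B u) = q^-1 *: B (gd q false x u).
Proof. by gdcomp. Qed.
Let XB' d (u : T d) : gd q true x (B u) = q *: B (gd q true x u).
Proof. by gdcomp. Qed.
Let YA d (u : T d) : gd q false y (A u) = q ^- 2 *: A (gd q false y u).
Proof. by rewrite gd_op // /gdw yy; simpc; rewrite -invfM. Qed.
Let YA' d (u : T d) : gd q true y (A u) = q ^+ 2 *: A (gd q true y u).
Proof. by rewrite gd_op // /gdw yy; simpc. Qed.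
Let YB d (u : T d) : gd q false y (B u) = q ^+ 2 *: B (gd q false y u).
Proof. by rewrite gd_op // /gdw yy; simpc; rewrite -invfM invrK. Qed.
Let YB' d (u : T d) : gd q true y (B u) = q ^- 2 *: B (gd q true y u).
Proof. by rewrite gd_op // /gdw yy; simpc. Qed.
Let GG s s' d (u : T d) : gd q s y (gd q s' x u) = gd q s' x (gd q s y u).
Proof. exact: gdC. Qed.
Let D s b a d (u : T d.+1) : del a (gd q s b u) = gdw q s b a *: gd q s b (del a u).
Proof. exact: del_gd. Qed.
Let GX d (u : T d) : gd q true x (gd q false x u) = u.
Proof. exact: (@gdK _ _ q true). Qed.
Let GX' d (u : T d) : gd q false x (gd q true x u) = u.
Proof. exact: (@gdK _ _ q false). Qed.
Let GY d (u : T d) : gd q true y (gd q false y u) = u.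
Proof. exact: (@gdK _ _ q true). Qed.
Let GY' d (u : T d) : gd q false y (gd q true y u) = u.
Proof. exact: (@gdK _ _ q false). Qed.

Let G0 s b (u : T 0) : gd q s b u = u.
Proof. by apply/ffunP => r; rewrite ffunE big_ord0 expr0z mul1r. Qed.

Let rules := (Ax, Ax', Ay, Bx, Bx', By, D, linE, XA, XA', XB, XB', YA, YA', YB, YB', GG,
  GX, GX', GY, GY').

(** With [y] the middle letter, [B] can return it to [x] or to [rev_ord x], so [B A] contains a sign
    change and the commutator of [A] and [B] is not diagonal. Only a cubic relation survives; it is
    checked by the same induction on the first letter. *)
Lemma raise_raise_lower_op d (t : T d) :
  A (A (B t)) + B (A (A t)) = (q + q^-1) *: (A (B (A t))
    - A (q *: gd q false x (gd q true y t) + q^-1 *: gd q true x (gd q false y t))).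
Proof.
have [? ? ? ?] := farlE xy.
elim: d t => [|d IH] t; first by rewrite !op_0 subr0 scaler0 addr0.
have {}IH (u : T d) : A (A (B u)) = - B (A (A u)) + (q + q^-1) *: (A (B (A u))
    - A (q *: gd q false x (gd q true y u) + q^-1 *: gd q true x (gd q false y u))).
  by rewrite -IH addrCA addNr addr0.
apply: del_inj => a.
case: (eqVneq a x) => [->|ax].
  rewrite !rules IH !rules /gdw yy; simpc.
  by apply/ffunP => r; rewrite !TE; field; rewrite ?q0 ?q2.
case: (eqVneq a (rev_ord x)) => [->|ax'].
  rewrite !rules IH !rules /gdw yy; simpc.
  by apply/ffunP => r; rewrite !TE; field; rewrite ?q0 ?q2.
case: (eqVneq a y) => [->|ay].
  rewrite !rules IH !rules /gdw yy; simpc.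
  by apply/ffunP => r; rewrite !TE; field; rewrite ?q0 ?q2.
have Aa u : del a (A u) = A (del a u) by rewrite del_op /opw yy; simpc.
have Ba u : del a (B u) = B (del a u) by opcomp.
rewrite !(Aa, Ba, D, linE) IH !linE /gdw yy; simpc.
by apply/ffunP => r; rewrite !TE; ring.
Qed.

Lemma lower_lower_raise_op d (t : T d) :
  B (B (A t)) + A (B (B t)) = (q + q^-1) *: (B (A (B t))
    - (q *: gd q false x (gd q true y (B t)) + q^-1 *: gd q true x (gd q false y (B t)))).
Proof.
have [? ? ? ?] := farlE xy.
elim: d t => [|d IH] t; first by rewrite !op_0 !linE !scaler0 addr0 subr0 scaler0.
have {}IH (u : T d) : B (B (A u)) = - A (B (B u)) + (q + q^-1) *: (B (A (B u))
    - (q *: gd q false x (gd q true y (B u)) + q^-1 *: gd q true x (gd q false y (B u)))).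
  by rewrite -IH addrCA addNr addr0.
apply: del_inj => a.
case: (eqVneq a x) => [->|ax].
  rewrite !rules IH !rules /gdw yy; simpc.
  by apply/ffunP => r; rewrite !TE; field; rewrite ?q0 ?q2.
case: (eqVneq a (rev_ord x)) => [->|ax'].
  rewrite !rules IH !rules /gdw yy; simpc.
  by apply/ffunP => r; rewrite !TE; field; rewrite ?q0 ?q2.
case: (eqVneq a y) => [->|ay].
  rewrite !rules IH !rules /gdw yy; simpc.
  by apply/ffunP => r; rewrite !TE; field; rewrite ?q0 ?q2.
have Aa u : del a (A u) = A (del a u) by rewrite del_op /opw yy; simpc.
have Ba u : del a (B u) = B (del a u) by opcomp.
rewrite !(Aa, Ba, D, linE) IH ?linE /gdw yy; simpc.
by apply/ffunP => r; rewrite !TE; ring.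
Qed.

End MiddleNode.

(** * The projections J and their relations with raising and lowering *)

Section JOperators.
Variables (n : nat) (K : fieldType).
Local Notation letter := 'I_(n.*2).+1.
Local Notation T d := {ffun multi n d -> K^o}.
Implicit Types (x y a : letter) (q : K).

(** The type is computed letter by letter: a middle letter fixes it to [None], and otherwise a
    letter beyond the middle flips the parity. Once the middle is excluded, [<=] and [<] count the
    same letters. *)
Lemma J_type_mcons d a (r : multi n d) : J_type (mcons a r) =
  if a == n :> nat then None
  else if (n < a)%N then omap negb (J_type r) else J_type r.
Proof.
rewrite /J_type.
have -> : [exists j, mcons a r j == n :> nat] =
    (a == n :> nat) || [exists j, r j == n :> nat].
  apply/existsP/orP => [[j]|[an|/existsP[j jn]]].
  - case: (unliftP ord0 j) => [k|] ->; rewrite ?mcons0 ?mconsS => h.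
      by right; apply/existsP; exists k.
    by left.
  - by exists ord0; rewrite mcons0.
  - by exists (lift ord0 j); rewrite mconsS.
have -> : #|[pred j | (n <= mcons a r j)%N]| =
    ((n <= a) + #|[pred j | (n <= r j)%N]|)%N.
  rewrite -!sum1_card !big_mkcond big_ord_recl /= inE mcons0 /=.
  rewrite [in RHS]big_mkcond; congr addn.
  by apply: eq_bigr => j _; rewrite !inE mconsS.
case: eqP => //= /eqP an; case: ifP => _; first by rewrite !if_same.
by rewrite leq_eqVlt eq_sym (negbTE an) /=; case: ltnP => _; rewrite oddD //= oddb.
Qed.

Definition jp d (al : option bool) (t : T d) : T d :=
  [ffun r : multi n d => (J_type r == al)%:R * t r].

Lemma jp_is_linear d al : linear (@jp d al).
Proof. by move=> k t u; apply/ffunP => r; rewrite !(ffunE, TE) mulrDr mulrCA. Qed.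
HB.instance Definition _ d al :=
  GRing.isLinear.Build K (T d) (T d) _ (@jp d al) (@jp_is_linear d al).

Lemma jpD' d al t u : @jp d al (t + u) = jp al t + jp al u.
Proof. exact: linearD. Qed.
Lemma jpN' d al t : @jp d al (- t) = - jp al t.
Proof. exact: linearN. Qed.
Lemma jpZ' d al k t : @jp d al (k *: t) = k *: jp al t.
Proof. exact: linearZ. Qed.
Lemma jp0' d al : @jp d al 0 = 0.
Proof. exact: linear0. Qed.
Definition jlinE := (linE, jpD', jpN', jpZ', jp0').

Lemma jp_gd q s b d al (t : T d) : jp al (gd q s b t) = gd q s b (jp al t).
Proof.
by apply/ffunP => r; rewrite [LHS]ffunE [gd _ _ _ _ _]ffunE
  [RHS]ffunE [jp _ _ _]ffunE mulrCA.
Qed.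

Lemma del_jp d a s (t : T d.+1) : a != n :> nat ->
  del a (jp (Some s) t) = jp (Some ((n < a)%N (+) s)) (del a t).
Proof.
move=> an; apply/ffunP => r; rewrite [LHS]ffunE [LHS]ffunE [RHS]ffunE.
rewrite [del a t r]ffunE J_type_mcons (negbTE an); congr (_%:R * _).
by case: ltnP => _; case: (J_type r) => // [[]]; case: s.
Qed.

Lemma del_jp_mid d a s (t : T d.+1) : a = n :> nat ->
  del a (jp (Some s) t) = 0.
Proof.
move=> an; apply/ffunP => r; rewrite ffunE [LHS]ffunE [RHS]ffunE.
by rewrite J_type_mcons an eqxx mul0r.
Qed.

(** The source and the target lie strictly on the same side of the middle, so the operator never
    changes the parity. *)
Lemma jp_op_side q x y d s (t : T d) : (x < n)%N -> (y < n)%N ->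
  jp (Some s) (op q x y t) = op q x y (jp (Some s) t).
Proof.
move=> xn yn; elim: d s t => [|d IH] s t; first by rewrite !op_0 jp0'.
apply: del_inj => a; rewrite (del_op _ _ _ a).
have side (z : letter) : (z < n)%N -> [/\ z != n :> nat, (n < z)%N = false,
    rev_ord z != n :> nat & (n < rev_ord z)%N].
  by case: z => z /= zN; split; lia.
have [x1 x2 x3 x4] := side x xn; have [y1 y2 y3 y4] := side y yn.
case: (eqVneq (a : nat) n) => [an|an].
  rewrite !(del_jp_mid _ _ an) linE scaler0 !add0r.
  have -> : a == y = false by apply/eqP => e; rewrite -e an ltnn in yn.
  have -> : a == rev_ord y = false by apply/eqP => e; move: y3; rewrite -e an eqxx.
  by rewrite !scale0r addr0.
rewrite !(del_jp _ _ an) !(del_jp _ _ x1) !(del_jp _ _ x3) del_op !jlinE !jp_gd IH; congr (_ + _ + _).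
  by case: eqP => [->|_] /=; rewrite ?scale0r // x2 y2.
by case: eqP => [->|_]; rewrite ?scale0r // x4 y4.
Qed.

Lemma jp_op_into_mid q x y d s (t : T d) : y = n :> nat ->
  jp (Some s) (op q x y t) = 0.
Proof.
move=> yn; elim: d s t => [|d IH] s t; first by rewrite !op_0 jp0'.
apply: del_inj => a; rewrite linE.
case: (eqVneq (a : nat) n) => [an|an]; first by rewrite del_jp_mid.
rewrite del_jp // del_op !jlinE IH.
have -> : a == y = false by apply/eqP => e; move: an; rewrite e yn eqxx.
have -> : a == rev_ord y = false.
  by apply/eqP => e; move: an; rewrite e /= yn; apply/negP; lia.
by rewrite !scale0r scaler0 !addr0.
Qed.

Lemma op_jp_from_mid q x y d s (t : T d) : y = n :> nat ->
  op q y x (jp (Some s) t) = 0.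
Proof.
move=> yn; elim: d s t => [|d IH] s t; first by rewrite !op_0.
have yn' : rev_ord y = n :> nat by rewrite /= yn; lia.
apply: del_inj => a; rewrite del_op !(del_jp_mid _ _ yn) ?(del_jp_mid _ _ yn').
rewrite !jlinE !scaler0 !addr0.
case: (eqVneq (a : nat) n) => [an|an]; first by rewrite del_jp_mid // linE scaler0.
by rewrite del_jp // IH scaler0.
Qed.

Section JFE.
Variables (q : K) (x y : letter).
Hypotheses (q0 : q != 0) (q2 : q ^+ 2 - 1 != 0) (yn : y = n :> nat) (xn : (x < n)%N).
Local Notation A := (op q x y).
Local Notation B := (op q^-1 y x).

(** Raising to the middle and lowering again produces the original letter and its mirror image, and
    the mirror exchanges the two parities. Projecting onto one parity after the operation and onto
    the other before it removes the mirror part from the difference and leaves a diagonal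
    operator. *)
Lemma jp_lower_raise d s (t : T d) :
  jp (Some s) (B (A t)) - B (A (jp (Some (~~ s)) t)) =
  (q - q^-1)^-1 *: (gd q true x (gd q false y (jp (Some s) t - jp (Some (~~ s)) t))
                   - gd q false x (gd q true y (jp (Some s) t - jp (Some (~~ s)) t))).
Proof.
have yy : rev_ord y = y by apply/val_inj; rewrite /= yn; lia.
have xy : farl x y by rewrite /farl yy andbb -val_eqE /= yn neq_ltn xn.
have [x1 x2 x3 x4] := farlE xy.
have xx : x != rev_ord x by rewrite -val_eqE /=; apply/negP; lia.
have xne : x != n :> nat by rewrite neq_ltn xn.
have xne' : rev_ord x != n :> nat by move: xn; rewrite /=; lia.
have xl : (n < x)%N = false by apply/negbTE; rewrite -leqNgt ltnW.
have xl' : (n < rev_ord x)%N by move: xn; rewrite /=; lia.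
have G0 s' b (u : T 0) : gd q s' b u = u.
  by apply/ffunP => r; rewrite ffunE big_ord0 expr0z mul1r.
elim: d s t => [|d IH] s t; first by rewrite !op_0 !G0 subrr jp0' subr0 scaler0.
have JA s' (u : T d) : jp (Some s') (A u) = 0 by exact: jp_op_into_mid.
have {}IH s' (u : T d) : jp (Some s') (B (A u)) = B (A (jp (Some (~~ s')) u)) +
  (q - q^-1)^-1 *: (gd q true x (gd q false y (jp (Some s') u - jp (Some (~~ s')) u))
                   - gd q false x (gd q true y (jp (Some s') u - jp (Some (~~ s')) u))).
  by rewrite -IH addrC subrK.
have Ax u : del x (A u) = A (del x u) by rewrite del_op /opw yy; simpc.
have Ax' u : del (rev_ord x) (A u) = A (del (rev_ord x) u).
  by rewrite del_op /opw yy; simpc.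
have Ay u : del y (A u) =
    A (del y u) + gd q false y (del x u) + gd q true y (del (rev_ord x) u).
  by rewrite del_op /opw yy; simpc; rewrite mulfV // scale1r.
have Bx u : del x (B u) = q^-1 *: B (del x u) + gd q true x (del y u).
  by rewrite del_op !gdV /opw; simpc.
have Bx' u : del (rev_ord x) (B u) = q *: B (del (rev_ord x) u) + gd q false x (del y u).
  by rewrite del_op !gdV /opw; simpc; rewrite invrK yy.
have D s' b a u : del a (gd q s' b u) = gdw q s' b a *: gd q s' b (del a u).
  exact: del_gd.
have GG s1 s' (u : T d) : gd q s1 y (gd q s' x u) = gd q s' x (gd q s1 y u).
  exact: gdC.
have Jx s' u : del x (jp (Some s') u) = jp (Some s') (del x u) by rewrite del_jp // xl.
have Jx' s' u : del (rev_ord x) (jp (Some s') u) = jp (Some (~~ s')) (del (rev_ord x) u).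
  by rewrite del_jp // xl'.
have Jy s' u : del y (jp (Some s') u) = 0 by rewrite del_jp_mid.
apply: del_inj => a.
case: (eqVneq a x) => [->|ax].
  rewrite !(Ax, Bx, Ay, Jx, Jx', Jy, D, jlinE, jp_gd, JA, negbK) IH !linE ?GG /gdw; simpc.
  by apply/ffunP => r; rewrite !TE; field; rewrite ?q0 ?q2.
case: (eqVneq a (rev_ord x)) => [->|ax'].
  rewrite !(Ax', Bx', Ay, Jx, Jx', Jy, D, jlinE, jp_gd, JA, negbK) IH !linE ?GG /gdw; simpc.
  by rewrite !negbK; apply/ffunP => r; rewrite !TE; field; rewrite ?q0 ?q2.
case: (eqVneq a y) => [->|ay].
  rewrite !(Jy, D, linE).
  have By u : del y (B u) = B (del y u) by opcomp.
  have BJ s' (u : T d) : B (jp (Some s') u) = 0 by exact: op_jp_from_mid.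
  rewrite By Ay !(Jx, Jx', Jy, jlinE, negbK) -!jp_gd !BJ.
  by rewrite !scaler0 !subrr !addr0 ?scaler0 ?subrr ?oppr0.
have Aa u : del a (A u) = A (del a u) by rewrite del_op /opw yy; simpc.
have Ba u : del a (B u) = B (del a u) by opcomp.
have an : a != n :> nat by apply: contra ay => /eqP e; apply/eqP/val_inj; rewrite /= e yn.
rewrite !(Aa, Ba, D, jlinE, del_jp _ _ an) IH !linE /gdw addbN yy; simpc.
by apply/ffunP => r; rewrite !TE; ring.
Qed.

End JFE.
End JOperators.

Definition delta (K : fieldType) (X : finType) (x : X) : {ffun X -> K^o} :=
  [ffun y => (y == x)%:R].

(** * Action on the basis vectors *)

Section BasisAction.
Variables (n : nat) (K : fieldType).
Local Notation letter := 'I_(n.*2).+1.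
Local Notation T d := {ffun multi n d -> K^o}.
Implicit Types (x y a b : letter) (q : K).

Local Notation dl := (delta K).

Definition subst d (r : multi n d) (k : 'I_d) (a : letter) : multi n d :=
  [ffun j => if j == k then a else r j].

Lemma subst_mcons0 d b (r : multi n d) a : subst (mcons b r) ord0 a = mcons a r.
Proof.
apply/ffunP => j; rewrite ffunE; case: (unliftP ord0 j) => [k|] ->.
  by rewrite !mconsS.
by rewrite eqxx mcons0.
Qed.

Lemma subst_mconsS d b (r : multi n d) k a :
  subst (mcons b r) (lift ord0 k) a = mcons b (subst r k a).
Proof.
apply/ffunP => j; rewrite ffunE; case: (unliftP ord0 j) => [l|] ->.
  by rewrite !mconsS ffunE (inj_eq (lift_inj)).
by rewrite !mcons0.
Qed.

Lemma del_delta d a b (r : multi n d) : del a (dl (mcons b r)) = (a == b)%:R *: dl r.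
Proof.
by apply/ffunP => s; rewrite TE !ffunE eq_mcons -natrM mulnb.
Qed.

Lemma gd_delta d q s y (r : multi n d) : gd q s y (dl r) =
  q ^ (if s then \sum_k cnt y (r k) else - \sum_k cnt y (r k)) *: dl r.
Proof.
apply/ffunP => u; rewrite TE !ffunE; case: eqP => [->|_]; last by rewrite !mulr0.
by case: s; rewrite ?sumrN.
Qed.

(** The power of [q] in front of the term that changes position [k]: letters to its left enter
    through [opw], those to its right through [gd]. The flag [s] tells whether the letter acted on
    is at [k] or at the mirror position of [k]. *)
Definition exponent y d (r : multi n d) (s : bool) (k : 'I_d) : int :=
  \sum_(j < d) if (j < k)%N then (r j == y)%:Z - (r j == rev_ord y)%:Z
         else if (k < j)%N then (if s then cnt y (r j) else - cnt y (r j)) else 0.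

Definition op_sum q x y d (r : multi n d) : T d :=
  \sum_k (((r k == x)%:R * q ^ exponent y r false k) *: dl (subst r k y)
     + ((r k == rev_ord x)%:R * q ^ exponent y r true k) *: dl (subst r k (rev_ord y))).

Lemma exponent_mconsS y d b (r : multi n d) s k :
  exponent y (mcons b r) s (lift ord0 k) =
  (b == y)%:Z - (b == rev_ord y)%:Z + exponent y r s k.
Proof.
rewrite /exponent big_ord_recl mcons0; congr (_ + _).
by apply: eq_bigr => j _; rewrite mconsS !lift0 !ltnS.
Qed.

Lemma exponent_mcons0 y d b (r : multi n d) s :
  exponent y (mcons b r) s ord0 = if s then \sum_k cnt y (r k) else - \sum_k cnt y (r k).
Proof.
rewrite /exponent big_ord_recl ltnn add0r -sumrN.
by case: s; apply: eq_bigr => j _; rewrite mconsS.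
Qed.

Lemma op_delta q x y d (r : multi n d) : q != 0 -> op q x y (dl r) = op_sum q x y r.
Proof.
move=> q0; elim: d r => [|d IH] r; first by rewrite op_0 /op_sum big_ord0.
rewrite -(mtailK r); move: (r ord0) (mtail r) => b {}r.
apply: del_inj => a; rewrite (del_op _ _ _ a) !del_delta !linE IH !gd_delta.
rewrite /op_sum [RHS]linear_sum /= big_ord_recl mcons0 subst_mcons0 subst_mcons0.
rewrite !exponent_mcons0 !linE !del_delta -[LHS]addrA addrC; congr (_ + _).
  by rewrite ![_ == b]eq_sym; apply/ffunP => u; rewrite !TE; ring.
rewrite !scaler_sumr; apply: eq_bigr => k _.
rewrite mconsS !subst_mconsS !exponent_mconsS !linE !del_delta !scalerDr !scalerA.
have -> : (a == b)%:R = (a == b)%:R * (a == b)%:R :> K by rewrite -natrM mulnb andbb.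
case: eqP => [->|_]; last by rewrite !(mulr0, mul0r).
have -> : opw q y b = q ^ ((b == y)%:Z - (b == rev_ord y)%:Z).
  rewrite /opw expfzDr // -!invr_expz; case: (b == y); case: (b == rev_ord y); rewrite /= ?expr1z ?expr0z ?invr1 ?mulr1 ?mul1r //.
by rewrite !expfzDr //; congr (_ *: _ + _ *: _); rewrite !mulr1; ring.
Qed.

Lemma ext_lshift d (r : multi n d) k : ext r (lshift d k) = r k.
Proof. by rewrite /ext (unsplitK (inl k)). Qed.

Lemma ext_rshift d (r : multi n d) k : ext r (rshift d k) = rev_ord (r (rev_ord k)).
Proof. by rewrite /ext (unsplitK (inr k)). Qed.

Lemma rev_lshift d (k : 'I_d) : rev_ord (lshift d k) = rshift d (rev_ord k).
Proof. by apply: val_inj => /=; have := ltn_ord k; lia. Qed.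

Lemma sum_ext (V : nmodType) d (F : 'I_(d + d) -> V) :
  \sum_p F p = \sum_k (F (lshift d k) + F (rshift d (rev_ord k))).
Proof.
rewrite big_split_ord big_split /=; congr (_ + _).
by rewrite (reindex_inj rev_ord_inj).
Qed.

Lemma lshift_rshiftF d (k l : 'I_d) : (lshift d k == rshift d l) = false.
Proof. by apply/eqP => /(congr1 val) /=; have := ltn_ord k; lia. Qed.

End BasisAction.

Section FormulasMatch.
Variables (n d : nat) (K : fieldType).
Local Notation letter := 'I_(n.*2).+1.
Local Notation T := {ffun multi n d -> K^o}.
Implicit Types (i : 'I_n) (r : multi n d) (q : K) (k : 'I_d).

Definition lo i : letter := inord i.
Definition hi i : letter := inord i.+1.

Lemma loE i : lo i = i :> nat.
Proof. by rewrite /lo inordK //; have := ltn_ord i; lia. Qed.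
Lemma hiE i : hi i = i.+1 :> nat.
Proof. by rewrite /hi inordK //; have := ltn_ord i; lia. Qed.

Definition E_sum q i r : T :=
  q ^- (\sum_j (ext r j == i.+1 :> nat)) *:
  \sum_(p | ext r p == i :> nat)
     q ^+ (2 * \sum_(j < d + d | (j < p)%N) (ext r j == i.+1 :> nat))
     *: delta K (raise r p).

Definition F_sum q i r : T :=
  q ^- (\sum_j (ext r j == i :> nat)) *:
  \sum_(p | ext r p == i.+1 :> nat)
     q ^+ (2 * \sum_(j < d + d | (p < j)%N) (ext r j == i :> nat))
     *: delta K (lower r p).

Lemma raise_lshift i r k : r k = lo i -> raise r (lshift d k) = subst r k (hi i).
Proof.
move=> rk; apply/ffunP => l; rewrite !ffunE (inj_eq (@lshift_inj _ _)) rev_lshift.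
rewrite lshift_rshiftF; case: eqP => // ->; apply: val_inj.
by rewrite /= inordK ?rk ?loE ?hiE //; have := ltn_ord i; lia.
Qed.

Lemma raise_rshift i r k : r k = rev_ord (lo i) ->
  raise r (rshift d (rev_ord k)) = subst r k (rev_ord (hi i)).
Proof.
move=> rk; apply/ffunP => l; rewrite !ffunE lshift_rshiftF -rev_lshift rev_ordK.
rewrite (inj_eq (@lshift_inj _ _)); case: eqP => // ->; apply: val_inj.
by rewrite /= rk inordK /= ?loE ?hiE //; have := ltn_ord i; lia.
Qed.

Lemma lower_lshift i r k : r k = hi i -> lower r (lshift d k) = subst r k (lo i).
Proof.
move=> rk; apply/ffunP => l; rewrite !ffunE (inj_eq (@lshift_inj _ _)) rev_lshift.
rewrite lshift_rshiftF; case: eqP => // ->; apply: val_inj.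
by rewrite /= inordK ?rk ?loE ?hiE //; have := ltn_ord i; lia.
Qed.

Lemma lower_rshift i r k : r k = rev_ord (hi i) ->
  lower r (rshift d (rev_ord k)) = subst r k (rev_ord (lo i)).
Proof.
move=> rk; apply/ffunP => l; rewrite !ffunE lshift_rshiftF -rev_lshift rev_ordK.
rewrite (inj_eq (@lshift_inj _ _)); case: eqP => // ->; apply: val_inj.
by rewrite /= rk inordK /= ?loE ?hiE //; have := ltn_ord i; lia.
Qed.

Lemma farl_lo_hi i : farl (lo i) (hi i).
Proof.
by apply/andP; split; rewrite -val_eqE /= ?loE ?hiE; have := ltn_ord i; lia.
Qed.

Lemma sum_natz (I : finType) (P : pred I) (F : I -> nat) :
  (\sum_(i | P i) F i)%N%:Z = \sum_(i | P i) (F i)%:Z :> int.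
Proof. exact: (big_morph Posz PoszD). Qed.

Lemma nat_letter_eq (a b : letter) m : b = m :> nat -> (a == m :> nat) = (a == b).
Proof. by move=> <-. Qed.

Lemma rev_letter_eq (a b : letter) m :
  b = m :> nat -> (rev_ord a == m :> nat) = (a == rev_ord b).
Proof. by move=> <-; rewrite val_eqE -(inj_eq rev_ord_inj) rev_ordK. Qed.

Lemma expr_ratio q a b : q != 0 -> q ^- a * q ^+ b = q ^ (b%:Z - a%:Z).
Proof. by move=> q0; rewrite expfzDr // mulrC -invr_expz. Qed.

(** The sum over the [d + d] positions is folded onto pairs of mirror positions; the exponents are
    then compared letter by letter, according to whether [j] is before, after or equal to [k]. *)
Lemma op_E_sum q i r : q != 0 -> op q (lo i) (hi i) (delta K r) = E_sum q i r.
Proof.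
move=> q0; rewrite op_delta // /op_sum /E_sum [X in _ *: X]big_mkcond [X in _ *: X]sum_ext /= scaler_sumr.
have [n1 n2 n3 n4] := farlE (farl_lo_hi i).
apply: eq_bigr => k _; rewrite ext_lshift ext_rshift rev_ordK scalerDr; congr (_ + _).
  rewrite (nat_letter_eq _ (loE i)); case: eqP => [rk|_]; last first.
    by rewrite mul0r scale0r scaler0.
  rewrite mul1r (raise_lshift rk) scalerA; congr (_ *: _).
  rewrite expr_ratio //; congr (_ ^ _).
  rewrite PoszM !sum_natz sum_ext big_mkcond /= sum_ext /exponent.
  rewrite mulr_sumr -sumrB /=; apply: eq_bigr => j _.
  rewrite !ext_lshift !ext_rshift !rev_ordK /=.
  rewrite !(rev_letter_eq _ (hiE i)) !(nat_letter_eq _ (hiE i)) /cnt.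
  case: (ltngtP j k) => [jk|jk|/val_inj ->].
  - by have := ltn_ord k; have := ltn_ord j; case: (r j == hi i); case: (r j == rev_ord (hi i)); do ?case: ifP; lia.
  - by have := ltn_ord k; have := ltn_ord j; case: (r j == hi i); case: (r j == rev_ord (hi i)); do ?case: ifP; lia.
  - rewrite rk (negbTE n1) (negbTE n2); have := ltn_ord k; by do ?case: ifP; lia.
rewrite (rev_letter_eq _ (loE i)); case: eqP => [rk|_]; last first.
  by rewrite mul0r scale0r scaler0.
rewrite mul1r (raise_rshift rk) scalerA; congr (_ *: _).
rewrite expr_ratio //; congr (_ ^ _).
rewrite PoszM !sum_natz sum_ext big_mkcond /= sum_ext /exponent.
rewrite mulr_sumr -sumrB /=; apply: eq_bigr => j _.
rewrite !ext_lshift !ext_rshift !rev_ordK /=.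
rewrite !(rev_letter_eq _ (hiE i)) !(nat_letter_eq _ (hiE i)) /cnt.
case: (ltngtP j k) => [jk|jk|/val_inj ->].
- by have := ltn_ord k; have := ltn_ord j; case: (r j == hi i); case: (r j == rev_ord (hi i)); do ?case: ifP; lia.
- by have := ltn_ord k; have := ltn_ord j; case: (r j == hi i); case: (r j == rev_ord (hi i)); do ?case: ifP; lia.
- rewrite rk (negbTE n3) (negbTE n4); have := ltn_ord k; by do ?case: ifP; lia.
Qed.

Lemma op_F_sum q i r : q != 0 -> op q^-1 (hi i) (lo i) (delta K r) = F_sum q i r.
Proof.
move=> q0; have qi0 : q^-1 != 0 by rewrite invr_eq0.
rewrite op_delta // /op_sum /F_sum [X in _ *: X]big_mkcond [X in _ *: X]sum_ext /=.
rewrite scaler_sumr; have [n1 n2 n3 n4] := farlE (farl_lo_hi i).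
apply: eq_bigr => k _; rewrite ext_lshift ext_rshift rev_ordK scalerDr; congr (_ + _).
  rewrite (nat_letter_eq _ (hiE i)); case: eqP => [rk|_]; last first.
    by rewrite mul0r scale0r scaler0.
  rewrite mul1r (lower_lshift rk) scalerA; congr (_ *: _).
  rewrite expr_ratio // exprz_inv; congr (_ ^ _).
  rewrite PoszM !sum_natz sum_ext big_mkcond /= sum_ext /exponent.
  rewrite mulr_sumr -sumrB -sumrN /=; apply: eq_bigr => j _.
  rewrite !ext_lshift !ext_rshift !rev_ordK /=.
  rewrite !(rev_letter_eq _ (loE i)) !(nat_letter_eq _ (loE i)) /cnt.
  case: (ltngtP j k) => [jk|jk|/val_inj ->].
  - by have := ltn_ord k; have := ltn_ord j; case: (r j == lo i); case: (r j == rev_ord (lo i)); do ?case: ifP; lia.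
  - by have := ltn_ord k; have := ltn_ord j; case: (r j == lo i); case: (r j == rev_ord (lo i)); do ?case: ifP; lia.
  - rewrite rk ![hi i == _]eq_sym (negbTE n1) -(inj_eq rev_ord_inj) rev_ordK (negbTE n2); have := ltn_ord k; by do ?case: ifP; lia.
rewrite (rev_letter_eq _ (hiE i)); case: eqP => [rk|_]; last first.
  by rewrite mul0r scale0r scaler0.
rewrite mul1r (lower_rshift rk) scalerA; congr (_ *: _).
rewrite expr_ratio // exprz_inv; congr (_ ^ _).
rewrite PoszM !sum_natz sum_ext big_mkcond /= sum_ext /exponent.
rewrite mulr_sumr -sumrB -sumrN /=; apply: eq_bigr => j _.
rewrite !ext_lshift !ext_rshift !rev_ordK /=.
rewrite !(rev_letter_eq _ (loE i)) !(nat_letter_eq _ (loE i)) /cnt.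
case: (ltngtP j k) => [jk|jk|/val_inj ->].
- by have := ltn_ord k; have := ltn_ord j; case: (r j == lo i); case: (r j == rev_ord (lo i)); do ?case: ifP; lia.
- by have := ltn_ord k; have := ltn_ord j; case: (r j == lo i); case: (r j == rev_ord (lo i)); do ?case: ifP; lia.
- rewrite rk ![rev_ord (hi i) == _]eq_sym (negbTE n4) (negbTE n2); have := ltn_ord k; by do ?case: ifP; lia.
Qed.

Lemma sum_ext_cnt r (a : letter) m : a = m :> nat ->
  (\sum_j (ext r j == m :> nat))%N%:Z = \sum_k cnt a (r k) :> int.
Proof.
move=> am; rewrite sum_natz sum_ext; apply: eq_bigr => k _.
by rewrite ext_lshift ext_rshift rev_ordK (rev_letter_eq _ am) (nat_letter_eq _ am).
Qed.

Lemma gd_false_sum q r (a : letter) m : a = m :> nat ->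
  gd q false a (delta K r) = q ^- (\sum_j (ext r j == m :> nat)) *: delta K r.
Proof. by move=> am; rewrite gd_delta -(sum_ext_cnt _ am) -invr_expz. Qed.

Lemma gd_true_sum q r (a : letter) m : a = m :> nat ->
  gd q true a (delta K r) = q ^+ (\sum_j (ext r j == m :> nat)) *: delta K r.
Proof. by move=> am; rewrite gd_delta -(sum_ext_cnt _ am). Qed.

Lemma jp_delta al r : jp al (delta K r) = if J_type r == al then delta K r else 0.
Proof.
apply/ffunP => s; rewrite !ffunE; case: (eqVneq s r) => [->|sr].
  by case: ifP; rewrite ?ffunE ?eqxx ?mulr1 // mul0r.
by case: ifP; rewrite ffunE ?(negbTE sr) ?mulr0.
Qed.

End FormulasMatch.

Lemma v_neq0 : v != 0.
Proof. by rewrite tofrac_eq0 polyX_eq0. Qed.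

Lemma v_sqr_neq1 : v ^+ 2 - 1 != 0.
Proof.
rewrite /v -tofracXn -(tofrac1 {poly rat}) -tofracB tofrac_eq0.
by rewrite -size_poly_eq0 size_XnsubC.
Qed.

(** * Representations of presented algebras *)

Section Rep.
Variables (K : fieldType) (Y : choiceType) (W : vectType K).
Variables (rv : bool) (h : Y -> 'End(W)).
Local Notation A := (free_alg K Y).

(** With [rv] true the product is reversed composition, so that right modules are covered as
    well. *)
Definition lfun_mul (f g : 'End(W)) : 'End(W) := if rv then (g \o f)%VF else (f \o g)%VF.

Lemma lfun_mulA : associative lfun_mul.
Proof. by move=> x y z; rewrite /lfun_mul; case: rv; rewrite comp_lfunA. Qed.
Lemma lfun_mul1l : left_id \1%VF lfun_mul.
Proof. by move=> x; rewrite /lfun_mul; case: rv; rewrite (comp_lfun1l, comp_lfun1r). Qed.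
Lemma lfun_mul1r : right_id \1%VF lfun_mul.
Proof. by move=> x; rewrite /lfun_mul; case: rv; rewrite (comp_lfun1l, comp_lfun1r). Qed.
Lemma lfun_mulDl : left_distributive lfun_mul +%R.
Proof. by move=> x y z; rewrite /lfun_mul; case: rv; rewrite (comp_lfunDl, comp_lfunDr). Qed.
Lemma lfun_mulDr : right_distributive lfun_mul +%R.
Proof. by move=> x y z; rewrite /lfun_mul; case: rv; rewrite (comp_lfunDl, comp_lfunDr). Qed.
Lemma lfun_mulZl k x y : lfun_mul (k *: x) y = k *: lfun_mul x y.
Proof. by rewrite /lfun_mul; case: rv; [rewrite comp_lfunZr|rewrite comp_lfunZl]. Qed.
Lemma lfun_mulZr k x y : lfun_mul x (k *: y) = k *: lfun_mul x y.
Proof. by rewrite /lfun_mul; case: rv; [rewrite comp_lfunZl|rewrite comp_lfunZr]. Qed.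

Definition end_lift : A -> 'End(W) := free_lift lfun_mul \1%VF h.

(** Attaches a plain function to an element of the free algebra. The closure lemmas below let the
    tactic [rep] compute this function from the syntax of the element, so a relation becomes a
    pointwise identity. *)
Definition Rep (a : A) (f : W -> W) := forall t, end_lift a t = f t.

Lemma Rep_D a b f g : Rep a f -> Rep b g -> Rep (a + b) (fun t => f t + g t).
Proof. by move=> af bg t; rewrite /end_lift free_liftD add_lfunE [X in X + _]af [X in _ + X]bg. Qed.
Lemma Rep_N a f : Rep a f -> Rep (- a) (fun t => - f t).
Proof. by move=> af t; rewrite /end_lift free_liftN opp_lfunE [X in - X]af. Qed.
Lemma Rep_Z k a f : Rep a f -> Rep (k *: a) (fun t => k *: f t).
Proof. by move=> af t; rewrite /end_lift free_liftZ scale_lfunE [X in _ *: X]af. Qed.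
Lemma Rep_0 : Rep 0 (fun=> 0).
Proof. by move=> t; rewrite /end_lift free_lift0 zero_lfunE. Qed.
Lemma Rep_Mn a f (b : bool) : Rep a f -> Rep (a *+ b) (fun t => if b then f t else 0).
Proof. by move=> af; case: b; [rewrite mulr1n|rewrite mulr0n; apply: Rep_0]. Qed.
Lemma Rep_1 : Rep 1 (fun t => t).
Proof. by move=> t; rewrite /end_lift free_lift1 id_lfunE. Qed.
Lemma Rep_C k : Rep k%:MP (fun t => k *: t).
Proof. by move=> t; rewrite -[_%:MP]mulr1 mul_malgC (Rep_Z k Rep_1). Qed.
Lemma Rep_M a b f g : Rep a f -> Rep b g ->
  Rep (a * b) (fun t => if rv then g (f t) else f (g t)).
Proof.
move=> af bg t.
have -> : end_lift (a * b) = lfun_mul (end_lift a) (end_lift b).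
  by apply: free_liftM; [exact: lfun_mulA|exact: lfun_mul1l|exact: lfun_mulDl
    |exact: lfun_mulDr|exact: lfun_mulZl|exact: lfun_mulZr].
rewrite /lfun_mul; case: rv; rewrite comp_lfunE.
  by rewrite -[RHS](bg (f t)); congr (fun_of_lfun _ _); apply: af.
by rewrite -[RHS](af (g t)); congr (fun_of_lfun _ _); apply: bg.
Qed.
Lemma Rep_X2 a f : Rep a f -> Rep (a ^+ 2) (fun t => f (f t)).
Proof. by move=> af t; rewrite expr2 (Rep_M af af); case: rv. Qed.
Lemma Rep_gen g : Rep (fgen K g) (h g).
Proof. by move=> t; rewrite /end_lift free_lift_gen // lfun_mul1r. Qed.

Lemma Rep_eq a b f g : Rep a f -> Rep b g -> f =1 g -> end_lift a = end_lift b.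
Proof. by move=> af bg fg; apply/lfunP => t; rewrite af bg. Qed.

Section Presented.
Variable rels : A -> A -> Prop.
Hypothesis relsP : forall a b, rels a b -> end_lift a = end_lift b.

Definition rep_fun : presented_alg rels -> 'End(W) := @presented_lift _ _ _ lfun_mul \1%VF h _.

HB.instance Definition _ := GRing.isLinear.Build K (presented_alg rels) 'End(W) _ rep_fun
  (presented_lift_is_linear lfun_mulA lfun_mul1l lfun_mulDl lfun_mulDr lfun_mulZl lfun_mulZr
     relsP).

Definition rep_of : {linear presented_alg rels -> 'End(W)} := rep_fun.

Lemma rep_of1 : rep_of 1 = \1%VF.
Proof.
exact: (presented_lift1 lfun_mulA lfun_mul1l lfun_mulDl lfun_mulDr lfun_mulZl lfun_mulZr relsP).
Qed.

Lemma rep_ofM x y : rep_of (x * y) = lfun_mul (rep_of x) (rep_of y).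
Proof.
exact: (presented_liftM lfun_mulA lfun_mul1l lfun_mulDl lfun_mulDr lfun_mulZl lfun_mulZr relsP).
Qed.

Lemma rep_of_gen y : rep_of (pgen rels y) = h y.
Proof.
apply: (presented_lift_gen lfun_mulA lfun_mul1l lfun_mulDl lfun_mulDr lfun_mulZl lfun_mulZr relsP).
exact: lfun_mul1r.
Qed.

End Presented.
End Rep.

Ltac rep gen := lazymatch goal with
  | |- Rep _ _ (_ + _) _ => eapply Rep_D; rep gen
  | |- Rep _ _ (- _) _ => eapply Rep_N; rep gen
  | |- Rep _ _ (_ *: _) _ => eapply Rep_Z; rep gen
  | |- Rep _ _ (_ * _) _ => eapply Rep_M; rep gen
  | |- Rep _ _ (_ ^+ 2) _ => eapply Rep_X2; rep gen
  | |- Rep _ _ (_ *+ nat_of_bool _) _ => eapply Rep_Mn; rep gen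
  | |- Rep _ _ (_%:MP) _ => apply Rep_C
  | |- Rep _ _ (fgen _ _) _ => apply gen
  | |- Rep _ _ 0 _ => apply Rep_0
  | |- Rep _ _ 1 _ => apply Rep_1
  end.

(** * The generators of U as operators *)

Section Generators.
Variables (n d : nat) (K : fieldType) (q : K).
Local Notation letter := 'I_(n.*2).+1.
Local Notation T := {ffun multi n d -> K^o}.

Definition hlet (a : 'I_n.+1) : letter := inord a.

Lemma hletE a : hlet a = a :> nat.
Proof. by rewrite inordK //; have := ltn_ord a; lia. Qed.

Definition Ugen_op (g : Ugen n) : T -> T :=
  match g with
  | UgenE i => @op n K q (lo i) (hi i) d
  | UgenF i => @op n K q^-1 (hi i) (lo i) d
  | UgenH a => gd q false (hlet a)
  | UgenHinv a => gd q true (hlet a)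
  | UgenJ al => jp al
  end.

Lemma Ugen_op_is_linear g : linear (Ugen_op g).
Proof. by case: g => [i|i|a|a|al] k t u /=; rewrite linearP. Qed.
HB.instance Definition _ g :=
  GRing.isLinear.Build K T T _ (Ugen_op g) (Ugen_op_is_linear g).

Definition Ugen_end (g : Ugen n) : 'End(T) := linfun (Ugen_op g).

Lemma Ugen_endE g t : Ugen_end g t = Ugen_op g t.
Proof. exact: lfunE. Qed.

Lemma URep_gen g : Rep false Ugen_end (fgen K g) (Ugen_op g).
Proof. by move=> t; rewrite Rep_gen Ugen_endE. Qed.
End Generators.

Section GeneratorRelations.
Variables (n d : nat) (K : fieldType) (q : K).
Local Notation letter := 'I_(n.*2).+1.
Local Notation T := {ffun multi n d -> K^o}.
Implicit Types (i j : 'I_n) (t : T).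

Lemma hlet_lo i : hlet (inord i) = lo i.
Proof. by apply/val_inj; rewrite /= hletE loE inordK //; have := ltn_ord i; lia. Qed.
Lemma hlet_hi i : hlet (inord i.+1) = hi i.
Proof. by apply/val_inj; rewrite /= hletE hiE inordK //; have := ltn_ord i; lia. Qed.

Lemma hi_mid i : i.+1 = n -> rev_ord (hi i) = hi i.
Proof. by move=> e; apply/val_inj; rewrite /= hiE; lia. Qed.

Lemma lo_nmid i : lo i != rev_ord (lo i).
Proof. by rewrite -val_eqE /= loE; have := ltn_ord i; lia. Qed.

Lemma hi_nmid i : i.+1 != n -> hi i != rev_ord (hi i).
Proof. by rewrite -val_eqE /= hiE; have := ltn_ord i; lia. Qed.

Lemma loS i j : i.+1 = j -> lo j = hi i.
Proof. by move=> e; apply/val_inj; rewrite /= loE hiE. Qed.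

Lemma farl_lo_lo i j : i != j :> nat -> farl (lo i) (lo j).
Proof.
by rewrite /farl -!val_eqE /= !loE; have := ltn_ord i; have := ltn_ord j; lia.
Qed.
Lemma farl_hi_hi i j : i != j :> nat -> farl (hi i) (hi j).
Proof.
by rewrite /farl -!val_eqE /= !hiE; have := ltn_ord i; have := ltn_ord j; lia.
Qed.
Lemma farl_lo_hi' i j : i != j.+1 :> nat -> farl (lo i) (hi j).
Proof.
by rewrite /farl -!val_eqE /= loE hiE; have := ltn_ord i; have := ltn_ord j; lia.
Qed.
Lemma farl_hi_lo i j : i.+1 != j :> nat -> farl (hi i) (lo j).
Proof.
by rewrite /farl -!val_eqE /= loE hiE; have := ltn_ord i; have := ltn_ord j; lia.
Qed.

Lemma farl_sym (x y : letter) : farl x y -> farl y x.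
Proof. by case/farlE => *; apply/andP; split; rewrite eq_sym. Qed.

Lemma J_sum t : jp (Some true) t + jp None t + jp (Some false) t = t.
Proof.
apply/ffunP => r; rewrite !TE !ffunE -!mulrDl.
by case: (J_type r) => [[]|]; rewrite /= ?addr0 ?add0r mul1r.
Qed.

Lemma J_mul al be t : jp al (jp be t) = if al == be then jp al t else 0.
Proof.
apply/ffunP => r; rewrite ffunE ffunE; case: (eqVneq al be) => [->|ab]; rewrite !ffunE.
  by rewrite mulrA -natrM mulnb andbb.
rewrite mulrA -natrM mulnb; case: eqP => [->|]; last by rewrite mul0r.
by rewrite (negbTE ab) mul0r.
Qed.

Lemma J_raise s i t :
  jp (Some s) (op q (lo i) (hi i) t) =
  if i.+1 != n then op q (lo i) (hi i) (jp (Some s) t) else 0.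
Proof.
have := ltn_ord i; case: eqP => /= [e|e] iN.
  by apply: jp_op_into_mid; rewrite hiE.
by apply: jp_op_side; rewrite ?loE ?hiE //; lia.
Qed.

Lemma lower_J s i t :
  op q^-1 (hi i) (lo i) (jp (Some s) t) =
  if i.+1 != n then jp (Some s) (op q^-1 (hi i) (lo i) t) else 0.
Proof.
have := ltn_ord i; case: eqP => /= [e|e] iN.
  by apply: op_jp_from_mid; rewrite hiE.
by rewrite jp_op_side ?loE ?hiE //; lia.
Qed.

Hypotheses (q0 : q != 0) (q2 : q ^+ 2 - 1 != 0).

Lemma gdw_ratio (a : 'I_n.+1) i :
  gdw q false (hlet a) (hi i) / gdw q false (hlet a) (lo i) = q ^ HE_weight a i.
Proof.
rewrite !gdwE // invr_expz -expfzDr //; congr (_ ^ _); rewrite opprK /cnt /HE_weight.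
rewrite -!val_eqE /= loE hiE hletE.
have := ltn_ord i; have := ltn_ord a; lia.
Qed.

Lemma H_raise (a : 'I_n.+1) i t :
  gd q false (hlet a) (op q (lo i) (hi i) t) =
  q ^ HE_weight a i *: op q (lo i) (hi i) (gd q false (hlet a) t).
Proof. by rewrite gd_op // gdw_ratio. Qed.

Lemma H_lower (a : 'I_n.+1) i t :
  gd q false (hlet a) (op q^-1 (hi i) (lo i) t) =
  q ^ (- HE_weight a i) *: op q^-1 (hi i) (lo i) (gd q false (hlet a) t).
Proof. by rewrite gd_op // -invr_expz -gdw_ratio invf_div. Qed.

Lemma raise_lower_commutator i j t : ~ (i.+1 = n /\ j.+1 = n) ->
  op q (lo i) (hi i) (op q^-1 (hi j) (lo j) t)
  - op q^-1 (hi j) (lo j) (op q (lo i) (hi i) t) =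
  if i == j then (q - q^-1)^-1 *: (gd q false (lo i) (gd q true (hi i) t)
    - gd q true (lo i) (gd q false (hi i) t)) else 0.
Proof.
have qi0 : q^-1 != 0 by rewrite invr_eq0.
move=> ij; case: (eqVneq i j) => [e|].
  subst j; apply: commutator_op => //; [exact: farl_lo_hi|exact: lo_nmid|].
  by apply: hi_nmid; apply/eqP; tauto.
rewrite -val_eqE /= => nij; apply/eqP; rewrite subr_eq0; apply/eqP.
have [iN jN] := (ltn_ord i, ltn_ord j).
case: (eqVneq i.+1 j) => [e|ne].
  rewrite (loS e); apply: op_same_target => //; rewrite -?(loS e).
  - by apply: farl_lo_lo.
  - by apply: farl_lo_hi.
  - by rewrite /farl -!val_eqE /= loE hiE; lia.
  - exact: lo_nmid.
case: (eqVneq j.+1 i) => [e|ne'].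
  rewrite -(loS e); apply: op_same_source => //; [exact: farl_lo_hi| | |exact: lo_nmid].
  - by rewrite /farl -!val_eqE /= loE hiE; lia.
  - exact: farl_lo_lo.
apply: op_far => //; [apply: farl_lo_hi'|apply: farl_lo_lo|apply: farl_hi_hi|apply: farl_hi_lo];
  rewrite // eq_sym //.
Qed.

Lemma raise_raise_far i j t : (i.+1 < j)%N || (j.+1 < i)%N ->
  op q (lo i) (hi i) (op q (lo j) (hi j) t) = op q (lo j) (hi j) (op q (lo i) (hi i) t).
Proof.
move=> ij; apply: op_far => //;
  [apply: farl_lo_lo|apply: farl_lo_hi'|apply: farl_hi_lo|apply: farl_hi_hi]; lia.
Qed.

Lemma lower_lower_far i j t : (i.+1 < j)%N || (j.+1 < i)%N ->
  op q^-1 (hi i) (lo i) (op q^-1 (hi j) (lo j) t) =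
  op q^-1 (hi j) (lo j) (op q^-1 (hi i) (lo i) t).
Proof.
move=> ij; apply: op_far; rewrite ?invr_eq0 //;
  [apply: farl_hi_hi|apply: farl_hi_lo|apply: farl_lo_hi'|apply: farl_lo_lo]; lia.
Qed.

Lemma raise_serre i j t : (i.+1 == j) || (j.+1 == i) ->
  op q (lo i) (hi i) (op q (lo i) (hi i) (op q (lo j) (hi j) t))
  - (q + q^-1) *: op q (lo i) (hi i) (op q (lo j) (hi j) (op q (lo i) (hi i) t))
  + op q (lo j) (hi j) (op q (lo i) (hi i) (op q (lo i) (hi i) t)) = 0.
Proof.
have [iN jN] := (ltn_ord i, ltn_ord j).
have far3 (k l : 'I_n) : k.+1 = l -> farl (lo k) (hi l).
  by move=> kl; apply: farl_lo_hi'; lia.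
case/orP => /eqP e.
  have := @serre_op n K q (lo i) (hi i) (hi j) q0 (farl_lo_hi i) _ (far3 _ _ e).
  by rewrite -(loS e); apply; [exact: farl_lo_hi|exact: lo_nmid].
have := @serre_op' n K q (lo j) (hi j) (hi i) q0 (farl_lo_hi j) _ (far3 _ _ e).
by rewrite -(loS e); apply; [exact: farl_lo_hi|exact: lo_nmid].
Qed.

Lemma lower_serre i j t : (i.+1 == j) || (j.+1 == i) ->
  op q^-1 (hi i) (lo i) (op q^-1 (hi i) (lo i) (op q^-1 (hi j) (lo j) t))
  - (q + q^-1) *:
    op q^-1 (hi i) (lo i) (op q^-1 (hi j) (lo j) (op q^-1 (hi i) (lo i) t))
  + op q^-1 (hi j) (lo j) (op q^-1 (hi i) (lo i) (op q^-1 (hi i) (lo i) t)) = 0.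
Proof.
have qi0 : q^-1 != 0 by rewrite invr_eq0.
have [iN jN] := (ltn_ord i, ltn_ord j).
have far3 (k l : 'I_n) : k.+1 = l -> farl (hi l) (lo k).
  by move=> kl; apply: farl_sym; apply: farl_lo_hi'; lia.
have far1 (k : 'I_n) : farl (hi k) (lo k) by apply: farl_sym; apply: farl_lo_hi.
case/orP => /eqP e.
  (* The [F] are [op] with parameter [q^-1] along the reversed chain of letters [hi j],
     [lo j = hi i], [lo i]; the two Serre lemmas therefore exchange roles. *)
  have := @serre_op' n K q^-1 (hi j) (lo j) (lo i) qi0 (far1 j) _ (far3 _ _ e).
  rewrite invrK [q^-1 + q]addrC (loS e); apply; first exact: far1.
  by rewrite -(loS e); exact: lo_nmid.
have := @serre_op n K q^-1 (hi i) (lo i) (lo j) qi0 (far1 i) _ (far3 _ _ e).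
rewrite invrK [q^-1 + q]addrC (loS e); apply; first exact: far1.
by rewrite -(loS e); exact: lo_nmid.
Qed.

Lemma J_lower_raise s i t : i.+1 = n ->
  jp (Some s) (op q^-1 (hi i) (lo i) (op q (lo i) (hi i) t))
  - op q^-1 (hi i) (lo i) (op q (lo i) (hi i) (jp (Some (~~ s)) t)) =
  (q - q^-1)^-1 *:
    (gd q true (lo i) (gd q false (hi i) (jp (Some s) t - jp (Some (~~ s)) t))
     - gd q false (lo i) (gd q true (hi i) (jp (Some s) t - jp (Some (~~ s)) t))).
Proof. by move=> e; apply: jp_lower_raise; rewrite ?hiE ?loE. Qed.

Lemma raise_raise_lower i t : i.+1 = n ->
  op q (lo i) (hi i) (op q (lo i) (hi i) (op q^-1 (hi i) (lo i) t))
  + op q^-1 (hi i) (lo i) (op q (lo i) (hi i) (op q (lo i) (hi i) t)) =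
  (q + q^-1) *: (op q (lo i) (hi i) (op q^-1 (hi i) (lo i) (op q (lo i) (hi i) t))
    - op q (lo i) (hi i) (q *: gd q false (lo i) (gd q true (hi i) t)
      + q^-1 *: gd q true (lo i) (gd q false (hi i) t))).
Proof.
by move=> e; apply: raise_raise_lower_op; rewrite ?hi_mid ?lo_nmid ?farl_lo_hi.
Qed.

Lemma lower_lower_raise i t : i.+1 = n ->
  op q^-1 (hi i) (lo i) (op q^-1 (hi i) (lo i) (op q (lo i) (hi i) t))
  + op q (lo i) (hi i) (op q^-1 (hi i) (lo i) (op q^-1 (hi i) (lo i) t)) =
  (q + q^-1) *: (op q^-1 (hi i) (lo i) (op q (lo i) (hi i) (op q^-1 (hi i) (lo i) t))
    - (q *: gd q false (lo i) (gd q true (hi i) (op q^-1 (hi i) (lo i) t))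
      + q^-1 *: gd q true (lo i) (gd q false (hi i) (op q^-1 (hi i) (lo i) t)))).
Proof.
by move=> e; apply: lower_lower_raise_op; rewrite ?hi_mid ?lo_nmid ?farl_lo_hi.
Qed.

End GeneratorRelations.

Lemma U_rel_hold n d a b : @U_rel n a b -> end_lift false (Ugen_end d v) a = end_lift false (Ugen_end d v) b.
Proof.
have [v0 v2] := (v_neq0, v_sqr_neq1).
case.
- by eapply Rep_eq; [rep URep_gen|rep URep_gen|] => t; apply: J_sum.
- by move=> al be; eapply Rep_eq; [rep URep_gen|rep URep_gen|] => t; apply: J_mul.
- by move=> al a0; eapply Rep_eq; [rep URep_gen|rep URep_gen|] => t; apply: jp_gd.
- by move=> s i; eapply Rep_eq; [rep URep_gen|rep URep_gen|] => t; apply: J_raise.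
- by move=> s i; eapply Rep_eq; [rep URep_gen|rep URep_gen|] => t; apply: lower_J.
- move=> s i e; eapply Rep_eq; [rep URep_gen|rep URep_gen|] => t; rewrite /Ugen_op /= hlet_lo hlet_hi.
  exact: (J_lower_raise v0 v2 s t e).
- by move=> a1 a2; eapply Rep_eq; [rep URep_gen|rep URep_gen|] => t; apply: gdC.
- by move=> a1; eapply Rep_eq; [rep URep_gen|rep URep_gen|] => t; exact: (@gdK _ _ v false _ _ _ v0).
- by move=> a1; eapply Rep_eq; [rep URep_gen|rep URep_gen|] => t; exact: (@gdK _ _ v true _ _ _ v0).
- by move=> a1 i; eapply Rep_eq; [rep URep_gen|rep URep_gen|] => t; exact: (H_raise v0 v2).
- by move=> a1 i; eapply Rep_eq; [rep URep_gen|rep URep_gen|] => t; exact: (H_lower v0 v2).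
- move=> i j ij; eapply Rep_eq; [rep URep_gen|rep URep_gen|] => t; rewrite /Ugen_op /= !hlet_lo !hlet_hi.
  exact: (raise_lower_commutator v0 v2 t ij).
- by move=> i j ij; eapply Rep_eq; [rep URep_gen|rep URep_gen|] => t; exact: (raise_raise_far v0 v2 t ij).
- by move=> i j ij; eapply Rep_eq; [rep URep_gen|rep URep_gen|] => t; exact: (lower_lower_far v0 v2 t ij).
- by move=> i j ij; eapply Rep_eq; [rep URep_gen|rep URep_gen|] => t; exact: (raise_serre v0 v2 t ij).
- by move=> i j ij; eapply Rep_eq; [rep URep_gen|rep URep_gen|] => t; exact: (lower_serre v0 v2 t ij).
- move=> i e; eapply Rep_eq; [rep URep_gen|rep URep_gen|] => t; rewrite /Ugen_op /= !hlet_lo !hlet_hi.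
  exact: (raise_raise_lower v0 t e).
- move=> i e; eapply Rep_eq; [rep URep_gen|rep URep_gen|] => t; rewrite /Ugen_op /= !hlet_lo !hlet_hi.
  exact: (lower_lower_raise v0 t e).
Qed.

(** * Hecke operators of simply laced type *)

Section SimplyLaced.
Variables (K : fieldType) (q : K) (I : Type) (X : finType).
Variables (s : I -> X -> X) (al : I -> X -> int).
Local Notation T := {ffun X -> K^o}.
Implicit Types (i j : I) (x y : X) (t : T).
Hypotheses (sK : forall i, involutive (s i)) (alN : forall i x, al i (s i x) = - al i x)
  (al0 : forall i x, al i x = 0 -> s i x = x).

(** Here and in [braiding], [al i x] behaves like the value of the simple root [i] at [x]. The
    conditions say how [s i] transforms the other root in rank two: it is fixed in type A1 x A1 and
    becomes the sum of the two roots in type A2. *)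
Definition commuting i j := forall x,
  [/\ s i (s j x) = s j (s i x), al j (s i x) = al j x & al i (s j x) = al i x].

Definition braiding i j := forall x,
  [/\ s i (s j (s i x)) = s j (s i (s j x)), al j (s i x) = al i x + al j x
    & al i (s j x) = al i x + al j x].

(** The transposed form of the action: the value at [y] collects the contributions of the basis
    vectors at [y] and at [s i y]. The rule on basis vectors is [tau_delta]. *)
Definition tau i t : T :=
  [ffun y => if 0 <= al i y then q ^+ 2 * t (s i y)
             else t (s i y) + (q ^+ 2 - 1) * t y].

Lemma tauE i t y : tau i t y = if 0 <= al i y then q ^+ 2 * t (s i y)
             else t (s i y) + (q ^+ 2 - 1) * t y.
Proof. by rewrite ffunE. Qed.

Lemma tau_is_linear i : linear (tau i).
Proof.
move=> k t u; apply/ffunP => y; rewrite !(tauE, ffunE) /=.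
by case: ifP => _; rewrite /GRing.scale /=; ring.
Qed.
HB.instance Definition _ i :=
  GRing.isLinear.Build K T T _ (tau i) (tau_is_linear i).

Lemma tau_delta i x : tau i (delta K x) =
  if 0 < al i x then delta K (s i x) else if al i x == 0 then q ^+ 2 *: delta K x
  else (q ^+ 2 - 1) *: delta K x + q ^+ 2 *: delta K (s i x).
Proof.
have sx y : (s i y == x) = (y == s i x) by rewrite -(inj_eq (can_inj (sK i))) sK.
apply/ffunP => y; rewrite tauE !ffunE sx.
case: (eqVneq y (s i x)) => [->|ysx].
  rewrite alN; case: ltrgt0P => [ax|ax|ax0].
  - rewrite oppr_ge0 leNgt ax /= !ffunE eqxx; case: eqP => [e|]; last by rewrite mulr0 addr0.
    by have := alN i x; rewrite e; lia.
  - rewrite oppr_ge0 ltW //= !ffunE eqxx /GRing.scale /=.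
    case: eqP => [e|]; last by rewrite mulr0 add0r.
    by have := alN i x; rewrite e; lia.
  - by rewrite ax0 oppr0 /= (al0 ax0) !ffunE eqxx.
case: ltrgt0P => [ax|ax|ax0] /=.
- rewrite ffunE (negbTE ysx); case: ifP => [_|ay]; first by rewrite mulr0.
  case: eqP ay => [->|_ _]; last by rewrite mulr0 addr0.
  by rewrite ltW.
- rewrite !ffunE (negbTE ysx) /GRing.scale /= !mulr0 addr0; case: ifP => [ay|_]; last by rewrite add0r.
  by case: eqP ay => [->|]; rewrite ?mulr0 //; rewrite leNgt ax.
- rewrite !ffunE -(al0 ax0) (negbTE ysx) /GRing.scale /= !mulr0.
  by case: ifP; rewrite ?addr0.
Qed.

Lemma tau_quadratic i t : tau i (tau i t) = (q ^+ 2 - 1) *: tau i t + q ^+ 2 *: t.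
Proof.
apply/ffunP => y; rewrite !(TE, tauE) sK alN oppr_ge0.
case: ltrgt0P => [ay|ay|ay] /=; try ring.
by rewrite (al0 ay); ring.
Qed.

Lemma tau_commute i j : commuting i j -> forall t, tau i (tau j t) = tau j (tau i t).
Proof.
move=> c t; apply/ffunP => y; rewrite !tauE; have [-> -> ->] := c y.
by do 2!case: ifP => _; ring.
Qed.

(** Along the orbit of [y] under the two reflections every root value is, up to sign, one of [a],
    [b], [a + b]. The nine sign patterns of [(a, b)] are checked separately; where a root vanishes,
    its reflection fixes the word. *)
Lemma tau_braid i j : braiding i j ->
  forall t, tau i (tau j (tau i t)) = tau j (tau i (tau j t)).
Proof.
move=> c t; apply/ffunP => y.
have [b1 b2 b3] := c y; have [_ c2 _] := c (s j y); have [_ _ d3] := c (s i y).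
have [_ e2 _] := c (s i (s j y)); have [_ _ f3] := c (s j (s i y)).
rewrite !tauE !sK b1 !(c2, d3, b2, b3, alN).
move: (al0 (i := i) (x := y)) (al0 (i := j) (x := y)).
move: (al i y) (al j y) => a b za zb.
rewrite addKr addrK !oppr_ge0.
case: (ltrgt0P a) za => [a0|a0|->] za; case: (ltrgt0P b) zb => [b0|b0|->] zb /=.
- by rewrite (ltW (addr_gt0 a0 b0)).
- by case: ifP => _; ring.
- by rewrite addr0 (ltW a0) zb.
- by case: ifP => _; ring.
- by rewrite leNgt (_ : a + b < 0) /=; [ring|lia].
- by rewrite addr0 leNgt a0 /= zb //; ring.
- by rewrite add0r (ltW b0).
- by rewrite add0r leNgt b0 /= za //; ring.
- by [].
Qed.

End SimplyLaced.

Lemma delta_sum (K : fieldType) (X : finType) (t : {ffun X -> K^o}) :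
  t = \sum_x t x *: delta K x.
Proof.
apply/ffunP => y; rewrite sum_ffunE (bigD1 y) //= big1 ?addr0.
  by rewrite TE ffunE eqxx mulr1.
by move=> x xy; rewrite TE ffunE eq_sym (negbTE xy) mulr0.
Qed.

Lemma delta_ext (K : fieldType) (X : finType) (M : lmodType K)
    (f g : {linear {ffun X -> K^o} -> M}) :
  (forall x, f (delta K x) = g (delta K x)) -> f =1 g.
Proof.
move=> fg t; rewrite [t]delta_sum !linear_sum.
by apply: eq_bigr => x _; rewrite !linearZ fg.
Qed.

(** * Equivariant maps built along descents *)

Section Descents.
Variables (K : fieldType) (q : K) (I X : finType).
Variables (s : I -> X -> X) (al : I -> X -> int) (mu : X -> nat).
Local Notation T := {ffun X -> K^o}.
Implicit Types (i j : I) (x y : X) (t : T).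
Hypotheses (sK : forall i, involutive (s i)) (alN : forall i x, al i (s i x) = - al i x)
  (al0 : forall i x, al i x = 0 -> s i x = x)
  (mu_descent : forall i x, al i x < 0 -> (mu (s i x) < mu x)%N)
  (pairs : forall i j, [\/ i = j, commuting s al i j | braiding s al i j]).

Lemma descent_ind (P : X -> Prop) :
    (forall x, (forall i, 0 <= al i x) -> P x) ->
    (forall i x, al i x < 0 -> P (s i x) -> P x) ->
  forall x, P x.
Proof.
move=> Pmin Pstep x; have [k] := ubnP (mu x); elim: k x => // k IH x mux.
have [/existsP[i ix]|/existsPn noi] := boolP [exists i, al i x < 0].
  apply: (Pstep i) => //; apply: IH.
  by apply: leq_trans (mu_descent ix) _; rewrite -ltnS.
by apply: Pmin => i; rewrite leNgt noi.
Qed.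

Section Hom.
Variables (M : lmodType K) (rho : I -> {linear M -> M}) (m0 : M).
Hypotheses
  (rho_quadratic : forall i m, rho i (rho i m) = (q ^+ 2 - 1) *: rho i m + q ^+ 2 *: m)
  (rho_commute : forall i j m, commuting s al i j -> rho i (rho j m) = rho j (rho i m))
  (rho_braid : forall i j m, braiding s al i j ->
     rho i (rho j (rho i m)) = rho j (rho i (rho j m))).

(** [k] is fuel and [pick] chooses an arbitrary descent. [word_at] has enough fuel because [mu]
    drops at every step; the result is the product of generators along a path down to a minimal
    element. *)
Fixpoint descend k x : M :=
  if k is k'.+1 then
    if [pick i | al i x < 0] is Some i then rho i (descend k' (s i x)) else m0
  else m0.

Definition word_at x := descend (mu x).+1 x.

Lemma descend_stable k l x : (mu x < k)%N -> (mu x < l)%N -> descend k x = descend l x.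
Proof.
elim: k l x => // k IH [//|l] x; rewrite !ltnS => xk xl /=.
case: pickP => // i ix; congr (rho i _).
by apply: IH; apply: leq_trans (mu_descent ix) _.
Qed.

Lemma word_at_min x : (forall i, 0 <= al i x) -> word_at x = m0.
Proof.
by move=> xmin; rewrite /word_at /=; case: pickP => // i; rewrite ltNge xmin.
Qed.

(* Independence of the chosen descent: two descents i, j of x meet at the      *)
(* minimal element of the orbit of x under <s_i, s_j>, and the two paths give  *)
(* the two sides of the braid relation.                                        *)
Lemma word_at_descent i x : al i x < 0 -> word_at x = rho i (word_at (s i x)).
Proof.
have [k] := ubnP (mu x); elim: k x i => // k IH x i mux ix.
have {}IH j y : (mu y < mu x)%N -> al j y < 0 -> word_at y = rho j (word_at (s j y)).
  by move=> yx; apply: IH; apply: leq_trans yx _; rewrite -ltnS.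
have [j jx ->] : exists2 j, al j x < 0 & word_at x = rho j (word_at (s j x)).
  rewrite {1}/word_at /=; case: pickP => [j jx|/(_ i)]; last by rewrite ix.
  by exists j => //; congr (rho j _); apply: descend_stable => //; apply: mu_descent.
have [mi mj] := (mu_descent ix, mu_descent jx).
case: (pairs i j) => [->//|c|c].
  have [c1 c2 c3] := c x.
  rewrite (IH i (s j x)) ?c3 // (IH j (s i x)) ?c2 //.
  by rewrite c1 -(rho_commute _ c).
have [c1 c2 c3] := c x; have [_ _ c4] := c (s i x); have [_ c5 _] := c (s j x).
have ij0 : al i x + al j x < 0 by lia.
rewrite (IH i (s j x)) ?c3 // (IH j (s i x)) ?c2 //.
rewrite (IH j (s i (s j x))) ?c5 ?c3 ?alN ?addrK //; last first.
  by apply: ltn_trans (mu_descent _) mj; rewrite c3.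
rewrite (IH i (s j (s i x))) ?c4 ?c2 ?alN ?addKr //; last first.
  by apply: ltn_trans (mu_descent _) mi; rewrite c2.
by rewrite -c1 -(rho_braid _ c).
Qed.

Variable G : pred X.
Hypotheses (Gs : forall i x, G x -> G (s i x)) (Gal : forall i x, G x -> al i x != 0).

Definition regular_hom t : M := \sum_(x | G x) t x *: word_at x.

Lemma regular_hom_is_linear : linear regular_hom.
Proof.
move=> k t u; rewrite /regular_hom scaler_sumr -big_split /=.
by apply: eq_bigr => x _; rewrite !TE scalerDl scalerA.
Qed.
HB.instance Definition _ := GRing.isLinear.Build K T M _ regular_hom
  regular_hom_is_linear.

Lemma regular_hom_delta x : regular_hom (delta K x) = if G x then word_at x else 0.
Proof.
rewrite /regular_hom; case: ifP => Gx.
  rewrite (bigD1 x) //= ffunE eqxx scale1r big1 ?addr0 // => y /andP[_ yx].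
  by rewrite ffunE (negbTE yx) scale0r.
rewrite big1 // => y Gy; rewrite ffunE; case: eqP => [e|_]; last by rewrite scale0r.
by rewrite -e Gy in Gx.
Qed.

(** At an ascent the image gains one factor by [word_at_descent]; at a descent the quadratic
    relation in [M] matches that of [tau]. The vanishing root, for which [tau] acts by the scalar
    [q ^+ 2], does not occur on [G], and outside [G] both sides are 0. *)
Lemma regular_hom_tau i t : regular_hom (tau q s al i t) = rho i (regular_hom t).
Proof.
move: t; apply: (delta_ext (f := regular_hom \o tau q s al i)
  (g := rho i \o regular_hom)) => x /=.
rewrite tau_delta // regular_hom_delta.
have Gsx : G (s i x) = G x by apply/idP/idP => [/(Gs i)|/(Gs i)//]; rewrite sK.
have [Gx|/negbTE Gx] := boolP (G x); last first.
  rewrite linear0; case: ifP => _; first by rewrite regular_hom_delta Gsx Gx.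
  by case: ifP => _; rewrite ?linearD !linearZ /= !regular_hom_delta ?Gsx Gx !scaler0 ?addr0.
rewrite (negbTE (Gal i Gx)); case: ltrgt0P (Gal i Gx) => // ix _.
  by rewrite regular_hom_delta Gsx Gx (@word_at_descent i) ?sK // alN oppr_lt0.
rewrite linearD !linearZ /= !regular_hom_delta Gsx Gx.
by rewrite (word_at_descent ix) rho_quadratic.
Qed.

End Hom.
End Descents.

Lemma commuting_sym (I X : finType) (s : I -> X -> X) (al : I -> X -> int) i j :
  commuting s al i j -> commuting s al j i.
Proof. by move=> c x; have [-> -> ->] := c x. Qed.

Lemma braiding_sym (I X : finType) (s : I -> X -> X) (al : I -> X -> int) i j :
  braiding s al i j -> braiding s al j i.
Proof. by move=> c x; have [-> -> ->] := c x; split=> //; rewrite addrC. Qed.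

Ltac ffcases := repeat match goal with
  | |- context [?a == ?b] => case: (eqVneq a b) => [?|?]; try subst
  end.

Ltac ffdone := try done; match goal with
  | H : is_true (?a != ?a) |- _ => by rewrite eqxx in H
  end.

(** * Hecke operators of type D *)

Section Positions.
Variables (n d : nat).
Implicit Types (r : multi n d) (a b c e : 'I_d).

(** The flag separates the two kinds of reflections of type D, an exchange of two letters and an
    exchange combined with two sign changes; [sgn_diff] is the corresponding root value. One
    treatment serves for both. *)
Definition sgn_swap (l : bool) r a b := if l then swap_rev r a b else swap r a b.
Definition sgn_diff (l : bool) r a b : int :=
  if l then (n.*2)%:Z - ((r a)%:Z + (r b)%:Z) else (r b)%:Z - (r a)%:Z.

Lemma swapE r a b k : swap r a b k = if k == a then r b else if k == b then r a else r k.
Proof. by rewrite ffunE. Qed.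
Lemma swap_revE r a b k : swap_rev r a b k =
  if k == a then rev_ord (r b) else if k == b then rev_ord (r a) else r k.
Proof. by rewrite ffunE. Qed.
Let swE := (swapE, swap_revE).

Lemma rev_ordZ (x : 'I_(n.*2).+1) : (rev_ord x)%:Z = (n.*2)%:Z - x%:Z :> int.
Proof. by have := ltn_ord x; rewrite /=; lia. Qed.

Lemma sgn_swapK l r a b : a != b -> sgn_swap l (sgn_swap l r a b) a b = r.
Proof.
move=> ab; apply/ffunP => k; case: l => /=; rewrite !swE !eqxx [b == a]eq_sym (negbTE ab);
  by ffcases; rewrite ?rev_ordK; ffdone.
Qed.

Lemma sgn_diffN l r a b : a != b -> sgn_diff l (sgn_swap l r a b) a b = - sgn_diff l r a b.
Proof.
move=> ab; case: l; rewrite /sgn_diff /= !swE eqxx [b == a]eq_sym (negbTE ab) eqxx //;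
  rewrite ?rev_ordZ; lia.
Qed.

Lemma sgn_diff0 l r a b : sgn_diff l r a b = 0 -> sgn_swap l r a b = r.
Proof.
move=> e; apply/ffunP => k; apply/val_inj; move: e; case: l => /=; rewrite !swE;
  ffcases; rewrite /=; try have := ltn_ord (r b); try have := ltn_ord (r a); rewrite /sgn_diff; lia.
Qed.

Lemma sgn_swap_out l r a b k : k != a -> k != b -> sgn_swap l r a b k = r k.
Proof. by move=> ka kb; case: l; rewrite /= swE (negbTE ka) (negbTE kb). Qed.

Lemma sgn_swap_comm l m r a b c e : uniq [:: a; b; c; e] ->
  [/\ sgn_swap l (sgn_swap m r c e) a b = sgn_swap m (sgn_swap l r a b) c e,
      sgn_diff m (sgn_swap l r a b) c e = sgn_diff m r c e &
      sgn_diff l (sgn_swap m r c e) a b = sgn_diff l r a b].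
Proof.
rewrite /= !inE !negb_or -!andbA => /and5P[ab ac ae bc /and3P[be ce _]].
split.
- apply/ffunP => k; case: l; case: m; rewrite /= !swE ?eqxx; neqs;
    by ffcases; rewrite ?rev_ordK; ffdone.
- by rewrite /sgn_diff !sgn_swap_out // eq_sym.
- by rewrite /sgn_diff !sgn_swap_out // eq_sym.
Qed.

Lemma sgn_swap_same r a b : a != b ->
  [/\ sgn_swap false (sgn_swap true r a b) a b = sgn_swap true (sgn_swap false r a b) a b,
      sgn_diff true (sgn_swap false r a b) a b = sgn_diff true r a b &
      sgn_diff false (sgn_swap true r a b) a b = sgn_diff false r a b].
Proof.
move=> ab; split.
- apply/ffunP => k; rewrite /= !swE ?eqxx; neqs; by ffcases; rewrite ?rev_ordK; ffdone.
- by rewrite /sgn_diff /= !swE ?eqxx; neqs; lia.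
- by rewrite /sgn_diff /= !swE ?eqxx; neqs; rewrite !rev_ordZ; lia.
Qed.

Lemma sgn_swap_braid l r a b c : uniq [:: a; b; c] ->
  [/\ sgn_swap false (sgn_swap l (sgn_swap false r a b) b c) a b =
      sgn_swap l (sgn_swap false (sgn_swap l r b c) a b) b c,
      sgn_diff l (sgn_swap false r a b) b c = sgn_diff false r a b + sgn_diff l r b c &
      sgn_diff false (sgn_swap l r b c) a b = sgn_diff false r a b + sgn_diff l r b c].
Proof.
rewrite /= !inE !negb_or -!andbA => /and4P[ab ac bc _]; split.
- apply/ffunP => k; case: l; rewrite /= !swE ?eqxx; neqs;
    by ffcases; rewrite ?rev_ordK; ffdone.
- by case: l; rewrite /sgn_diff /= !swE ?eqxx; neqs; lia.
- by case: l; rewrite /sgn_diff /= !swE ?eqxx; neqs; rewrite ?rev_ordZ; lia.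
Qed.

End Positions.

Section TypeD.
Variables (n d : nat).
Hypothesis d2 : (1 < d)%N.
Implicit Types (r : multi n d) (i j k : 'I_d).

Definition is_last j := j.+1 == d.
(** The last generator acts on the last two positions. For [2 <= d] the predecessor in [fst_pos]
    always exists, while the default in [snd_pos] is the intended value at the last index. *)
Definition fst_pos j : 'I_d := if is_last j then odflt j (insub j.-1) else j.
Definition snd_pos j : 'I_d := odflt j (insub j.+1).

Lemma snd_posE j : (snd_pos j : nat) = (if is_last j then j : nat else j.+1).
Proof.
rewrite /snd_pos /is_last; have := ltn_ord j.
by case: insubP => /= [k kd ->|]; case: eqP; lia.
Qed.

Lemma fst_posE j : (fst_pos j : nat) = (if is_last j then j.-1 else j : nat).
Proof.
rewrite /fst_pos /is_last; have := ltn_ord j; case: eqP => // e.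
by case: insubP => /= [k kd ->|]; lia.
Qed.

Lemma fst_snd_pos j : fst_pos j != snd_pos j.
Proof.
rewrite -val_eqE /= fst_posE snd_posE /is_last; case: (j.+1 =P d); lia.
Qed.

Definition simple_refl j r := sgn_swap (is_last j) r (fst_pos j) (snd_pos j).
Definition simple_root j r := sgn_diff (is_last j) r (fst_pos j) (snd_pos j).
Definition height r : nat := \sum_(k < d) (d.-1 - k) * r k.

Lemma simple_reflK j : involutive (simple_refl j).
Proof. by move=> r; apply/sgn_swapK/fst_snd_pos. Qed.

Lemma simple_rootN j r : simple_root j (simple_refl j r) = - simple_root j r.
Proof. exact/sgn_diffN/fst_snd_pos. Qed.

Lemma simple_root0 j r : simple_root j r = 0 -> simple_refl j r = r.
Proof. exact: sgn_diff0. Qed.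

(** The weights in [height] decrease by one at each step to the right, so moving the smaller letter
    left lowers it. For the last generator the two weights are 1 and 0, and the letter of weight 1
    is replaced by a smaller one. *)
Lemma height_descent j r : simple_root j r < 0 -> (height (simple_refl j r) < height r)%N.
Proof.
move=> jr; rewrite /height (bigD1 (fst_pos j)) //= (bigD1 (snd_pos j)) /=; last first.
  by rewrite eq_sym fst_snd_pos.
rewrite [X in (_ < X)%N](bigD1 (fst_pos j)) //= [X in (_ < _ + X)%N](bigD1 (snd_pos j)) /=; last first.
  by rewrite eq_sym fst_snd_pos.
under eq_bigr => k /andP[k1 k2] do rewrite sgn_swap_out //.
rewrite !addnA ltn_add2r.
have fs := fst_snd_pos j; move: jr; rewrite /simple_root /simple_refl /sgn_diff.
have [jd d1] := (ltn_ord j, d2); have := snd_posE j; have := fst_posE j.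
move: (fst_pos j) (snd_pos j) fs => a b ab.
have [ra rb] := (ltn_ord (r a), ltn_ord (r b)).
rewrite /is_last; case: eqP => e /= -> ->; rewrite ?swap_revE ?swapE !eqxx eq_sym (negbTE ab) /=.
  have [-> ->] : (d.-1 - j = 0)%N /\ (d.-1 - j.-1 = 1)%N by lia.
  by rewrite !mul0n !mul1n; lia.
move=> rr; have : (r b < r a)%N by lia.
have : (d.-1 - j = (d.-1 - j.+1).+1)%N by lia.
by move=> -> ?; rewrite !mulSn; lia.
Qed.

(** The Dynkin diagram of type D. In indices starting from 0, the nodes up to [d-2] form a chain;
    the last node [d-1] is joined to [d-3] only, and it commutes with [d-2], which acts on the same
    two positions. *)
Lemma type_D_pairs i j :
  [\/ i = j, commuting (@simple_refl) simple_root i j | braiding (@simple_refl) simple_root i j].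
Proof.
wlog ij : i j / (i <= j)%N.
  move=> wl; case: (leqP i j) => [/wl//|/ltnW/wl[->|c|c]]; first exact: Or31.
    exact/Or32/commuting_sym.
  exact/Or33/braiding_sym.
case: (eqVneq i j) => [|nij]; first exact: Or31.
have {nij}ij : (i < j)%N by rewrite ltn_neqAle nij ij.
have jd := ltn_ord j; have i0 : is_last i = false by apply/eqP; lia.
have fi : fst_pos i = i by rewrite /fst_pos i0.
have si := snd_posE i; have fj := fst_posE j; have sj := snd_posE j.
rewrite i0 in si.
case jl : (is_last j) fj sj => fj sj; last first.
  case: (eqVneq i.+1 j) => [e|ne]; [apply: Or33|apply: Or32] => r.
    have e1 : snd_pos i = fst_pos j by apply/val_inj; rewrite /= si fj.
    rewrite /simple_refl /simple_root fi i0 jl e1; apply: sgn_swap_braid.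
    by rewrite /= !inE !negb_or -!val_eqE /= fj sj; lia.
  rewrite /simple_refl /simple_root fi i0 jl; apply: sgn_swap_comm.
  by rewrite /= !inE !negb_or -!val_eqE /= si fj sj; lia.
case: (eqVneq i.+1 j) => [e|ne].
  apply: Or32 => r.
  have e1 : fst_pos j = i by apply/val_inj; rewrite /= fj; lia.
  have e2 : snd_pos i = j by apply/val_inj; rewrite /= si.
  have e3 : snd_pos j = j by apply/val_inj; rewrite /= sj.
  rewrite /simple_refl /simple_root fi i0 jl e1 e2 e3; apply: sgn_swap_same.
  by rewrite -val_eqE /=; lia.
case: (eqVneq i.+2 j) => [e|ne2]; [apply: Or33|apply: Or32] => r.
  have e1 : snd_pos i = fst_pos j by apply/val_inj; rewrite /= si fj; lia.
  rewrite /simple_refl /simple_root fi i0 jl e1; apply: sgn_swap_braid.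
  by rewrite /= !inE !negb_or -!val_eqE /= fj sj; lia.
rewrite /simple_refl /simple_root fi i0 jl; apply: sgn_swap_comm.
by rewrite /= !inE !negb_or -!val_eqE /= si fj sj; lia.
Qed.

Lemma braiding_next i j : j = i.+1 :> nat -> (j.+1 < d)%N -> braiding (@simple_refl) simple_root i j.
Proof.
move=> ji jd r; have i0 : is_last i = false by apply/eqP; lia.
have j0 : is_last j = false by apply/eqP; lia.
have e1 : snd_pos i = j by apply/val_inj; rewrite /= snd_posE i0.
rewrite /simple_refl /simple_root /fst_pos i0 j0 e1; apply: sgn_swap_braid.
by rewrite /= !inE !negb_or -!val_eqE /= snd_posE j0; lia.
Qed.

Lemma braiding_last i j : j.+1 = d -> i.+3 = d -> braiding (@simple_refl) simple_root i j.
Proof.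
move=> jd id r; have i0 : is_last i = false by apply/eqP; lia.
have jl : is_last j by apply/eqP.
have e1 : snd_pos i = fst_pos j by apply/val_inj; rewrite /= snd_posE fst_posE i0 jl; lia.
have fi : fst_pos i = i by rewrite /fst_pos i0.
rewrite /simple_refl /simple_root fi i0 jl e1; apply: sgn_swap_braid.
by rewrite /= !inE !negb_or -!val_eqE /= snd_posE fst_posE jl; lia.
Qed.

Lemma commuting_far i j : (j.+2 <= i)%N -> (i.+1 < d)%N -> commuting (@simple_refl) simple_root i j.
Proof.
move=> ji id r; have i0 : is_last i = false by apply/eqP; lia.
have j0 : is_last j = false by apply/eqP; lia.
rewrite /simple_refl /simple_root /fst_pos i0 j0; apply: sgn_swap_comm.
by rewrite /= !inE !negb_or -!val_eqE /= !snd_posE i0 j0; lia.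
Qed.

Lemma commuting_last i j : i.+1 = d -> j.+3 <> d -> i != j ->
  commuting (@simple_refl) simple_root i j.
Proof.
move=> id jd; rewrite -val_eqE /= => ij; have jltd := ltn_ord j.
apply: commuting_sym => r.
have il : is_last i by apply/eqP.
have j0 : is_last j = false by apply/eqP; lia.
have fj : fst_pos j = j by rewrite /fst_pos j0.
have sj := snd_posE j; have fi := fst_posE i; have si := snd_posE i.
rewrite j0 in sj; rewrite il in fi si.
case: (eqVneq j.+1 i) => [e|ne].
  have e1 : fst_pos i = j by apply/val_inj; rewrite /= fi; lia.
  have e2 : snd_pos j = i by apply/val_inj; rewrite /= sj.
  have e3 : snd_pos i = i by apply/val_inj; rewrite /= si.
  rewrite /simple_refl /simple_root fj j0 il e1 e2 e3; apply: sgn_swap_same.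
  by rewrite -val_eqE /=; lia.
rewrite /simple_refl /simple_root fj j0 il; apply: sgn_swap_comm.
by rewrite /= !inE !negb_or -!val_eqE /= sj fi si; lia.
Qed.

End TypeD.

Section HeckeOperators.
Variables (n d : nat) (K : fieldType) (q : K).
Hypothesis d2 : (1 < d)%N.
Local Notation T := {ffun multi n d -> K^o}.
Implicit Types (i j : 'I_d) (t : T).

Definition htau j : T -> T := tau q (@simple_refl n d) (@simple_root n d) j.

HB.instance Definition _ j := GRing.Linear.copy (htau j) (tau q (@simple_refl n d) (@simple_root n d) j).

Definition htau_end j : 'End(T) := linfun (htau j).

Lemma htau_endE j t : htau_end j t = htau j t.
Proof. exact: lfunE. Qed.

Lemma HRep_gen j : Rep true htau_end (fgen K j) (htau j).
Proof. by move=> t; rewrite Rep_gen htau_endE. Qed.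

Lemma htau_quadratic i t : htau i (htau i t) = (q ^+ 2 - 1) *: htau i t + q ^+ 2 *: t.
Proof. by apply: tau_quadratic => *; [exact: simple_reflK|exact: simple_rootN|exact: simple_root0]. Qed.

Lemma htau_commute i j t : commuting (@simple_refl n d) (@simple_root n d) i j ->
  htau i (htau j t) = htau j (htau i t).
Proof. by move=> c; apply: tau_commute. Qed.

Lemma htau_braid i j t : braiding (@simple_refl n d) (@simple_root n d) i j ->
  htau i (htau j (htau i t)) = htau j (htau i (htau j t)).
Proof. by move=> c; apply: tau_braid => // *; [exact: simple_reflK|exact: simple_rootN|exact: simple_root0]. Qed.

End HeckeOperators.

Lemma Hecke_rel_hold n d (d2 : (1 < d)%N) a b : @Hecke_rel d a b ->
  end_lift true (@htau_end n d _ v) a = end_lift true (@htau_end n d _ v) b.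
Proof.
case.
- move=> i; eapply Rep_eq; [rep HRep_gen|rep HRep_gen|] => t /=.
  exact: (htau_quadratic v d2).
- move=> i j ji jd; eapply Rep_eq; [rep HRep_gen|rep HRep_gen|] => t /=.
  exact: (htau_braid v d2 t (braiding_next d2 ji jd)).
- move=> i j ij id; eapply Rep_eq; [rep HRep_gen|rep HRep_gen|] => t /=.
  exact: (htau_commute v t (commuting_sym (commuting_far d2 ij id))).
(* The relation includes the trivial case of equal generators, which is split off because
   [commuting] concerns distinct reflections. *)
- move=> i j id jd; case: (eqVneq i j) => [->//|ij].
  eapply Rep_eq; [rep HRep_gen|rep HRep_gen|] => t /=.
  exact: (htau_commute v t (commuting_sym (commuting_last d2 id jd ij))).
- move=> i j id jd; eapply Rep_eq; [rep HRep_gen|rep HRep_gen|] => t /=.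
  exact: (htau_braid v d2 t (braiding_sym (braiding_last d2 id jd))).
Qed.

(** * Commutation of the two actions *)

Section Commutation.
Variables (n : nat) (K : fieldType) (q : K).
Hypothesis q0 : q != 0.
Local Notation letter := 'I_(n.*2).+1.
Local Notation T d := {ffun multi n d -> K^o}.
Implicit Types (x y c e : letter).

(** One Hecke operator at two arbitrary positions, so that positions can be shifted when a tensor
    factor is removed; the index type of [tau] is [unit] since there is a single reflection. *)
Definition pair_tau d l (a b : 'I_d) : T d -> T d :=
  tau q (fun _ : unit => sgn_swap l ^~ a ^~ b) (fun _ r => sgn_diff l r a b) tt.

HB.instance Definition _ d l a b := GRing.Linear.copy (@pair_tau d l a b)
  (tau q (fun _ : unit => sgn_swap l ^~ a ^~ b) (fun _ r => sgn_diff l r a b) tt).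

Lemma pair_tauE d l (a b : 'I_d) (t : T d) r : pair_tau l a b t r =
  if 0 <= sgn_diff l r a b then q ^+ 2 * t (sgn_swap l r a b)
  else t (sgn_swap l r a b) + (q ^+ 2 - 1) * t r.
Proof. exact: tauE. Qed.

Lemma del_pair_tau d l (a b : 'I_d) c (t : T d.+1) :
  del c (pair_tau l (lift ord0 a) (lift ord0 b) t) = pair_tau l a b (del c t).
Proof.
apply/ffunP => r; rewrite [LHS]ffunE !pair_tauE.
have -> : sgn_diff l (mcons c r) (lift ord0 a) (lift ord0 b) = sgn_diff l r a b.
  by rewrite /sgn_diff !mconsS.
have -> : sgn_swap l (mcons c r) (lift ord0 a) (lift ord0 b) = mcons c (sgn_swap l r a b).
  apply/ffunP => k; case: l; rewrite ffunE; case: (unliftP ord0 k) => [k'|] ->;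
    by rewrite ?mcons0 ?mconsS ?(inj_eq lift_inj) ?ffunE.
by rewrite ![del c t _]ffunE.
Qed.

Lemma del2_pair_tau d c e (t : T d.+2) :
  del e (del c (pair_tau false ord0 (lift ord0 ord0) t)) =
  if (c <= e)%N then q ^+ 2 *: del c (del e t)
  else del c (del e t) + (q ^+ 2 - 1) *: del e (del c t).
Proof.
have de (u : T d.+2) a b r : del b (del a u) r = u (mcons a (mcons b r)).
  by rewrite ffunE ffunE.
apply/ffunP => r; rewrite de pair_tauE /sgn_diff mcons0 mconsS mcons0.
have -> : sgn_swap false (mcons c (mcons e r)) ord0 (lift ord0 ord0) = mcons e (mcons c r).
  apply/ffunP => k; rewrite ffunE; case: (unliftP ord0 k) => [k'|] ->.
    rewrite mconsS (inj_eq lift_inj); case: (unliftP ord0 k') => [k''|] ->.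
      by rewrite !mconsS.
    by rewrite !mconsS !mcons0.
  by rewrite !mconsS !mcons0.
rewrite subr_ge0 lez_nat; case: ifP => _; by rewrite !TE !de.
Qed.

Lemma del2_op d p x y c e (t : T d.+2) : p != 0 ->
  del e (del c (op p x y t)) =
    (opw p y c * opw p y e) *: op p x y (del e (del c t))
    + (opw p y c * (e == y)%:R) *: gd p false y (del x (del c t))
    + (opw p y c * (e == rev_ord y)%:R) *: gd p true y (del (rev_ord x) (del c t))
    + ((c == y)%:R * gdw p false y e) *: gd p false y (del e (del x t))
    + ((c == rev_ord y)%:R * gdw p true y e) *: gd p true y (del e (del (rev_ord x) t)).
Proof.
move=> p0; rewrite del_op !linE del_op !(del_gd _ _ _ _ p0) !scalerDr !scalerA.
by apply/ffunP => r; rewrite !TE; ring.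
Qed.

(* The action of tau_1 and of the first two tensor factors of op on the        *)
(* coefficients u c e of v_c (x) v_e (x) m.                                    *)
Definition tw (u : letter -> letter -> K) c e : K :=
  if (c <= e)%N then q ^+ 2 * u e c else u e c + (q ^+ 2 - 1) * u c e.

Definition push (kp gp : letter -> K) x y (u : letter -> letter -> K) c e : K :=
  (kp c * (e == y)%:R) * u c x + ((c == y)%:R * gp e) * u x e.

(** The letters [x] and [y] are consecutive, so any third letter compares in the same way with both
    and the two sides agree. When [c] and [e] both equal [y], the comparison changes and the factor
    [q ^+ 2] between [kp y] and [gp y] compensates for it. *)
Lemma push_tw kp gp x y u c e : (forall a, a != y -> kp a = gp a) ->
    (y = x.+1 :> nat /\ kp y = q ^+ 2 * gp y) \/ (x = y.+1 :> nat /\ gp y = q ^+ 2 * kp y) ->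
  push kp gp x y (tw u) c e = tw (push kp gp x y u) c e.
Proof.
move=> kg adj; have nN (a b : letter) : a != b -> a <> b :> nat.
  by move=> ab /val_inj e'; rewrite e' eqxx in ab.
have xy : x != y by rewrite -val_eqE; apply/eqP => /= h; case: adj => -[]; lia.
have cmp a : a != x -> a != y ->
    [/\ (a <= x)%N = (a <= y)%N, (x <= a)%N = ~~ (a <= y)%N & (y <= a)%N = ~~ (a <= y)%N].
  by move=> /nN ax /nN ay; split; case: adj => -[]; lia.
rewrite /push /tw; case: (eqVneq c y) => [->|cy]; case: (eqVneq e y) => [->|ey] /=;
  rewrite ?(mulr0, mul0r, mulr1, mul1r, addr0, add0r); last by case: ifP.
- rewrite leqnn; case: adj => -[a ->]; [have [-> ->] : (y <= x)%N = false /\ (x <= y)%N by lia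
    |have [-> ->] : (y <= x)%N /\ (x <= y)%N = false by lia]; ring.
- case: (eqVneq e x) => [->|ex].
    by rewrite leqnn (kg x xy); case: ifP => _; ring.
  by rewrite (kg e ey); have [_ -> ->] := cmp e ex ey; case: ifP => _; ring.
- case: (eqVneq c x) => [->|cx].
    by rewrite leqnn (kg x xy); case: ifP => _; ring.
  by rewrite (kg c cy); have [-> _ _] := cmp c cx cy; case: ifP => _; ring.
Qed.

(** By [del2_op] the operator splits into a part on the tail, whose coefficient is symmetric in the
    first two letters, and two parts of the form [push], one for [x] to [y] and one for the mirror
    letters; [push_tw] handles each of these. *)
Lemma op_pair_tau0 d p x y (t : T d.+2) : farl x y ->
    (y = x.+1 :> nat /\ p = q) \/ (x = y.+1 :> nat /\ p = q^-1) ->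
  op p x y (pair_tau false ord0 (lift ord0 ord0) t) =
  pair_tau false ord0 (lift ord0 ord0) (op p x y t).
Proof.
move=> xy adj; have p0 : p != 0 by case: adj => -[_ ->]; rewrite ?invr_eq0.
apply: del_inj => c; apply: del_inj => e; rewrite del2_pair_tau !(del2_op _ _ _ _ _ p0).
rewrite !del2_pair_tau; apply/ffunP => r; rewrite !TE.
pose u1 (a b : letter) := op p x y (del b (del a t)) r.
pose u2 (a b : letter) := gd p false y (del b (del a t)) r.
pose u3 (a b : letter) := gd p true y (del b (del a t)) r.
have tw1 (a b : letter) : op p x y (if (a <= b)%N then q ^+ 2 *: del a (del b t)
    else del a (del b t) + (q ^+ 2 - 1) *: del b (del a t)) r = tw u1 a b.
  by rewrite /tw; case: ifP => _; rewrite !linE !TE.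
have tw2 (a b : letter) : gd p false y (if (a <= b)%N then q ^+ 2 *: del a (del b t)
    else del a (del b t) + (q ^+ 2 - 1) *: del b (del a t)) r = tw u2 a b.
  by rewrite /tw; case: ifP => _; rewrite !linE !TE.
have tw3 (a b : letter) : gd p true y (if (a <= b)%N then q ^+ 2 *: del a (del b t)
    else del a (del b t) + (q ^+ 2 - 1) *: del b (del a t)) r = tw u3 a b.
  by rewrite /tw; case: ifP => _; rewrite !linE !TE.
rewrite !tw1 !tw2 !tw3.
have [rx ry] : rev_ord x = (n.*2 - x)%N :> nat /\ rev_ord y = (n.*2 - y)%N :> nat.
  by split; rewrite /=; lia.
have [lx ly] := (ltn_ord x, ltn_ord y).
have e2 : push (opw p y) (gdw p false y) x y (tw u2) c e =
    tw (push (opw p y) (gdw p false y) x y u2) c e.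
  apply: push_tw => [a /negbTE ay|]; first by rewrite /opw /gdw ay mul1r.
  rewrite /opw /gdw eqxx; case: adj => -[yx ->]; [left|right]; split => //;
    case: (y == _); field; by rewrite ?oner_neq0 ?q0.
have e3 : push (opw p y) (gdw p true y) (rev_ord x) (rev_ord y) (tw u3) c e =
    tw (push (opw p y) (gdw p true y) (rev_ord x) (rev_ord y) u3) c e.
  apply: push_tw => [a /negbTE ay|]; first by rewrite /opw /gdw ay.
  rewrite /opw /gdw eqxx; case: adj => -[yx ->]; [right|left]; (split; first lia);
    case: (rev_ord y == _); field; by rewrite ?oner_neq0 ?q0.
transitivity (opw p y c * opw p y e * tw u1 c e + push (opw p y) (gdw p false y) x y (tw u2) c e
  + push (opw p y) (gdw p true y) (rev_ord x) (rev_ord y) (tw u3) c e).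
  by rewrite /push; ring.
by rewrite e2 e3 /push /tw /u1 /u2 /u3; case: ifP => _; rewrite !TE; ring.
Qed.

Definition flip_last d (a : 'I_d) (t : T d) : T d :=
  [ffun r : multi n d => t (subst r a (rev_ord (r a)))].

Lemma flip_last_is_linear d a : linear (@flip_last d a).
Proof. by move=> k t u; apply/ffunP => r; rewrite !(ffunE, TE). Qed.
HB.instance Definition _ d a :=
  GRing.isLinear.Build K (T d) (T d) _ (@flip_last d a) (@flip_last_is_linear d a).

Lemma subst_subst d (r : multi n d) a x y : subst (subst r a x) a y = subst r a y.
Proof. by apply/ffunP => k; rewrite !ffunE; case: eqP. Qed.

Lemma subst_id d (r : multi n d) a : subst r a (r a) = r.
Proof. by apply/ffunP => k; rewrite !ffunE; case: eqP => [->|]. Qed.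

(** Changing the sign of the last letter realises the diagram automorphism of type D, which
    exchanges the last two Hecke generators. *)
Lemma pair_tau_flip d (a b : 'I_d) (t : T d) : a != b ->
  pair_tau true a b t = flip_last b (pair_tau false a b (flip_last b t)).
Proof.
move=> ab; apply/ffunP => r; rewrite [RHS]ffunE !pair_tauE.
set r' := subst r b (rev_ord (r b)).
have -> : sgn_diff false r' a b = sgn_diff true r a b.
  rewrite /sgn_diff !ffunE eqxx (negbTE ab) rev_ordZ /=; lia.
have fl : flip_last b t r' = t r by rewrite ffunE !ffunE eqxx subst_subst rev_ordK subst_id.
have -> : flip_last b t (sgn_swap false r' a b) = t (sgn_swap true r a b).
  rewrite ffunE; congr (t _); apply/ffunP => k; rewrite /= !ffunE ?eqxx; neqs.
  by ffcases; rewrite ?rev_ordK; ffdone.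
by rewrite fl.
Qed.

Lemma del_flip_last d (a : 'I_d) c (t : T d.+1) :
  del c (flip_last (lift ord0 a) t) = flip_last a (del c t).
Proof.
by apply/ffunP => r; rewrite 2![LHS]ffunE 2![RHS]ffunE mconsS subst_mconsS.
Qed.

Lemma diag_flip_last d p (f : letter -> int) (a : 'I_d) (t : T d) :
  (forall c, f (rev_ord c) = f c) ->
  diag p f (flip_last a t) = flip_last a (diag p f t).
Proof.
move=> fs; apply/ffunP => r; rewrite [LHS]ffunE [flip_last a t r]ffunE.
rewrite [RHS]ffunE [diag p f t _]ffunE; congr (_ ^ _ * _).
by apply: eq_bigr => k _; rewrite ffunE; case: eqP => [->|//]; rewrite fs.
Qed.

Lemma cnt_rev y c : cnt y (rev_ord c) = cnt y c.
Proof.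
rewrite /cnt (inj_eq rev_ord_inj) addrC; congr (_%:Z + _).
by rewrite -{1}(rev_ordK y) (inj_eq rev_ord_inj).
Qed.

Lemma gd_flip_last d p s y (a : 'I_d) (t : T d) :
  gd p s y (flip_last a t) = flip_last a (gd p s y t).
Proof. by apply: diag_flip_last => c; rewrite !cnt_rev. Qed.

(** The last position and its mirror image are neighbours in the extended word, so a letter is
    changed there with the same coefficient in either place. The projections [jp] do not commute
    with this sign change, hence their separate treatment through [J_type_sgn_swap]. *)
Lemma op_flip_last d p x y (a : 'I_d) (t : T d) : a.+1 = d ->
  op p x y (flip_last a t) = flip_last a (op p x y t).
Proof.
elim: d a t => [[]//|d IH] a t; case: (unliftP ord0 a) => [b ->|->].
  rewrite lift0 => -[bd]; apply: del_inj => c.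
  rewrite del_flip_last !(del_op _ _ _ c) !del_flip_last !linearD !linearZ /=.
  by rewrite IH // !gd_flip_last.
case=> d0; subst d; apply: del_inj => c.
have df b (u : T 1) : del b (flip_last ord0 u) = del (rev_ord b) u.
  by apply/ffunP => r; rewrite [LHS]ffunE ffunE [RHS]ffunE mcons0 subst_mcons0.
(* After the last factor the tail is empty and both diagonal operators are the identity, so the two
   terms of the coproduct are exchanged by the flip. *)
have g0 p' s b (u : T 0) : gd p' s b u = u.
  by apply/ffunP => r; rewrite ffunE big_ord0 expr0z mul1r.
rewrite df !(del_op _ _ _ c) !(del_op _ _ _ (rev_ord c)) !df !op_0 !g0 rev_ordK !scaler0 !add0r.
by rewrite (inj_eq rev_ord_inj) -[c == rev_ord y](inj_eq rev_ord_inj) rev_ordK addrC.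
Qed.

Lemma sum_sgn_swap d (f : letter -> int) l (r : multi n d) (a b : 'I_d) : a != b ->
  (forall c, f (rev_ord c) = f c) -> \sum_k f (sgn_swap l r a b k) = \sum_k f (r k).
Proof.
move=> ab fs; rewrite (bigD1 a) //= (bigD1 b) /=; last by rewrite eq_sym.
rewrite [RHS](bigD1 a) //= [X in _ = _ + X](bigD1 b) /=; last by rewrite eq_sym.
rewrite !addrA; congr (_ + _).
  by case: l; rewrite /= !ffunE !eqxx [b == a]eq_sym (negbTE ab) ?fs addrC.
by apply: eq_bigr => k /andP[ka kb]; rewrite sgn_swap_out.
Qed.

Lemma diag_pair_tau d p (f : letter -> int) l (a b : 'I_d) (t : T d) : a != b ->
  (forall c, f (rev_ord c) = f c) ->
  diag p f (pair_tau l a b t) = pair_tau l a b (diag p f t).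
Proof.
move=> ab fs; apply/ffunP => r; rewrite [LHS]ffunE !pair_tauE.
have inv := sum_sgn_swap l r ab fs.
by case: ifP => _; rewrite ![diag p f t _]ffunE inv; ring.
Qed.

Lemma gd_pair_tau d p s y l (a b : 'I_d) (t : T d) : a != b ->
  gd p s y (pair_tau l a b t) = pair_tau l a b (gd p s y t).
Proof. by move=> ab; apply: diag_pair_tau => // c; rewrite !cnt_rev. Qed.

Lemma op_pair_tau_next d p x y (a b : 'I_d) (t : T d) : farl x y ->
    (y = x.+1 :> nat /\ p = q) \/ (x = y.+1 :> nat /\ p = q^-1) -> b = a.+1 :> nat ->
  op p x y (pair_tau false a b t) = pair_tau false a b (op p x y t).
Proof.
move=> xy adj; elim: d a b t => [[]//|d IH] a b t.
case: (unliftP ord0 b) => [b' ->|-> //]; rewrite lift0.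
case: (unliftP ord0 a) => [a' ->|->].
  rewrite lift0 => -[ab]; have ab' : a' != b' by rewrite -val_eqE /= ab; lia.
  apply: del_inj => c; rewrite del_pair_tau !(del_op _ _ _ c) !del_pair_tau IH //.
  by rewrite !gd_pair_tau // !linearD !linearZ.
clear a b IH; case: d b' t => [[]//|d] b' t [b0].
have -> : b' = ord0 by apply/val_inj.
exact: op_pair_tau0.
Qed.

Lemma op_pair_tau_last d p x y (a b : 'I_d) (t : T d) : farl x y ->
    (y = x.+1 :> nat /\ p = q) \/ (x = y.+1 :> nat /\ p = q^-1) ->
    b = a.+1 :> nat -> b.+1 = d ->
  op p x y (pair_tau true a b t) = pair_tau true a b (op p x y t).
Proof.
move=> xy adj ab bd; have nab : a != b by rewrite -val_eqE /= ab; lia.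
rewrite !pair_tau_flip // op_flip_last // op_pair_tau_next // op_flip_last //.
Qed.

End Commutation.

(** A reflection of type D changes the signs of no letter or of two letters, so the parity of the
    number of letters beyond the middle is preserved. *)
Lemma J_type_sgn_swap n d l (r : multi n d) (a b : 'I_d) : a != b -> J_type (sgn_swap l r a b) = J_type r.
Proof.
move=> ab.
have mid (x : 'I_(n.*2).+1) : (rev_ord x == n :> nat) = (x == n :> nat).
  by have := ltn_ord x; rewrite /=; lia.
have ex (u : multi n d) : [exists k, u k == n :> nat] -> [exists k, sgn_swap l u a b k == n :> nat].
  case/existsP => k kn; apply/existsP.
  case: (eqVneq k a) kn => [->|ka] kn.
    exists b; case: l; rewrite /= ffunE [b == a]eq_sym (negbTE ab) eqxx //.
    by rewrite mid.
  case: (eqVneq k b) kn => [->|kb] kn; last by exists k; rewrite sgn_swap_out.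
  by exists a; case: l; rewrite /= ffunE eqxx // mid.
rewrite /J_type.
have -> : [exists k, sgn_swap l r a b k == n :> nat] = [exists k, r k == n :> nat].
  by apply/idP/idP => [/ex|/ex//]; rewrite sgn_swapK.
clear ex; case: ifP => // /negbT/existsPn noex; congr (Some (~~ _)).
rewrite -!sum1_card ![in LHS]big_mkcond ![in RHS]big_mkcond.
rewrite (bigD1 a) //= (bigD1 b) /=; last by rewrite eq_sym.
rewrite [in RHS](bigD1 a) //= [X in _ = odd (_ + X)](bigD1 b) /=; last by rewrite eq_sym.
rewrite !addnA ![in LHS]oddD ![in RHS]oddD; congr (_ (+) _).
  rewrite !inE; case: l; rewrite /= !ffunE !eqxx [b == a]eq_sym (negbTE ab); last by rewrite addbC.
  have fl (x : 'I_(n.*2).+1) : x != n :> nat -> (n <= rev_ord x)%N = ~~ (n <= x)%N.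
    by have := ltn_ord x; rewrite /=; lia.
  by rewrite !fl ?noex //; do 2!case: (n <= _)%N.
congr odd; apply: eq_bigr => k /andP[ka kb].
by rewrite !inE sgn_swap_out.
Qed.

Section ActionsCommute.
Variables (n d : nat) (K : fieldType) (q : K).
Hypotheses (d2 : (1 < d)%N) (q0 : q != 0).
Local Notation T := {ffun multi n d -> K^o}.
Implicit Types (r : multi n d) (t : T) (j : 'I_d).

Lemma htau_pair j t :
  htau q j t = pair_tau q (is_last j) (fst_pos j) (snd_pos j) t.
Proof. by apply/ffunP => r; rewrite [RHS]pair_tauE [LHS]tauE. Qed.

Lemma jp_pair_tau al l (a b : 'I_d) t : a != b ->
  jp al (pair_tau q l a b t) = pair_tau q l a b (jp al t).
Proof.
move=> ab; apply/ffunP => r; rewrite [LHS]ffunE !pair_tauE ![jp al t _]ffunE.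
by rewrite J_type_sgn_swap //; case: ifP => _; ring.
Qed.

Lemma op_htau p x y j t : farl x y ->
    (y = x.+1 :> nat /\ p = q) \/ (x = y.+1 :> nat /\ p = q^-1) ->
  op p x y (htau q j t) = htau q j (op p x y t).
Proof.
move=> xy adj; rewrite !htau_pair.
have fs : snd_pos j = (fst_pos j).+1 :> nat.
  by rewrite snd_posE ?fst_posE // /is_last; case: eqP; lia.
case jl : (is_last j); last exact: op_pair_tau_next.
by apply: op_pair_tau_last => //; rewrite snd_posE // jl; apply/eqP.
Qed.

Lemma Ugen_op_htau g j t : Ugen_op q g (htau q j t) = htau q j (Ugen_op q g t).
Proof.
have ab := fst_snd_pos d2 j.
case: g => [i|i|a|a|al] /=.
- by apply: op_htau; [exact: farl_lo_hi|left; rewrite loE hiE].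
- by apply: op_htau; [exact/farl_sym/farl_lo_hi|right; rewrite loE hiE].
- by rewrite !htau_pair gd_pair_tau.
- by rewrite !htau_pair gd_pair_tau.
- by rewrite !htau_pair jp_pair_tau.
Qed.

End ActionsCommute.

(** * The bicommutant theorem *)

Section OrthogonalProjection.
Variables (K : fieldType) (V : vectType K) (F : V -> V -> K).
Hypotheses (FDl : forall x y z, F (x + y) z = F x z + F y z)
  (FZl : forall k x z, F (k *: x) z = k * F x z)
  (Fsym : forall x y, F x y = F y x) (Fan : forall x, F x x = 0 -> x = 0).

Let F0l z : F 0 z = 0.
Proof. by rewrite -(scale0r 0) FZl mul0r. Qed.
Let FBl x y z : F (x - y) z = F x z - F y z.
Proof. by rewrite FDl -scaleN1r FZl mulN1r. Qed.
Let FDr x y z : F z (x + y) = F z x + F z y.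
Proof. by rewrite !(Fsym z) FDl. Qed.
Let FZr k x z : F z (k *: x) = k * F z x.
Proof. by rewrite !(Fsym z) FZl. Qed.

(** Gram-Schmidt, one vector at a time: [e] is the part of [a] orthogonal to the previous span. If
    [F e e] vanishes, anisotropy gives [e = 0] and [a] adds nothing. *)
Lemma projection_span (X : seq V) x : exists2 y, y \in <<X>>%VS &
  forall z, z \in <<X>>%VS -> F (x - y) z = 0.
Proof.
elim: X x => [|a X IH] x.
  exists 0; first exact: mem0v.
  by move=> z; rewrite span_nil memv0 => /eqP ->; rewrite Fsym F0l.
have [b bX ab] := IH a; have [y yX xy] := IH x.
set e := a - b in ab.
have sub z : z \in <<X>>%VS -> z \in <<a :: X>>%VS.
  by move=> zX; rewrite span_cons -[z]add0r; apply: memv_add => //; apply: mem0v.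
have eX : e \in <<a :: X>>%VS.
  by apply: memvB; [apply: memv_span; exact: mem_head|exact: sub].
have spanE z : z \in <<a :: X>>%VS -> exists k, z - k *: e \in <<X>>%VS.
  rewrite span_cons => /memv_addP[_ /vlineP[k ->] [w wX ->]]; exists k.
  by rewrite /e scalerBr opprB addrC addrA subrK memvD // memvZ.
clearbody e; have [e0|/eqP e0] := eqVneq (F e e) 0.
  exists y; first exact: sub.
  move=> z /spanE[k]; rewrite (Fan e0) scaler0 subr0; exact: xy.
exists (y + (F x e / F e e) *: e); first by apply: memvD; [exact: sub|exact: memvZ].
move=> z /spanE[k zk]; rewrite -(subrK (k *: e) z); move: (z - _) zk => w wX.
have ye : F y e = 0 by rewrite Fsym ab.
rewrite opprD addrA FBl FZl !FDr !FZr (xy w wX) (ab w wX) FBl ye.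
by field; apply/eqP.
Qed.

Variable S : V -> Prop.
Hypotheses (S0 : S 0) (SD : forall x y, S x -> S y -> S (x + y))
  (SZ : forall k x, S x -> S (k *: x)).

(** Among the subspaces contained in [S] take one of maximal dimension; adding the line of any [x]
    in [S] cannot enlarge it. *)
Lemma subspace_vspace : exists U : {vspace V}, forall x, S x <-> x \in U.
Proof.
pose Q k := `[< exists2 U : {vspace V}, forall u, u \in U -> S u & \dim U = k >].
have exQ : exists k, Q k.
  exists 0%N; apply/asboolP; exists 0%VS; last exact: dimv0.
  by move=> u; rewrite memv0 => /eqP ->.
have bQ k : Q k -> (k <= \dim {:V})%N.
  by move=> /asboolP[U _ <-]; apply/dimvS/subvf.
have [k /asboolP[U US <-] max] := ex_maxnP exQ bQ.
exists U => x; split; last exact: US.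
move=> Sx; have UU : (U <= U + <[x]>)%VS by apply: addvSl.
suff /eqP -> : U == (U + <[x]>)%VS by apply: subvP (memv_line x); apply: addvSr.
rewrite eqEdim UU /=; apply: max; apply/asboolP; exists (U + <[x]>)%VS => //.
by move=> _ /memv_addP[u uU [_ /vlineP[l ->] ->]]; apply: SD; [exact: US|exact: SZ].
Qed.

Lemma projection_exists x : exists y, S y /\ forall z, S z -> F (x - y) z = 0.
Proof.
have [U SU] := subspace_vspace.
have [y yU xy] := projection_span (vbasis U) x.
move: yU xy; rewrite (span_basis (vbasisP U)) => yU xy; exists y; split; first exact/SU.
by move=> z /SU; apply: xy.
Qed.

Definition proj x : V := projT1 (cid (projection_exists x)).

Lemma projS x : S (proj x).
Proof. by rewrite /proj; case: cid => y []. Qed.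

Lemma proj_orth x z : S z -> F (x - proj x) z = 0.
Proof. by rewrite /proj; case: cid => y [_] /= h /h. Qed.

Lemma proj_unique x y : S y -> (forall z, S z -> F (x - y) z = 0) -> proj x = y.
Proof.
move=> Sy xy; apply/eqP; rewrite -subr_eq0; apply/eqP/Fan.
have Sd : S (proj x - y) by apply: SD; [exact: projS|rewrite -scaleN1r; exact: SZ].
have -> : F (proj x - y) (proj x - y) = F ((x - y) - (x - proj x)) (proj x - y).
  by congr (F _ _); rewrite opprB [RHS]addrC addrA subrK.
by rewrite FBl xy // proj_orth // subr0.
Qed.

Lemma proj_is_linear : linear proj.
Proof.
move=> k x y; apply: proj_unique => [|z Sz].
  by apply: SD; [apply: SZ|]; apply: projS.
have -> : k *: x + y - (k *: proj x + proj y) = k *: (x - proj x) + (y - proj y).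
  by rewrite scalerBr opprD addrACA.
by rewrite FDl FZl !proj_orth // mulr0 addr0.
Qed.
HB.instance Definition _ := GRing.isLinear.Build K V V _ proj proj_is_linear.

Lemma proj_id x : S x -> proj x = x.
Proof. by move=> Sx; apply: proj_unique => // z _; rewrite subrr F0l. Qed.

End OrthogonalProjection.

Section Bicommutant.
Variables (K : fieldType) (X : finType) (c : X -> K).
Local Notation T := {ffun X -> K^o}.
Hypothesis c0 : forall x, c x != 0.
Hypothesis squares : forall (I : finType) (a : I -> K), \sum_i a i ^+ 2 = 0 -> forall i, a i = 0.

Definition form (t u : T) : K := \sum_x c x ^+ 2 * (t x * u x).

Variable B : 'End(T) -> Prop.
Hypotheses (BD : forall f g, B f -> B g -> B (f + g)) (BZ : forall k f, B f -> B (k *: f))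
  (B1 : B \1%VF) (BM : forall f g, B f -> B g -> B (f \o g)%VF)
  (Badj : forall f, B f -> exists2 g, B g & forall t u, form (f t) u = form t (g u)).

(** The analogue of the Hilbert-Schmidt form. For it, left multiplication by [b] has as adjoint the
    left multiplication by the adjoint of [b]. *)
Definition end_form (f g : 'End(T)) : K := \sum_x form (f (delta K x)) (g (delta K x)).

Let E_Dl f g h : end_form (f + g) h = end_form f h + end_form g h.
Proof.
rewrite /end_form -big_split; apply: eq_bigr => x _ /=; rewrite /form -big_split.
by apply: eq_bigr => y _ /=; rewrite add_lfunE TE; ring.
Qed.
Let E_Zl k f h : end_form (k *: f) h = k * end_form f h.
Proof.
rewrite /end_form mulr_sumr; apply: eq_bigr => x _ /=; rewrite /form mulr_sumr.
by apply: eq_bigr => y _ /=; rewrite scale_lfunE TE; ring.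
Qed.
Let E_sym f g : end_form f g = end_form g f.
Proof.
by apply: eq_bigr => x _; apply: eq_bigr => y _; rewrite [X in _ * X]mulrC.
Qed.
Let E_an f : end_form f f = 0 -> f = 0.
Proof.
rewrite /end_form pair_bigA /= => e; apply/lfunP => t; rewrite zero_lfunE.
have f0 x : f (delta K x) = 0.
  apply/ffunP => y; rewrite TE.
  have := @squares (X * X)%type (fun p => c p.2 * f (delta K p.1) p.2) _ (x, y).
  move=> /(_ _)/eqP h; apply/eqP; move: h; rewrite mulf_eq0 (negbTE (c0 y)) /=; apply.
  by rewrite -[RHS]e; apply: eq_bigr => p _; rewrite exprMn expr2 [in LHS]expr2.
by rewrite [t]delta_sum linear_sum big1 // => x _; rewrite linearZ /= f0 scaler0.
Qed.
Let B0 : B 0.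
Proof. by rewrite -(scale0r \1%VF); apply: BZ. Qed.

Local Notation P := (proj E_Dl E_Zl E_sym E_an B0 BD BZ).

(** The difference [h - P h] is orthogonal to [B]. Since [B] contains an adjoint of [b] and is
    closed under products, [b] composed with this difference is still orthogonal to [B]. *)
Let P_left b h : B b -> P (b \o h)%VF = (b \o P h)%VF.
Proof.
move=> Bb; have [g Bg bg] := Badj Bb; apply: proj_unique => [|z Bz].
  by apply: BM => //; apply: projS.
rewrite -comp_lfunNr -comp_lfunDr.
rewrite (_ : end_form _ _ = end_form (h - P h) (g \o z)%VF); last first.
  by apply: eq_bigr => x _; rewrite !comp_lfunE bg.
by apply: proj_orth; apply: BM.
Qed.

Lemma left_projection : exists P : {linear 'End(T) -> 'End(T)},
  [/\ forall f, B (P f), forall f, B f -> P f = f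
    & forall b h, B b -> P (b \o h)%VF = (b \o P h)%VF].
Proof.
exists P; split=> [f|f|b h]; [exact: projS|exact: proj_id|exact: P_left].
Qed.

(** As a left module over itself, the endomorphism algebra is a direct sum of copies of [T], one for
    each basis vector; this is the inclusion of the copy with index [k]. *)
Definition column k (u : T) : 'End(T) := linfun (fun t : T => t k *: u).

Let column_fun_linear k (u : T) : linear (fun t : T => t k *: u).
Proof. by move=> a t s; rewrite !TE scalerDl scalerA. Qed.

Let columnE k u t : column k u t = t k *: u.
Proof.
pose L := GRing.isLinear.Build K T T _ (fun t : T => t k *: u) (column_fun_linear k u).
pose g : {linear T -> T} := HB.pack (fun t : T => t k *: u) L.
by rewrite /column (lfunE g).
Qed.

Let column_is_linear k : linear (column k).
Proof.
move=> a u w; apply/lfunP => t; rewrite add_lfunE scale_lfunE !columnE.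
by rewrite scalerDr !scalerA mulrC.
Qed.

Let column_comp k (f : 'End(T)) u : column k (f u) = (f \o column k u)%VF.
Proof. by apply/lfunP => t; rewrite comp_lfunE !columnE linearZ. Qed.

Let column_sum (h : 'End(T)) : h = \sum_k column k (h (delta K k)).
Proof.
apply/lfunP => t; rewrite sum_lfunE {1}[t]delta_sum linear_sum.
by apply: eq_bigr => k _; rewrite columnE linearZ.
Qed.

(* von Neumann: the matrix entries of the orthogonal projection P of End T     *)
(* onto the left B-module B commute with B, hence with f, so P (f h) = f P h.  *)
Lemma bicommutant f :
  (forall g, (forall b, B b -> (g \o b = b \o g)%VF) -> (f \o g = g \o f)%VF) -> B f.
Proof.
move=> fC; have [P [PB P_id PM]] := left_projection.
have blockC k l h : (P (column k (f h))) (delta K l) = f (P (column k h) (delta K l)).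
  have lin : linear (fun u => P (column k u) (delta K l)).
    by move=> a u w; rewrite column_is_linear linearP add_lfunE scale_lfunE.
  pose L := GRing.isLinear.Build K T T _ (fun u => P (column k u) (delta K l)) lin.
  pose g : {linear T -> T} := HB.pack (fun u => P (column k u) (delta K l)) L.
  have gC b : B b -> (linfun g \o b = b \o linfun g)%VF.
    move=> Bb; apply/lfunP => u; rewrite !comp_lfunE !lfunE /=.
    by rewrite column_comp PM // comp_lfunE.
  have /lfunP/(_ h) := fC _ gC.
  by rewrite !comp_lfunE !lfunE.
have PC h : P (f \o h)%VF = (f \o P h)%VF.
  have e l : P (f \o h)%VF (delta K l) = f (P h (delta K l)).
    rewrite [in LHS](column_sum (f \o h)%VF) [in RHS](column_sum h) !linear_sum !sum_lfunE.
    by rewrite linear_sum; apply: eq_bigr => k _; rewrite comp_lfunE blockC.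
  apply/lfunP => t; rewrite comp_lfunE [t]delta_sum !linear_sum.
  by apply: eq_bigr => l _; rewrite !linearZ /= e.
(* Applied to the identity, which lies in [B]: the projection of [f] is [f] composed with the
   projection of 1. *)
suff <- : P f = f by apply: PB.
by rewrite -{1}(comp_lfun1r f) PC P_id // comp_lfun1r.
Qed.

End Bicommutant.

(** * Adjoint operators *)

Section Adjoint.
Variables (n : nat) (K : fieldType) (q : K).
Local Notation letter := 'I_(n.*2).+1.
Local Notation T d := {ffun multi n d -> K^o}.
Implicit Types (x y a b : letter).

Definition below a b : int := (b < a)%N%:Z + (rev_ord b < a)%N%:Z.

(* q ^ len makes E_i adjoint to a multiple of F_i, see raise_adjoint; the      *)
(* recursion is the one that turns the coproduct of E_i into that of F_i.      *)
Fixpoint len d : multi n d -> int :=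
  match d with
  | 0 => fun=> 0
  | d'.+1 => fun r => \sum_k below (r ord0) (mtail r k) + @len d' (mtail r)
  end.

Definition qform d (t u : T d) : K := form (fun r => q ^ len r) t u.

Lemma qformE d (t u : T d) : qform t u = \sum_r (q ^ len r) ^+ 2 * (t r * u r).
Proof. by []. Qed.

Lemma qformC d (t u : T d) : qform t u = qform u t.
Proof. by rewrite !qformE; apply: eq_bigr => r _; rewrite [t r * _]mulrC. Qed.

Lemma qformDl d (t t' u : T d) : qform (t + t') u = qform t u + qform t' u.
Proof. by rewrite !qformE -big_split; apply: eq_bigr => r _; rewrite /= TE; ring. Qed.
Lemma qformZl d k (t u : T d) : qform (k *: t) u = k * qform t u.
Proof. by rewrite !qformE mulr_sumr; apply: eq_bigr => r _; rewrite /= TE; ring. Qed.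
Lemma qformDr d (t t' u : T d) : qform u (t + t') = qform u t + qform u t'.
Proof. by rewrite !(qformC u) qformDl. Qed.
Lemma qformZr d k (t u : T d) : qform u (k *: t) = k * qform u t.
Proof. by rewrite !(qformC u) qformZl. Qed.

Lemma qform_diag d p c (t u : T d) : qform (diag p c t) u = qform t (diag p c u).
Proof. by rewrite !qformE; apply: eq_bigr => r _; rewrite !ffunE /=; ring. Qed.

Lemma gd_diag d p s y (t : T d) :
  gd p s y t = diag p (fun a => if s then cnt y a else - cnt y a) t.
Proof. by apply/ffunP => r; rewrite [LHS]ffunE [RHS]ffunE. Qed.

Lemma qform_gd d p s y (t u : T d) : qform (gd p s y t) u = qform t (gd p s y u).
Proof. by rewrite !gd_diag qform_diag. Qed.

Lemma qform_jp d al (t u : T d) : qform (jp al t) u = qform t (jp al u).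
Proof. by rewrite !qformE; apply: eq_bigr => r _; rewrite !ffunE; ring. Qed.

Hypothesis q0 : q != 0.

Lemma qform_mcons d (t u : T d.+1) : qform t u =
  \sum_a qform (del a t) (diag q (fun b => 2 * below a b) (del a u)).
Proof.
rewrite qformE; under [RHS]eq_bigr do rewrite qformE; rewrite pair_bigA /=.
rewrite (reindex (fun p : letter * multi n d => mcons p.1 p.2)) /=; last first.
  exists (fun r : multi n d.+1 => (r ord0, mtail r)) => [[a r] _|r _] /=; last exact: mtailK.
  by rewrite mcons0 mconsK.
apply: eq_bigr => -[a r] _ /=; rewrite mcons0 mconsK !ffunE expfzDr // exprMn.
rewrite -mulr_sumr [2 * _]mulrC -exprz_exp -exprnP; ring.
Qed.

Lemma opwE (p : K) y a : p != 0 -> opw p y a = p ^ ((a == y)%:Z - (a == rev_ord y)%:Z).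
Proof.
move=> p0; rewrite /opw expfzDr // -invr_expz.
by case: (a == y); case: (a == rev_ord y); rewrite /= ?expr1z ?expr0z ?invr1.
Qed.

Lemma below_symm a b : below a (rev_ord b) = below a b.
Proof. by rewrite /below rev_ordK addrC. Qed.

(** Induction on [d] through the first letter. The adjoint of [E_i] is [F_i] times [H_(i+1)] over
    [H_i], up to the scalar [q ^ cnt y y], which is [q], or [q ^+ 2] when [y] is the middle
    letter. *)
Lemma raise_adjoint x y d (t u : T d) : y = x.+1 :> nat -> (y <= n)%N ->
  qform (op q x y t) u =
  qform t (q ^ cnt y y *: op q^-1 y x (gd q false y (gd q true x u))).
Proof.
move=> yx yn; have qi0 : q^-1 != 0 by rewrite invr_eq0.
pose g b := cnt x b - cnt y b; pose Q a b := 2 * below a b.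
have GE e (w : T e) : gd q false y (gd q true x w) = diag q g w.
  by rewrite !gd_diag diagD //; apply: eq_diag => b; rewrite addrC.
rewrite GE.
elim: d t u => [|d IH] t u.
  by rewrite !op_0 scaler0 !qformE !big1 // => r _; rewrite TE ?mulr0 ?mul0r ?mulr0.
have pick1 (F : letter -> T d) (b : letter) w : \sum_a qform ((a == b)%:R *: w) (F a) = qform w (F b).
  rewrite (bigD1 b) //= eqxx scale1r big1 ?addr0 // => a /negbTE ->.
  by rewrite scale0r qformE big1 // => r _; rewrite TE mul0r mulr0.
have pick2 (F : letter -> T d) (b : letter) w : \sum_a qform (F a) ((a == b)%:R *: w) = qform (F b) w.
  by under eq_bigr do rewrite qformC; rewrite pick1 qformC.
rewrite !qform_mcons //.
under eq_bigr do rewrite del_op !qformDl.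
rewrite !big_split /= !pick1.
(* [Q a] is the weight that the first letter [a] adds to the tail. As [x] and [y] are consecutive,
   [below y b - below x b = cnt x b], and likewise the mirror letters differ by [cnt y b]; this
   turns each term of one coproduct into the matching term of the other. *)
have key a : diag q (Q a) (del a (q ^ cnt y y *: op q^-1 y x (diag q g u))) =
    opw q y a *: (q ^ cnt y y *: op q^-1 y x (diag q g (diag q (Q a) (del a u))))
    + (a == x)%:R *: gd q false y (diag q (Q y) (del y u))
    + (a == rev_ord x)%:R *: gd q true y (diag q (Q (rev_ord y)) (del (rev_ord y) u)).
  rewrite !linE del_op !del_diag // !linE.
  rewrite diag_op //; last by rewrite /Q !below_symm.
  rewrite !gdV !gd_diag !diagD // (@eq_diag _ _ _ _ (fun b => Q a b + g b) (fun b => g b + Q a b)); last first.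
    by move=> b; rewrite addrC.
  rewrite !scalerDr !scalerA; congr (_ *: _ + _ + _).
  - rewrite !opwE // exprz_inv -!expfzDr //; congr (_ ^ _).
    rewrite /Q /g /below /cnt; clear -yx yn; rewrite -!val_eqE /=.
    by have := ltn_ord x; have := ltn_ord a; lia.
  - case: eqP => [->|_]; last by rewrite mulr0 mul0r !scale0r.
    rewrite mulr1 scale1r -expfzDr // (_ : _ + _ = 0); last first.
      by rewrite /g /cnt; clear -yx yn; rewrite -!val_eqE /=; have := ltn_ord x; lia.
    rewrite expr0z scale1r; apply: eq_diag => b.
    rewrite /Q /g /below /cnt; clear -yx yn; rewrite -!val_eqE /=.
    by have := ltn_ord x; have := ltn_ord b; lia.
  - case: eqP => [->|_]; last by rewrite mulr0 mul0r !scale0r.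
    rewrite mulr1 scale1r -expfzDr // (_ : _ + _ = 0); last first.
      by rewrite /g /cnt; clear -yx yn; rewrite -!val_eqE /=; have := ltn_ord x; lia.
    rewrite expr0z scale1r; apply: eq_diag => b.
    rewrite /Q /g /below /cnt; clear -yx yn; rewrite -!val_eqE /=.
    by have := ltn_ord x; have := ltn_ord b; lia.
under [RHS]eq_bigr do rewrite key !qformDr (qformZr (opw _ _ _)) -IH.
rewrite !big_split /= !pick2 !qform_gd; congr (_ + _ + _).
by apply: eq_bigr => a _; rewrite qformZl.
Qed.

(** Follows from [raise_adjoint] by symmetry of the form, after the invertible self-adjoint diagonal
    operators are moved across. *)
Lemma lower_adjoint x y d (t u : T d) : y = x.+1 :> nat -> (y <= n)%N ->
  qform (op q^-1 y x t) u =
  qform t (q ^ (- cnt y y) *: gd q false x (gd q true y (op q x y u))).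
Proof.
move=> yx yn; rewrite qformC.
have -> : t = gd q false y (gd q true x (gd q false x (gd q true y t))).
  by rewrite (gdK true) // (gdK false).
set w := gd q false x _; rewrite qformZr -[in RHS]qform_gd -[in RHS]qform_gd.
have -> : gd q true y (gd q false x (gd q false y (gd q true x w))) = w.
  by rewrite (gdC _ false x) (gdK true) // (gdK false).
rewrite [RHS]mulrC [in RHS]qformC raise_adjoint // qformZr mulrAC -expfzDr // subrr.
by rewrite expr0z mul1r.
Qed.

(* Only E and F need an argument: the other generators are diagonal. *)
Lemma Ugen_adjoint d (B : 'End(T d) -> Prop) :
    (forall g, B (Ugen_end d q g)) -> (forall k f, B f -> B (k *: f)) ->
    (forall f g, B f -> B g -> B (f \o g)%VF) ->
  forall g, exists2 f, B f & forall t u, qform (Ugen_end d q g t) u = qform t (f u).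
Proof.
move=> Bg BZ BM; case=> [i|i|a|a|al].
- exists (q ^ cnt (hi i) (hi i) *: (Ugen_end d q (UgenF i) \o
    (Ugen_end d q (UgenH (inord i.+1)) \o Ugen_end d q (UgenHinv (inord i)))))%VF.
    by apply/BZ/BM => //; apply/BM.
  move=> t u; rewrite scale_lfunE !comp_lfunE !Ugen_endE /= raise_adjoint ?loE ?hiE //.
  by rewrite hlet_lo hlet_hi.
- exists (q ^ (- cnt (hi i) (hi i)) *: ((Ugen_end d q (UgenH (inord i)) \o
    Ugen_end d q (UgenHinv (inord i.+1))) \o Ugen_end d q (UgenE i)))%VF.
    by apply/BZ/BM => //; apply/BM.
  move=> t u; rewrite scale_lfunE !comp_lfunE !Ugen_endE /= lower_adjoint ?loE ?hiE //.
  by rewrite hlet_lo hlet_hi.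
- by exists (Ugen_end d q (UgenH a)) => // t u; rewrite !Ugen_endE /= qform_gd.
- by exists (Ugen_end d q (UgenHinv a)) => // t u; rewrite !Ugen_endE /= qform_gd.
- by exists (Ugen_end d q (UgenJ n al)) => // t u; rewrite !Ugen_endE /= qform_jp.
Qed.
End Adjoint.

(** * Sums of squares in a field of rational functions *)

Section Squares.

(** Evaluation at any point of the ordered ring makes every square vanish; each polynomial thus has
    as many distinct roots 0, 1, 2, ... as its size, and is zero. *)
Lemma polys_sum_sqr_eq0 (R : realDomainType) (I : finType) (p : I -> {poly R}) :
  \sum_i p i ^+ 2 = 0 -> forall i, p i = 0.
Proof.
move=> p0 i; apply: (@roots_geq_poly_eq0 _ _ [seq k%:R | k <- iota 0 (size (p i))]).
- apply/allP => x _; have /(congr1 (horner_eval x))/eqP := p0.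
  rewrite linear0 linear_sum psumr_eq0 => [/allP/(_ i (mem_index_enum _))|j _].
    by rewrite /= rmorphXn sqrf_eq0.
  by rewrite /= rmorphXn sqr_ge0.
- by rewrite map_inj_uniq ?iota_uniq // => a b /eqP; rewrite eqr_nat => /eqP.
- by rewrite size_map size_iota.
Qed.

Lemma common_denominator (R : idomainType) (I : eqType) (r : seq I) (a : I -> {fraction R}) :
  exists2 D : R, D != 0 & forall i, i \in r -> exists p, a i * tofrac D = tofrac p.
Proof.
elim: r => [|j r [D D0 rD]]; first by exists 1; rewrite ?oner_neq0.
have [p [e e0 ae]] : exists p, exists2 e : R, e != 0 & a j * tofrac e = tofrac p.
  move: (a j); elim/quotW => x; exists x.1, x.2; first exact: denom_ratioP.
  change (_ * _) with (FracField.mul (\pi x)%qT (tofrac x.2)); rewrite !piE.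
  apply/eqmodP; rewrite /= FracField.equivfE /FracField.mulf.
  rewrite !numden_Ratio ?mulf_neq0 ?denom_ratioP ?oner_neq0 //.
  by rewrite !mulr1 mulrC.
exists (D * e); first by rewrite mulf_neq0.
move=> i; rewrite inE => /predU1P[->|/rD[p' ip]].
  by exists (p * D); rewrite [D * e]mulrC !tofracM mulrA ae.
by exists (p' * e); rewrite !tofracM mulrA ip.
Qed.

(** Multiplication by a common denominator reduces the claim to polynomials. *)
Lemma fractions_sum_sqr_eq0 (R : realDomainType) (I : finType) (a : I -> {fraction {poly R}}) :
  \sum_i a i ^+ 2 = 0 -> forall i, a i = 0.
Proof.
move=> a0 i; have [D D0 aD] := common_denominator (enum I) a.
have {}aD j : exists p, a j * tofrac D = tofrac p.
  by apply: aD; rewrite mem_enum.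
pose p j := projT1 (cid (aD j)).
have pE j : a j * tofrac D = tofrac (p j) by rewrite /p; case: cid.
have p0 : \sum_j p j ^+ 2 = 0.
  apply/eqP; rewrite -tofrac_eq0 raddf_sum /=.
  under eq_bigr do rewrite tofracXn -pE exprMn.
  by rewrite -mulr_suml a0 mul0r.
have /eqP := pE i; rewrite (polys_sum_sqr_eq0 p0) tofrac0 mulf_eq0 tofrac_eq0.
by rewrite (negbTE D0) orbF => /eqP.
Qed.

End Squares.

(** * Cyclicity of the tensor space *)

Section SignedLetters.
Variable n : nat.
Local Notation letter := 'I_(n.*2).+1.
Implicit Types (x y a : letter) (s : bool) (i : 'I_n).

Definition sgn s a : letter := if s then rev_ord a else a.
(** The representative at most [n] of the orbit of [a] under [rev_ord]: an absolute value in which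
    the middle letter is the largest, with value [n]. *)
Definition absl a : nat := minn a (n.*2 - a).

Lemma absl_sgn s a : absl (sgn s a) = absl a.
Proof. by have := ltn_ord a; rewrite /absl /sgn; case: s => /=; lia. Qed.

Lemma absl_le a : (absl a <= n)%N.
Proof. by have := ltn_ord a; rewrite /absl; lia. Qed.

Lemma absl_small a : (a <= n)%N -> absl a = a.
Proof. by rewrite /absl; lia. Qed.

Lemma absl_lo i : absl (lo i) = i.
Proof. by rewrite absl_small loE // ltnW. Qed.

Lemma absl_hi i : absl (hi i) = i.+1.
Proof. by rewrite absl_small hiE. Qed.

Lemma absl_neq a x : absl a != absl x -> a != x /\ a != rev_ord x.
Proof.
by move=> ax; split; apply: contra ax => /eqP -> //; rewrite (absl_sgn true).
Qed.

Lemma sgn_absl a x : absl a = absl x -> (x <= n)%N -> a = sgn (n < a)%N x.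
Proof.
move=> ax xn; apply/val_inj => /=; move: ax; rewrite /absl /sgn.
by have := ltn_ord a; case: (ltnP n a) => /=; lia.
Qed.

End SignedLetters.

Section SingleTerms.
Variables (n d : nat) (K : fieldType).
Local Notation letter := 'I_(n.*2).+1.
Implicit Types (r : multi n d) (k l : 'I_d) (p : K) (x y : letter) (s : bool).

Lemma op_sum_out p x y r l : absl (r l) != absl x ->
  ((r l == x)%:R * p ^ exponent y r false l) *: delta K (subst r l y)
  + ((r l == rev_ord x)%:R * p ^ exponent y r true l) *: delta K (subst r l (rev_ord y)) = 0.
Proof. by case/absl_neq => /negbTE -> /negbTE ->; rewrite !mul0r !scale0r addr0. Qed.

Lemma op_sum_in p x y r l s : p != 0 -> x != rev_ord x -> r l = sgn s x ->
  ((r l == x)%:R * p ^ exponent y r false l) *: delta K (subst r l y)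
  + ((r l == rev_ord x)%:R * p ^ exponent y r true l) *: delta K (subst r l (rev_ord y))
  = p ^ exponent y r s l *: delta K (subst r l (sgn s y)).
Proof.
move=> p0 xx ->; case: s; rewrite /= eqxx ?[rev_ord x == x]eq_sym (negbTE xx);
  by rewrite mul0r scale0r mul1r ?addr0 ?add0r.
Qed.

Lemma op_single p x y r k s : p != 0 -> x != rev_ord x -> r k = sgn s x ->
    (forall l, l != k -> absl (r l) != absl x) ->
  exists2 c, c != 0 & op p x y (delta K r) = c *: delta K (subst r k (sgn s y)).
Proof.
move=> p0 xx rk out; exists (p ^ exponent y r s k); first exact: expfz_neq0.
rewrite op_delta // /op_sum (bigD1 k) //= (op_sum_in y p0 xx rk) big1 ?addr0 //.
by move=> l lk; apply/op_sum_out/out.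
Qed.

Lemma op_double p x y r k l s s' : p != 0 -> x != rev_ord x -> k != l ->
    r k = sgn s x -> r l = sgn s' x ->
    (forall m, m != k -> m != l -> absl (r m) != absl x) ->
  exists c c', [/\ c != 0, c' != 0 & op p x y (delta K r) =
    c *: delta K (subst r k (sgn s y)) + c' *: delta K (subst r l (sgn s' y))].
Proof.
move=> p0 xx kl rk rl out; exists (p ^ exponent y r s k), (p ^ exponent y r s' l).
split; try exact: expfz_neq0.
rewrite op_delta // /op_sum (bigD1 k) //= (bigD1 l) /=; last by rewrite eq_sym.
rewrite (op_sum_in y p0 xx rk) (op_sum_in y p0 xx rl) big1 ?addr0 //.
by move=> m /andP[mk ml]; apply/op_sum_out/out.
Qed.

Lemma op_middle p x y r k : p != 0 -> x = rev_ord x -> r k = x ->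
    (forall l, l != k -> absl (r l) != absl x) ->
  exists c c', [/\ c != 0, c' != 0 & op p x y (delta K r) =
    c *: delta K (subst r k y) + c' *: delta K (subst r k (rev_ord y))].
Proof.
move=> p0 xx rk out; exists (p ^ exponent y r false k), (p ^ exponent y r true k).
split; try exact: expfz_neq0.
rewrite op_delta // /op_sum (bigD1 k) //= [X in _ + X]big1 => [|m mk].
  by rewrite addr0 -xx rk eqxx !mul1r.
exact/op_sum_out/out.
Qed.

Lemma subst_out r k a l : l != k -> subst r k a l = r l.
Proof. by move=> lk; rewrite ffunE (negbTE lk). Qed.

Lemma subst_in r k a : subst r k a k = a.
Proof. by rewrite ffunE eqxx. Qed.

End SingleTerms.

Section BasePoint.
Variables (n d : nat).
Implicit Types (r : multi n d) (k l : 'I_d).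

Definition sorted_word r :=
  (forall k l, (k < l)%N -> (absl (r k) <= absl (r l))%N) /\
  (forall k, (k.+1 < d)%N -> (r k <= n)%N).

(** Without descents the letters increase weakly and the last two have sum at most [n.*2]. Hence
    only the last letter can pass the middle, and its absolute value still dominates the others. *)
Lemma no_descent_sorted r : (1 < d)%N -> (forall j, 0 <= simple_root j r) -> sorted_word r.
Proof.
move=> d2 rj.
have step (a b : 'I_d) : b = a.+1 :> nat -> (r a <= r b)%N.
  move=> ba; have := rj a; have := snd_posE d2 a.
  rewrite /simple_root /fst_pos /is_last; case: eqP => [e|_] sa.
    by have := ltn_ord b; lia.
  by rewrite (_ : snd_pos a = b) /sgn_diff; [lia|apply/val_inj; rewrite /= sa].
have last2 (a b : 'I_d) : b = a.+1 :> nat -> b.+1 = d -> (r a + r b <= n.*2)%N.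
  move=> ba bd; have := rj b; have := snd_posE d2 b; have := fst_posE d2 b.
  rewrite /simple_root /is_last; case: eqP => // _ fb sb.
  have -> : fst_pos b = a by apply/val_inj; rewrite /= fb ba.
  have -> : snd_pos b = b by apply/val_inj; rewrite /= sb.
  by rewrite /sgn_diff; lia.
have mono m (a b : 'I_d) : b = (a + m)%N :> nat -> (r a <= r b)%N.
  elim: m a b => [|m IH] a b ab.
    by rewrite (_ : b = a) //; apply/val_inj; rewrite /= ab addn0.
  have cd : (a.+1 < d)%N by have := ltn_ord b; lia.
  by apply: leq_trans (step a (Ordinal cd) _) (IH _ _ _) => //=; lia.
have d1 : (d.-1 < d)%N by lia.
have d3 : (d.-2 < d)%N by lia.
have le_n k : (k.+1 < d)%N -> (r k <= n)%N.
  move=> kd; have := last2 (Ordinal d3) (Ordinal d1); have := step (Ordinal d3) (Ordinal d1).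
  have := mono (d.-2 - k)%N k (Ordinal d3); rewrite /=; lia.
split=> // k l kl; have kd : (k.+1 < d)%N by have := ltn_ord l; lia.
have kn := le_n k kd; rewrite (absl_small kn).
have kl' := mono (l - k)%N k l; case: (ltnP l.+1 d) => ld.
  by rewrite absl_small ?le_n //; apply: kl'; lia.
have := last2 (Ordinal d3) l; have := mono (d.-2 - k)%N k (Ordinal d3).
have := ltn_ord l; rewrite /absl /=; lia.
Qed.

Definition base_point : multi n d := [ffun k : 'I_d => inord (n - d + k)].

Lemma base_pointE k : (d <= n)%N -> base_point k = (n - d + k)%N :> nat.
Proof. by move=> dn; rewrite ffunE inordK //; have := ltn_ord k; lia. Qed.

Lemma absl_base k : (d <= n)%N -> absl (base_point k) = (n - d + k)%N.
Proof. by move=> dn; rewrite absl_small base_pointE //; have := ltn_ord k; lia. Qed.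

End BasePoint.

Section Cyclic.
Variables (n d : nat) (K : fieldType) (q : K).
Hypotheses (d2 : (1 < d)%N) (dn : (d <= n)%N) (q0 : q != 0).
Local Notation letter := 'I_(n.*2).+1.
Local Notation T := {ffun multi n d -> K^o}.
Implicit Types (r : multi n d) (t u : T) (j k l : 'I_d) (i : 'I_n) (s : bool).

Local Notation r0 := (base_point n d).

Inductive orbit : T -> Prop :=
| orbit_base : orbit (delta K r0)
| orbitD t u of orbit t & orbit u : orbit (t + u)
| orbitZ (k : K) t of orbit t : orbit (k *: t)
| orbit_act g t of orbit t : orbit (Ugen_op q g t).

Lemma orbit_cancel c t : c != 0 -> orbit (c *: t) -> orbit t.
Proof. by move=> c0 /(orbitZ c^-1); rewrite scalerK. Qed.

Lemma orbit_second c t u : c != 0 -> orbit t -> orbit (t + c *: u) -> orbit u.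
Proof.
move=> c0 tO uO; apply: (orbit_cancel c0).
by rewrite -(addKr t (c *: u)) -scaleN1r; apply: orbitD => //; apply: orbitZ.
Qed.

Let qi0 : q^-1 != 0. Proof. by rewrite invr_eq0. Qed.

Lemma orbit_raise i r k s : r k = sgn s (lo i) ->
    (forall l, l != k -> absl (r l) != i) ->
  orbit (delta K r) -> orbit (delta K (subst r k (sgn s (hi i)))).
Proof.
move=> rk out /(orbit_act (UgenE i)) /=; rewrite -(absl_lo i) in out.
by have [c c0 ->] := op_single (hi i) q0 (lo_nmid i) rk out; apply: orbit_cancel.
Qed.

Lemma orbit_lower i r k s : i.+1 != n -> r k = sgn s (hi i) ->
    (forall l, l != k -> absl (r l) != i.+1) ->
  orbit (delta K r) -> orbit (delta K (subst r k (sgn s (lo i)))).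
Proof.
move=> iN rk out /(orbit_act (UgenF i)) /=; rewrite -(absl_hi i) in out.
by have [c c0 ->] := op_single (lo i) qi0 (hi_nmid iN) rk out; apply: orbit_cancel.
Qed.

(** [E_n] raises the letter to the middle and [F_n] returns it with both signs; subtracting a
    multiple of the original vector leaves the one with opposite sign. *)
Lemma orbit_sign i r k : i.+1 = n -> r k = lo i ->
    (forall l, l != k -> absl (r l) != i /\ absl (r l) != i.+1) ->
  orbit (delta K r) -> orbit (delta K (subst r k (rev_ord (lo i)))).
Proof.
move=> iN rk out rO; set r1 := subst r k (hi i).
have r1O : orbit (delta K r1).
  by apply: (@orbit_raise i r k false) => // l /out[].
have out1 l : l != k -> absl (r1 l) != absl (hi i).
  by move=> lk; rewrite subst_out // absl_hi; case: (out l lk).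
have [c [c' [c0 c0' e]]] := op_middle (lo i) qi0 (esym (hi_mid iN)) (subst_in _ _ _) out1.
have := orbit_act (UgenF i) r1O; rewrite /= e !subst_subst -rk subst_id.
by apply: orbit_second => //; apply: orbitZ.
Qed.

(** After [E_i] both positions have absolute value [i.+1], and [F_i] lowers either of them: one term
    is the original word, the other the exchanged one. *)
Lemma orbit_exchange i r k l s s' : i.+1 != n -> k != l ->
    r k = sgn s (lo i) -> r l = sgn s' (hi i) ->
    (forall m, m != k -> m != l -> absl (r m) != i /\ absl (r m) != i.+1) ->
  orbit (delta K r) ->
  orbit (delta K (subst (subst r k (sgn s (hi i))) l (sgn s' (lo i)))).
Proof.
move=> iN kl rk rl out rO; set r1 := subst r k _.
have lk : l != k by rewrite eq_sym.
have r1O : orbit (delta K r1).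
  apply: orbit_raise => // m mk; case: (eqVneq m l) => [->|ml]; last by case: (out m mk ml).
  by rewrite rl absl_sgn absl_hi; lia.
have out1 m : m != k -> m != l -> absl (r1 m) != absl (hi i).
  by move=> mk ml; rewrite subst_out // absl_hi; case: (out m mk ml).
have r1l : r1 l = sgn s' (hi i) by rewrite subst_out.
have [c [c' [c0 c0' e]]] :=
  op_double (lo i) qi0 (hi_nmid iN) kl (subst_in _ _ _) r1l out1.
have := orbit_act (UgenF i) r1O; rewrite /= e !subst_subst -rk subst_id.
by apply: orbit_second => //; apply: orbitZ.
Qed.

Lemma orbit_base_flip k : k.+1 = d -> orbit (delta K (subst r0 k (rev_ord (r0 k)))).
Proof.
move=> kd; have iN : (n.-1 < n)%N by lia.
have rk : r0 k = lo (Ordinal iN) by apply/val_inj; rewrite /= base_pointE // loE /=; lia.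
rewrite rk; apply: orbit_sign => //; [by rewrite /=; lia| |exact: orbit_base].
move=> l; rewrite -val_eqE /= absl_base //; have := ltn_ord l; lia.
Qed.

Lemma orbit_base_refl j : orbit (delta K (simple_refl j r0)).
Proof.
have fs := fst_snd_pos d2 j; have jd := ltn_ord j.
rewrite /simple_refl; have := fst_posE d2 j; have := snd_posE d2 j.
move: (fst_pos j) (snd_pos j) fs => a b ab; rewrite /is_last; case: eqP => jl /= bj aj.
  (* The last generator exchanges the last two letters and changes both signs. This is done in three
     moves: flip the last letter, exchange the absolute values, then flip the letter of absolute
     value [n.-1], now at [a]. *)
  have i1 : (n.-1 < n)%N by lia.
  have i2 : (n.-2 < n)%N by lia.
  pose i := Ordinal i1; pose i' := Ordinal i2.
  have ra : r0 a = lo i' by apply/val_inj; rewrite /= base_pointE // loE /=; lia.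
  have rb : r0 b = hi i' by apply/val_inj; rewrite /= base_pointE // hiE /=; lia.
  have ii' : hi i' = lo i by apply/val_inj; rewrite /= loE hiE /=; lia.
  have out m : m != a -> m != b -> (absl (r0 m) < n.-2)%N.
    by rewrite -!val_eqE /= absl_base //; have := ltn_ord m; lia.
  have ba : b != a by rewrite eq_sym.
  have := orbit_base_flip (k := b); rewrite bj rb => /(_ jl); set r1 := subst _ _ _ => O1.
  have O2 : orbit (delta K (subst (subst r1 a (sgn false (hi i'))) b (sgn true (lo i')))).
    apply: orbit_exchange => //; [by rewrite /=; lia|by rewrite subst_out|by rewrite subst_in|].
    by move=> m ma mb; rewrite subst_out //; have := out m ma mb; rewrite /=; lia.
  move: O2; set r2 := subst _ _ _ => O2.
  have r2a : r2 a = lo i by rewrite subst_out // subst_in.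
  rewrite (_ : swap_rev r0 a b = subst r2 a (rev_ord (lo i))).
    apply: orbit_sign => //; first by rewrite /=; lia.
    move=> m ma; case: (eqVneq m b) => [->|mb].
      by rewrite subst_in absl_sgn absl_lo /=; lia.
    by rewrite !subst_out //; have := out m ma mb; rewrite /=; lia.
  apply/ffunP => m; rewrite swap_revE ra rb -ii'; case: (eqVneq m a) => [->|ma].
    by rewrite subst_in.
  by case: (eqVneq m b) => [->|mb]; rewrite subst_out // ?subst_in // !subst_out.
have id' : (n - d + a < n)%N by have := ltn_ord b; lia.
pose i := Ordinal id'.
have ra : r0 a = lo i by apply/val_inj; rewrite /= base_pointE // loE /=; lia.
have rb : r0 b = hi i by apply/val_inj; rewrite /= base_pointE // hiE /=; lia.
rewrite (_ : swap r0 a b = subst (subst r0 a (sgn false (hi i))) b (sgn false (lo i))).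
  apply: orbit_exchange => //; last exact: orbit_base.
    by rewrite /=; have := ltn_ord b; lia.
  by move=> m; rewrite -!val_eqE /= absl_base //; have := ltn_ord m; lia.
apply/ffunP => m; rewrite swapE ra rb; case: (eqVneq m a) => [->|ma].
  by rewrite subst_out // subst_in.
by case: (eqVneq m b) => [->|mb]; rewrite ?subst_in // !subst_out.
Qed.

(** The Hecke operators commute with U, so stability need only be checked at the generating
    vector. *)
Lemma orbit_htau j t : orbit t -> orbit (htau q j t).
Proof.
elim=> [|{}t u _ tO _ uO|k {}t _ tO|g {}t _ tO].
- rewrite /htau tau_delta; [|exact: simple_reflK|exact: simple_rootN|exact: simple_root0].
  have O0 := orbit_base; case: ifP => _; first exact: orbit_base_refl.
  case: ifP => _; first exact: orbitZ.
  by apply: orbitD; apply: orbitZ => //; exact: orbit_base_refl.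
- by rewrite linearD; apply: orbitD.
- by rewrite linearZ; apply: orbitZ.
- by rewrite -Ugen_op_htau //; apply: orbit_act.
Qed.

(** The distance of the absolute values of [r] from those of the base point; each summand is an
    absolute difference, written with truncated subtractions. *)
Definition defect r : nat :=
  \sum_k ((absl (r k) - (n - d + k)) + ((n - d + k) - absl (r k))).

Lemma defect_subst r k a :
    ((absl a - (n - d + k)) + ((n - d + k) - absl a) <
     (absl (r k) - (n - d + k)) + ((n - d + k) - absl (r k)))%N ->
  (defect (subst r k a) < defect r)%N.
Proof.
move=> ak; rewrite /defect (bigD1 k) //= [X in (_ < X)%N](bigD1 k) //= subst_in.
under eq_bigr => l lk do rewrite subst_out //.
by rewrite ltn_add2r.
Qed.

Lemma sorted_subst r k s i : sorted_word r -> ((k.+1 < d)%N -> s = false) ->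
    (forall l, (l < k)%N -> (absl (r l) <= i)%N) ->
    (forall l, (k < l)%N -> (i <= absl (r l))%N) ->
  sorted_word (subst r k (sgn s (lo i))).
Proof.
move=> [r1 r2] ks lo_k hi_k; split=> [l m lm|l ld].
  case: (eqVneq l k) lm => [->|lk] lm.
    rewrite subst_in absl_sgn absl_lo subst_out ?hi_k //.
    by rewrite -val_eqE /=; lia.
  case: (eqVneq m k) lm => [->|mk] lm.
    by rewrite subst_in absl_sgn absl_lo subst_out ?lo_k.
  by rewrite !subst_out // r1.
case: (eqVneq l k) ld => [->|lk] ld; last by rewrite subst_out // r2.
by rewrite subst_in ks // /sgn loE; have := ltn_ord i; lia.
Qed.

(** Induction on the distance to the base point: one letter is moved by one step towards its place,
    and the move is undone by [E_i] or [F_i]. At distance 0 only the sign of the last letter is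
    left. *)
Lemma orbit_sorted r : sorted_word r -> orbit (delta K r).
Proof.
have [m] := ubnP (defect r); elim: m r => // m IH r; rewrite ltnS => rm rs.
have [r1 r2] := rs; have sgn_k k : (k.+1 < d)%N -> (n < r k)%N = false.
  by move=> kd; rewrite ltnNge r2.
have [/existsP[k0 k0P]|/existsPn small] := boolP [exists k, absl (r k) < n - d + k]%N.
  (* The rightmost letter that is too small: every later letter exceeds it by at least 2 in absolute
     value, so raising it by one meets no other letter and [F_i] recovers [r] as a single term. *)
  have [k kP kmax] := @arg_maxnP _ k0 (fun k => absl (r k) < n - d + k)%N (@nat_of_ord d) k0P.
  have gap l : (k < l)%N -> (absl (r k) + 2 <= absl (r l))%N.
    move=> kl; case: (ltnP (absl (r l)) (n - d + l)) => [lP|]; last by lia.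
    by have := kmax l lP; lia.
  have kn : (absl (r k) < n)%N by have := ltn_ord k; lia.
  have k1 : ((absl (r k)).+1 < n)%N by have := ltn_ord k; lia.
  pose i := Ordinal kn; pose i1 := Ordinal k1; pose s := (n < r k)%N.
  have rk : r k = sgn s (lo i).
    by apply: sgn_absl; rewrite ?absl_lo ?loE //= ltnW.
  pose r' := subst r k (sgn s (lo i1)).
  have e : lo i1 = hi i by [].
  have -> : r = subst r' k (sgn s (lo i)) by rewrite subst_subst -rk subst_id.
  apply: orbit_lower; first by rewrite /=; lia.
  - by rewrite subst_in e.
  - move=> l lk; rewrite subst_out //=; case: (ltngtP l k) => [/r1|/gap|/val_inj/eqP]; lia.
  apply: IH; last apply: sorted_subst => //.
  - apply: leq_trans rm; apply: defect_subst; rewrite absl_sgn absl_lo /=; lia.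
  - exact: sgn_k.
  - by move=> l /r1 /=; lia.
  - by move=> l /gap /=; lia.
have {}small (k : 'I_d) : (n - d + k <= absl (r k))%N by rewrite leqNgt small.
have [/existsP[k0 k0P]|/existsPn big] := boolP [exists k : 'I_d, n - d + k < absl (r k)]%N.
  (* Symmetrically, the leftmost letter that is too large is at least 2 above all earlier ones; [r]
     is recovered from the lowered word by [E_i]. *)
  have [k kP kmin] := @arg_minnP _ k0 (fun k : 'I_d => n - d + k < absl (r k))%N (@nat_of_ord d) k0P.
  have gap l : (l < k)%N -> (absl (r l) + 2 <= absl (r k))%N.
    move=> kl; have := small l; case: (ltnP (n - d + l) (absl (r l))) => [lP|]; last by lia.
    by have := kmin l lP; lia.
  have kn : ((absl (r k)).-1 < n)%N by have := absl_le (r k); lia.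
  pose i := Ordinal kn; pose s := (n < r k)%N.
  have rk : r k = sgn s (hi i).
    by apply: sgn_absl; [rewrite absl_hi /=; lia|rewrite hiE /=; have := absl_le (r k); lia].
  pose r' := subst r k (sgn s (lo i)).
  have -> : r = subst r' k (sgn s (hi i)) by rewrite subst_subst -rk subst_id.
  apply: orbit_raise.
  - by rewrite subst_in.
  - move=> l lk; rewrite subst_out //=; case: (ltngtP l k) => [/gap|/r1|/val_inj/eqP]; lia.
  apply: IH; last apply: sorted_subst => //.
  - apply: leq_trans rm; apply: defect_subst; rewrite absl_sgn absl_lo /=; lia.
  - exact: sgn_k.
  - by move=> l /gap /=; lia.
  - by move=> l /r1 /=; lia.
have abs_r k : absl (r k) = absl (r0 k).
  by apply/eqP; rewrite absl_base // eqn_leq small leqNgt big.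
have rE k : r k = sgn (n < r k)%N (r0 k).
  by apply: sgn_absl => //; rewrite base_pointE //; have := ltn_ord k; lia.
have d1 : (d.-1 < d)%N by lia.
pose k := Ordinal d1.
have -> : r = subst r0 k (sgn (n < r k)%N (r0 k)).
  apply/ffunP => l; rewrite ffunE; case: eqP => [->//|/eqP lk].
  by rewrite rE sgn_k //; have := ltn_ord l; move: lk; rewrite -val_eqE /=; lia.
case: (n < r k)%N; last by rewrite /= subst_id; exact: orbit_base.
by apply: orbit_base_flip; rewrite /=; lia.
Qed.

(** If [j] is a descent of [r], the vector of [r] is the image under [htau q j] of the vector of the
    reflected word, which has smaller height; sorted words end the descent. *)
Lemma orbit_delta r : orbit (delta K r).
Proof.
elim/(@descent_ind _ _ (@simple_refl n d) (@simple_root n d) (@height n d)): r.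
- exact: height_descent.
- by move=> r /(no_descent_sorted d2)/orbit_sorted.
- move=> j r jr /(orbit_htau j); rewrite /htau tau_delta;
    [|exact: simple_reflK|exact: simple_rootN|exact: simple_root0].
  by rewrite simple_rootN // oppr_gt0 jr simple_reflK.
Qed.

Lemma orbit_all t : orbit t.
Proof.
rewrite [t]delta_sum; elim/big_rec: _ => [|r u _ uO].
  by rewrite -(scale0r (delta K r0)); apply/orbitZ/orbit_base.
by apply: orbitD => //; apply/orbitZ/orbit_delta.
Qed.
End Cyclic.

Lemma expfz_inj (K : fieldType) (q : K) : q != 0 ->
  (forall m, (0 < m)%N -> q ^+ m != 1) -> injective (fun z : int => q ^ z).
Proof.
move=> q0 qm a b /= e; apply/eqP; rewrite -subr_eq0; apply/eqP.
have {e}: q ^ (a - b) = 1 by rewrite expfzDr // e -expfzDr // subrr.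
case: (a - b) => m; last first.
  by rewrite NegzE -invr_expz => /eqP; rewrite invr_eq1 (negbTE (qm _ _)).
by case: m => // m /eqP; rewrite (negbTE (qm _ _)).
Qed.

(** * The commutant of U *)

Section CommutantAtBase.
Variables (n d : nat) (K : fieldType) (q : K).
Hypotheses (d2 : (1 < d)%N) (dn : (d <= n)%N) (q0 : q != 0).
Hypothesis (qm : forall m, (0 < m)%N -> q ^+ m != 1).
Local Notation letter := 'I_(n.*2).+1.
Local Notation T := {ffun multi n d -> K^o}.
Implicit Types (r s : multi n d) (t u : T) (j k l : 'I_d) (i : 'I_n).
Local Notation r0 := (base_point n d).

Lemma J_type_side r b : J_type r = Some b -> forall k, r k != n :> nat.
Proof.
by rewrite /J_type; case: ifP => // /negbT/existsPn h _ k; exact: h.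
Qed.

Lemma J_type_base : J_type r0 = Some true.
Proof.
have lt k : (r0 k < n)%N by rewrite base_pointE //; have := ltn_ord k; lia.
rewrite /J_type; case: existsP => [[k]|_]; first by have := lt k; lia.
rewrite eq_card0 // => k; rewrite !inE; apply/negbTE; have := lt k; lia.
Qed.

Lemma J_type_base_flip k : k.+1 = d ->
  J_type (subst r0 k (rev_ord (r0 k))) = Some false.
Proof.
move=> kd; have lt l : (r0 l < n)%N by rewrite base_pointE //; have := ltn_ord l; lia.
have kk := lt k; rewrite /J_type; case: existsP => [[l]|_].
  case: (eqVneq l k) => [->|lk]; first by rewrite subst_in /=; lia.
  by rewrite subst_out //; have := lt l; lia.
rewrite (eq_card (B := pred1 k)) ?card1 // => l; rewrite !inE.
case: (eqVneq l k) => [->|lk]; first by rewrite subst_in /=; lia.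
by rewrite subst_out //; apply/negbTE; have := lt l; lia.
Qed.

Definition same_weight s := forall a : 'I_n.+1,
  \sum_k cnt (hlet a) (s k) = \sum_k cnt (hlet a) (r0 k).

Lemma cnt_absl (m : 'I_n.+1) (b : letter) : (m < n)%N -> cnt (hlet m) b = (absl b == m)%:Z.
Proof.
move=> mn; rewrite /cnt -!val_eqE /= hletE /absl; have := ltn_ord b; lia.
Qed.

(** Equal weights make the absolute values of [s] distinct and place them in the interval from
    [n - d] to [n.-1]; being sorted they are those of [r0]. Only the sign of the last letter
    remains, and the parity in [J_type] decides it. *)
Lemma sorted_same_weight s : sorted_word s -> J_type s = Some true -> same_weight s ->
  s = r0.
Proof.
move=> [s1 s2] sJ sw; have nmid := J_type_side sJ.
have absn k : (absl (s k) < n)%N.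
  by have := nmid k; have := ltn_ord (s k); rewrite /absl; lia.
have count (m : nat) : (m < n)%N ->
    (\sum_(k < d) (absl (s k) == m) = \sum_(k < d) (n - d + k == m))%N.
  move=> mn; have mn1 : (m < n.+1)%N by lia.
  have := sw (Ordinal mn1).
  under eq_bigr do rewrite cnt_absl //; under [RHS]eq_bigr do rewrite cnt_absl // absl_base //.
  by rewrite /= -!sum_natz => -[].
have ge k : (n - d <= absl (s k))%N.
  rewrite leqNgt; apply/negP => lt; have := count _ (absn k).
  rewrite (bigD1 k) //= eqxx [in RHS]big1 // => l _; apply/eqP; lia.
have lt_mono k l : (k < l)%N -> (absl (s k) < absl (s l))%N.
  move=> kl; rewrite ltn_neqAle s1 // andbT; apply/eqP => e.
  have := count _ (absn k); rewrite (bigD1 k) //= (bigD1 l) /=; last first.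
    by rewrite -val_eqE /=; lia.
  rewrite eqxx -e eqxx.
  have kd : (absl (s k) - (n - d) < d)%N by have := absn k; have := ge k; lia.
  rewrite [in RHS](bigD1 (Ordinal kd)) //= [in RHS]big1 => [|m mk]; last first.
    case: eqP => // e1; have := ge k; move: mk; rewrite -val_eqE /=; lia.
  set A := (\sum_(_ | _) _)%N; rewrite addn0 addnA; case: (_ == absl _); case: A => //.
have lower m k : k = m :> nat -> (n - d + m <= absl (s k))%N.
  elim: m k => [|m IH] k km; first by rewrite addn0 ge.
  have md : (m < d)%N by have := ltn_ord k; lia.
  have := lt_mono (Ordinal md) k; have := IH (Ordinal md) erefl; rewrite /= km; lia.
have upper m k : (k + m).+1 = d -> (absl (s k) + m < n)%N.
  elim: m k => [|m IH] k km; first by rewrite addn0 absn.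
  have md : (k.+1 < d)%N by lia.
  have := lt_mono k (Ordinal md); have := IH (Ordinal md); rewrite /=; lia.
have sabs k : absl (s k) = absl (r0 k).
  rewrite absl_base //; have := lower k k erefl; have := upper (d.-1 - k)%N k.
  by have := ltn_ord k; lia.
have sE k : s k = sgn (n < s k)%N (r0 k).
  by apply: sgn_absl => //; rewrite base_pointE //; have := ltn_ord k; lia.
have d1 : (d.-1 < d)%N by lia.
pose k := Ordinal d1.
have es : s = subst r0 k (sgn (n < s k)%N (r0 k)).
  apply/ffunP => l; rewrite ffunE; case: eqP => [->//|/eqP lk].
  have ld : (l.+1 < d)%N by have := ltn_ord l; move: lk; rewrite -val_eqE /=; lia.
  by rewrite sE ltnNge s2.
rewrite es; case: (n < s k)%N es => [es|_]; last by rewrite /= subst_id.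
have kd : k.+1 = d by rewrite /=; lia.
by have := J_type_base_flip kd; rewrite -[rev_ord _]/(sgn true _) -es sJ.
Qed.

Variable S : T -> Prop.
Hypotheses (SD : forall t u, S t -> S u -> S (t + u)) (SZ : forall (k : K) t, S t -> S (k *: t))
  (Stau : forall j t, S t -> S (htau q j t)) (S0 : S (delta K r0)).

Lemma same_weight_orbit s : J_type s = Some true -> same_weight s -> S (delta K s).
Proof.
elim/(@descent_ind _ _ (@simple_refl n d) (@simple_root n d) (@height n d)): s.
- exact: height_descent.
- by move=> s /(no_descent_sorted d2) ss sJ sw; rewrite (sorted_same_weight ss sJ sw).
- move=> j s js IH sJ sw; have ab := fst_snd_pos d2 j.
  have : S (htau q j (delta K (simple_refl j s))).
    apply/Stau/IH; first by rewrite J_type_sgn_swap.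
    by move=> a; rewrite sum_sgn_swap // => c; rewrite cnt_rev.
  rewrite /htau tau_delta; [|exact: simple_reflK|exact: simple_rootN|exact: simple_root0].
  by rewrite simple_rootN // oppr_gt0 js simple_reflK.
Qed.

(** [f] preserves the eigenspaces of the [H_a] and of [J_+]. So every word in the support of the
    image of [r0] has its weight and type, and such words lie in any Hecke-stable subspace
    containing [r0]. *)
Lemma commutant_at_base (f : {linear T -> T}) :
  (forall g t, f (Ugen_op q g t) = Ugen_op q g (f t)) -> S (f (delta K r0)).
Proof.
move=> fC; set u := f _.
have S00 : S 0 by rewrite -(scale0r (delta K r0)); apply: SZ.
rewrite [u]delta_sum; elim/big_rec: _ => // s w _ Sw; apply: SD => //.
have [->|us] := eqVneq (u s) 0; first by rewrite scale0r.
apply/SZ/same_weight_orbit.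
  have := fC (UgenJ n (Some true)) (delta K r0); rewrite /= jp_delta J_type_base eqxx -/u.
  move=> /ffunP/(_ s); rewrite [RHS]ffunE; case: eqP => // _ /eqP.
  by rewrite mul0r (negbTE us).
move=> a; have := fC (UgenHinv a) (delta K r0); rewrite /= gd_delta linearZ /= -/u.
move=> /ffunP/(_ s); rewrite TE [RHS]ffunE => /(mulIf us) e.
by apply: (expfz_inj q0 qm); rewrite /= e.
Qed.

End CommutantAtBase.

(** * The regular orbit of the base point *)

Section Regular.
Variables (n d : nat) (K : fieldType) (q : K).
Hypotheses (d2 : (1 < d)%N) (dn : (d <= n)%N).
Local Notation T := {ffun multi n d -> K^o}.
Implicit Types (r : multi n d) (t u : T) (j k l : 'I_d).
Local Notation r0 := (base_point n d).

Lemma simple_root_base j : 0 <= simple_root j r0.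
Proof.
have := fst_posE d2 j; have := snd_posE d2 j; rewrite /simple_root /sgn_diff.
rewrite !base_pointE // /is_last; have := ltn_ord j.
by case: (j.+1 =P d) => /= ? ? -> ->; lia.
Qed.

Definition regular_word r := [forall k, forall l, (absl (r k) == absl (r l)) ==> (k == l)].

Lemma regular_wordP r :
  reflect (forall k l, absl (r k) = absl (r l) -> k = l) (regular_word r).
Proof.
apply: (iffP forallP) => h k; first by move=> l e; apply/eqP; have /forallP/(_ l) := h k; rewrite e eqxx.
by apply/forallP => l; apply/implyP => /eqP/h ->.
Qed.

Lemma regular_word_refl j r : regular_word r -> regular_word (simple_refl j r).
Proof.
move=> /regular_wordP h; apply/regular_wordP => k l; rewrite /simple_refl.
move: (fst_pos j) (snd_pos j) (fst_snd_pos d2 j) => a b ab.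
have e m : absl (sgn_swap (is_last j) r a b m) = absl (r (tperm a b m)).
  case: (is_last j); rewrite /= ffunE; case: tpermP => [->|->|/eqP ma /eqP mb];
    rewrite ?eqxx ?[b == a]eq_sym ?(negbTE ab) ?(negbTE ma) ?(negbTE mb) //; exact: (absl_sgn true).
by rewrite !e => /h /perm_inj.
Qed.

Lemma regular_word_root j r : regular_word r -> simple_root j r != 0.
Proof.
move=> /regular_wordP h; apply/eqP => /= e; have := fst_snd_pos d2 j.
case/eqP; apply: h; move: e; rewrite /simple_root /sgn_diff /absl.
have := ltn_ord (r (fst_pos j)); have := ltn_ord (r (snd_pos j)); case: is_last; lia.
Qed.

Lemma regular_word_base : regular_word r0.
Proof.
apply/regular_wordP => k l; rewrite !absl_base // => e; apply/val_inj => /=; lia.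
Qed.

Variables (M : lmodType K) (rho : 'I_d -> {linear M -> M}) (m0 : M).
Hypotheses
  (rho_quadratic : forall j m, rho j (rho j m) = (q ^+ 2 - 1) *: rho j m + q ^+ 2 *: m)
  (rho_commute : forall i j m, commuting (@simple_refl n d) (@simple_root n d) i j ->
     rho i (rho j m) = rho j (rho i m))
  (rho_braid : forall i j m, braiding (@simple_refl n d) (@simple_root n d) i j ->
     rho i (rho j (rho i m)) = rho j (rho i (rho j m))).

(** Words with distinct absolute values are stable under reflections and annihilate no simple root,
    so [regular_hom] applies to them. The base point has no descent, hence its image is the empty
    product [m0]. *)
Lemma base_retraction : exists2 f : {linear T -> M}, f (delta K r0) = m0 &
  forall j t, f (htau q j t) = rho j (f t).
Proof.
exists (regular_hom (@simple_refl n d) (@simple_root n d) (@height n d) rho m0 regular_word).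
  rewrite /= regular_hom_delta regular_word_base word_at_min //; exact: simple_root_base.
move=> j t; apply: regular_hom_tau => //.
- exact: simple_reflK.
- exact: simple_rootN.
- exact: simple_root0.
- exact: height_descent.
- exact: type_D_pairs.
- exact: regular_word_refl.
- exact: regular_word_root.
Qed.
End Regular.

Lemma lfun_linearD (K : fieldType) (W : vectType K) (f : 'End(W)) t u :
  f (t + u) = f t + f u.
Proof. exact: linearD. Qed.

Lemma lfun_linearZ (K : fieldType) (W : vectType K) (f : 'End(W)) k t :
  f (k *: t) = k *: f t.
Proof. exact: linearZZ. Qed.

(** * The double centralizer property *)

Section TwoActions.
Variables (K : fieldType) (W : vectType K) (Y Z : choiceType).
Variables (hL : Y -> 'End(W)) (hR : Z -> 'End(W)).
Variables (relL : free_alg K Y -> free_alg K Y -> Prop)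
  (relR : free_alg K Z -> free_alg K Z -> Prop).
Hypotheses
  (relLP : forall a b, relL a b -> end_lift false hL a = end_lift false hL b)
  (relRP : forall a b, relR a b -> end_lift true hR a = end_lift true hR b).
Implicit Types (t u w : W) (f : 'End(W)) (x y : presented_alg relL)
  (h : presented_alg relR).

Local Notation L := (rep_of relLP).
Local Notation R := (rep_of relRP).

Lemma L_gen g x t : L (pgen relL g * x) t = hL g (L x t).
Proof. by rewrite rep_ofM rep_of_gen /lfun_mul comp_lfunE. Qed.
Lemma R_gen j h t : R (pgen relR j * h) t = R h (hR j t).
Proof. by rewrite rep_ofM rep_of_gen /lfun_mul comp_lfunE. Qed.
Lemma L_1 t : L 1 t = t. Proof. by rewrite rep_of1 id_lfunE. Qed.
Lemma L_D x y t : L (x + y) t = L x t + L y t.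
Proof. by rewrite linearD add_lfunE. Qed.
Lemma L_Z k x t : L (k *: x) t = k *: L x t.
Proof. by rewrite linearZ scale_lfunE. Qed.
Lemma R_1 t : R 1 t = t. Proof. by rewrite rep_of1 id_lfunE. Qed.
Lemma R_D h h' t : R (h + h') t = R h t + R h' t.
Proof. by rewrite linearD add_lfunE. Qed.
Lemma R_Z k h t : R (k *: h) t = k *: R h t.
Proof. by rewrite linearZ scale_lfunE. Qed.

Hypothesis hLR : forall g j t, hL g (hR j t) = hR j (hL g t).

Lemma hL_R g h t : hL g (R h t) = R h (hL g t).
Proof.
move: h t; elim/presented_ind => [|k h IH|h h' IH IH'|j h IH] t.
- by rewrite !R_1.
- by rewrite !R_Z lfun_linearZ IH.
- by rewrite !R_D lfun_linearD IH IH'.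
- by rewrite !R_gen IH hLR.
Qed.

Lemma actions_commute x h : (L x \o R h = R h \o L x)%VF.
Proof.
apply/lfunP => t; rewrite !comp_lfunE; move: x t.
elim/presented_ind => [|k x IH|x y IH IH'|g x IH] t.
- by rewrite !L_1.
- by rewrite !L_Z lfun_linearZ IH.
- by rewrite !L_D lfun_linearD IH IH'.
- by rewrite !L_gen IH hL_R.
Qed.

Variable w0 : W.

(** Let [f] commute with the left action. By the second hypothesis [f w0] equals [R h w0] for some
    [h]; then [f] and [R h] agree at [w0] and both commute with the left action, which generates
    everything from [w0]. *)
Lemma commutant_cyclic :
    (forall S : W -> Prop, S w0 -> (forall t u, S t -> S u -> S (t + u)) ->
       (forall k t, S t -> S (k *: t)) -> (forall g t, S t -> S (hL g t)) ->
     forall t, S t) ->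
    (forall (f : 'End(W)) (S : W -> Prop), (forall g t, f (hL g t) = hL g (f t)) ->
       S w0 -> (forall t u, S t -> S u -> S (t + u)) ->
       (forall k t, S t -> S (k *: t)) -> (forall j t, S t -> S (hR j t)) ->
     S (f w0)) ->
  forall f : 'End(W), (forall x, (f \o L x = L x \o f)%VF) -> exists h, R h = f.
Proof.
move=> cyc base f fC; have fop g t : f (hL g t) = hL g (f t).
  by have /lfunP/(_ t) := fC (pgen relL g); rewrite !comp_lfunE !rep_of_gen.
have [||k t [h <-]|j t [h <-]|h Rh] := base f (fun t => exists h, R h w0 = t) fop.
- by exists 1; rewrite R_1.
- by move=> t u [h <-] [h' <-]; exists (h + h'); rewrite R_D.
- by exists (k *: h); rewrite R_Z.
- exists (h * pgen relR j).
  by rewrite rep_ofM rep_of_gen /lfun_mul comp_lfunE.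
exists h; apply/lfunP => t; move: t.
apply: cyc => [//|t u tO uO|k t tO|g t tO].
- by rewrite !lfun_linearD tO uO.
- by rewrite !lfun_linearZ tO.
- by rewrite -hL_R tO fop.
Qed.

(** Equivariance gives [f (R h w0) = f w0 * h = h], so [h] is recovered from its operator. *)
Lemma rep_injective (f : {linear W -> presented_alg relR}) :
  f w0 = 1 -> (forall j t, f (hR j t) = f t * pgen relR j) -> injective R.
Proof.
move=> f0 fR1; have fR h t : f (R h t) = f t * h.
  move: h t; elim/presented_ind => [|k h IH|h h' IH IH'|j h IH] t.
  - by rewrite R_1 mulr1.
  - by rewrite R_Z linearZ /= IH presented_scaleAr.
  - by rewrite R_D linearD /= IH IH' mulrDr.
  - by rewrite R_gen IH fR1 mulrA.
by move=> h h' e; rewrite -[h]mul1r -[h']mul1r -f0 -!fR e.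
Qed.

Lemma rep_adjoint (F : W -> W -> K) :
    (forall t t' u, F (t + t') u = F t u + F t' u) ->
    (forall k t u, F (k *: t) u = k * F t u) ->
    (forall t u u', F t (u + u') = F t u + F t u') ->
    (forall k t u, F t (k *: u) = k * F t u) ->
    (forall g, exists y, forall t u, F (hL g t) u = F t (L y u)) ->
  forall x, exists y, forall t u, F (L x t) u = F t (L y u).
Proof.
move=> FDl FZl FDr FZr Fg.
elim/presented_ind=> [|k x [y xy]|x x' [y xy] [y' xy']|g x [y xy]].
- by exists 1 => t u; rewrite !L_1.
- by exists (k *: y) => t u; rewrite !L_Z FZl FZr xy.
- by exists (y + y') => t u; rewrite !L_D FDl FDr xy xy'.
have [z gz] := Fg g; exists (y * z) => t u.
by rewrite L_gen gz xy rep_ofM /lfun_mul comp_lfunE.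
Qed.

End TwoActions.

Section DoubleCentralizer.
Variables (n d : nat) (K : fieldType) (q : K).
Local Notation T := {ffun multi n d -> K^o}.
Variables (relU : free_alg K (Ugen n) -> free_alg K (Ugen n) -> Prop)
  (relH : free_alg K 'I_d -> free_alg K 'I_d -> Prop).
Hypotheses
  (relUP : forall a b, relU a b ->
     end_lift false (@Ugen_end n d K q) a = end_lift false (@Ugen_end n d K q) b)
  (relHP : forall a b, relH a b ->
     end_lift true (@htau_end n d K q) a = end_lift true (@htau_end n d K q) b).
Implicit Types (t u : T) (f : 'End(T)) (i j k l : 'I_d) (x y : presented_alg relU)
  (h : presented_alg relH).

Local Notation L := (rep_of relUP).
Local Notation R := (rep_of relHP).
Hypotheses (d2 : (1 < d)%N) (q0 : q != 0).

Lemma Ugen_end_htau g j t : Ugen_end d q g (htau_end n q j t) = htau_end n q j (Ugen_end d q g t).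
Proof.
have -> : htau_end n q j t = htau q j t by exact: htau_endE.
have -> : Ugen_end d q g t = Ugen_op q g t by exact: Ugen_endE.
rewrite Ugen_endE htau_endE.
exact: Ugen_op_htau.
Qed.

Hypotheses (dn : (d <= n)%N) (qm : forall m, (0 < m)%N -> q ^+ m != 1).
Local Notation r0 := (base_point n d).

Lemma commutant_is_R f : (forall x, (f \o L x = L x \o f)%VF) -> exists h, R h = f.
Proof.
have cc := @commutant_cyclic _ _ _ _ _ _ _ _ relUP relHP Ugen_end_htau (delta K r0).
apply: cc => [S S0 SD SZ Sg|{}f S fop S0 SD SZ Sg].
  move=> t; elim: (orbit_all d2 dn q0 t) => [|{}t u _ tO _ uO|k {}t _ tO|g {}t _ tO].
  - exact: S0.
  - exact: SD.
  - exact: SZ.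
  - by rewrite -Ugen_endE; apply: Sg.
apply: (commutant_at_base d2 dn q0 qm SD SZ) => // [j t tS|g t].
  by rewrite -htau_endE; apply: Sg.
by have := fop g t; rewrite !Ugen_endE.
Qed.

Section Injectivity.
Let g j : presented_alg relH := pgen relH j.
Hypotheses
  (quad : forall j, g j * g j = (q ^+ 2 - 1) *: g j + q ^+ 2 *: (1 : presented_alg relH))
  (braid_next : forall j k, k = j.+1 :> nat -> (k.+1 < d)%N ->
     g j * g k * g j = g k * g j * g k)
  (comm_far : forall i j, (j.+2 <= i)%N -> (i.+1 < d)%N -> g i * g j = g j * g i)
  (comm_last : forall k l, k.+1 = d -> l.+3 <> d -> g k * g l = g l * g k)
  (braid_last : forall k l, k.+1 = d -> l.+3 = d -> g k * g l * g k = g l * g k * g l).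

Let root0 j : simple_root j r0 != 0.
Proof. by apply: regular_word_root => //; apply: regular_word_base. Qed.

(** The two conditions disagree on the root [j] at the reflected base point, because the root [i] is
    nonzero there. This lets [gen_comm] and [gen_braid] translate conditions on reflections into the
    relations of the presentation, which are stated by index. *)
Lemma commuting_not_braiding i j : commuting (@simple_refl n d) (@simple_root n d) i j ->
  ~ braiding (@simple_refl n d) (@simple_root n d) i j.
Proof.
move=> /(_ r0)[_ e _] /(_ r0)[_ e' _]; have := root0 i; apply/negP/negPn/eqP.
by apply: (addIr (simple_root j r0)); rewrite -e' e add0r.
Qed.

Lemma gen_comm i j : commuting (@simple_refl n d) (@simple_root n d) i j ->
  g i * g j = g j * g i.
Proof.
wlog ij : i j / (i < j)%N.
  move=> wl c; case: (ltngtP i j) => [ij|ij|/val_inj -> //]; first exact: wl.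
  by apply/esym/wl => //; apply: commuting_sym.
move=> c; have nb := commuting_not_braiding c.
case: (eqVneq j.+1 d) => [jd|jd].
  case: (eqVneq i.+3 d) => [id|/eqP id]; last by rewrite (comm_last jd id).
  by case: nb; apply: braiding_last.
have {}jd : (j.+1 < d)%N by have := ltn_ord j; lia.
case: (eqVneq (j : nat) i.+1) => [e|e]; last by rewrite (@comm_far j i) //; lia.
by case: nb; apply: braiding_next.
Qed.

Lemma gen_braid i j : braiding (@simple_refl n d) (@simple_root n d) i j ->
  g i * g j * g i = g j * g i * g j.
Proof.
wlog ij : i j / (i < j)%N.
  move=> wl c; case: (ltngtP i j) => [ij|ij|/val_inj -> //]; first exact: wl.
  by apply/esym/wl => //; apply: braiding_sym.
move=> b; have nc c := commuting_not_braiding c b.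
case: (eqVneq j.+1 d) => [jd|jd].
  case: (eqVneq i.+3 d) => [id|/eqP id]; first by rewrite (braid_last jd id).
  by case: nc; apply/commuting_sym/commuting_last => //; rewrite -val_eqE /=; lia.
have {}jd : (j.+1 < d)%N by have := ltn_ord j; lia.
case: (eqVneq (j : nat) i.+1) => [e|e]; first exact: braid_next.
by case: nc; apply/commuting_sym/commuting_far => //; lia.
Qed.

Let right_mul j h : presented_alg relH := h * g j.
Let right_mul_linear j : linear (right_mul j).
Proof. by move=> k x y; rewrite /right_mul mulrDl presented_scaleAl. Qed.
HB.instance Definition _ j := GRing.isLinear.Build K (presented_alg relH)
  (presented_alg relH) _ (right_mul j) (right_mul_linear j).

(** [base_retraction] is applied to the right regular module of the presented algebra with
    [m0 = 1]. *)
Lemma R_injective : injective R.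
Proof.
have [|i j m c|i j m b|f f0 ftau] :=
  @base_retraction n d K q d2 dn (presented_alg relH) (fun j => right_mul j) 1.
- move=> j m; rewrite /= /right_mul -mulrA quad mulrDr -!presented_scaleAr mulr1 //.
- by rewrite /= /right_mul -!mulrA -(gen_comm c).
- by rewrite /= /right_mul -!mulrA !(mulrA (g _)) (gen_braid b).
by apply: (rep_injective f0) => j t; rewrite htau_endE; exact: ftau.
Qed.

End Injectivity.

Hypothesis squares :
  forall (I : finType) (a : I -> K), \sum_z a z ^+ 2 = 0 -> forall z, a z = 0.

Lemma L_adjoint x : exists y, forall t u, qform q (L x t) u = qform q t (L y u).
Proof.
move: x; apply: rep_adjoint => [t t' u|k t u|t u u'|k t u|g].
- exact: qformDl.
- exact: qformZl.
- exact: qformDr.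
- exact: qformZr.
have [g'|k f [z <-]|f f' [z <-] [z' <-]|_ [z <-] gz] :=
    @Ugen_adjoint n K q q0 d (fun f => exists z, L z = f) _ _ _ g.
- by exists (pgen relU g'); exact: rep_of_gen.
- by exists (k *: z); exact: linearZZ.
- by exists (z * z'); exact: rep_ofM.
by exists z.
Qed.

(** The image of [L] is a subalgebra closed under adjoints, hence its own bicommutant. Its commutant
    is the image of [R] by [commutant_is_R], and [f] commutes with that image. *)
Lemma commutant_is_L f : (forall h, (f \o R h = R h \o f)%VF) -> exists x, L x = f.
Proof.
move=> fC; have c0 (r : multi n d) : q ^ len r != 0 by apply: expfz_neq0.
apply: (bicommutant c0 squares (B := fun f => exists x, L x = f)).
- by move=> _ _ [x <-] [y <-]; exists (x + y); exact: linearD.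
- by move=> k _ [x <-]; exists (k *: x); exact: linearZZ.
- by exists 1; exact: rep_of1.
- by move=> _ _ [x <-] [y <-]; exists (x * y); exact: rep_ofM.
- move=> _ [x <-]; have [y xy] := L_adjoint x; exists (L y); first by exists y.
  exact: xy.
move=> g gC; have [|h <-] := @commutant_is_R g; last exact: fC.
by move=> x; apply: gC; exists x.
Qed.

End DoubleCentralizer.

(** * Explicit formulas and conclusion *)

Section HeckeFormulas.
Variables (n d : nat) (K : fieldType) (q : K).
Hypothesis d2 : (1 < d)%N.
Implicit Types (r : multi n d) (j k : 'I_d).

Lemma htau_delta j r : htau q j (delta K r) =
  if 0 < simple_root j r then delta K (simple_refl j r)
  else if simple_root j r == 0 then q ^+ 2 *: delta K r
  else (q ^+ 2 - 1) *: delta K r + q ^+ 2 *: delta K (simple_refl j r).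
Proof.
by apply: tau_delta; [exact: simple_reflK|exact: simple_rootN|exact: simple_root0].
Qed.

Lemma htau_next j k r : k = j.+1 :> nat ->
  htau q j (delta K r) =
  if (r j < r k)%N then delta K (swap r j k)
  else if r j == r k then q ^+ 2 *: delta K r
  else (q ^+ 2 - 1) *: delta K r + q ^+ 2 *: delta K (swap r j k).
Proof.
move=> kj; have jl : is_last j = false by apply/eqP; have := ltn_ord k; lia.
have sj : snd_pos j = k by apply/val_inj; rewrite /= snd_posE // jl kj.
rewrite htau_delta /simple_root /simple_refl /fst_pos jl sj /= subr_gt0 ltz_nat.
by rewrite subr_eq0 eqz_nat val_eqE [r k == _]eq_sym.
Qed.

Lemma htau_last j k r : j.+2 = d -> k.+1 = d ->
  htau q k (delta K r) =
  if (r j + r k < n.*2)%N then delta K (swap_rev r j k)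
  else if (r j + r k == n.*2)%N then q ^+ 2 *: delta K r
  else (q ^+ 2 - 1) *: delta K r + q ^+ 2 *: delta K (swap_rev r j k).
Proof.
move=> jd kd; have kl : is_last k by apply/eqP.
have fk : fst_pos k = j by apply/val_inj; rewrite /= fst_posE // kl; lia.
have sk : snd_pos k = k by apply/val_inj; rewrite /= snd_posE // kl.
rewrite htau_delta /simple_root /simple_refl kl fk sk /=.
by rewrite subr_gt0 -PoszD ltz_nat subr_eq0 eqz_nat [n.*2 == _]eq_sym.
Qed.
End HeckeFormulas.

Lemma v_not_unity m : (0 < m)%N -> v ^+ m != 1.
Proof.
move=> m0; rewrite -subr_eq0 /v -tofracXn -(tofrac1 {poly rat}) -tofracB tofrac_eq0.
by rewrite -size_poly_eq0 size_XnsubC.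
Qed.

Section WordRelations.
Variables (K : fieldType) (X : choiceType) (rels : free_alg K X -> free_alg K X -> Prop).
Local Notation A := (presented_alg rels).
Implicit Types x y z : X.

Lemma presented_relE a b : rels a b -> (\pi_A a = \pi_A b)%qT.
Proof. by move=> ab; apply/pi_eqP; apply: RelIdeal_rel. Qed.

Lemma pgen_rel2 x y x' y' : rels (fgen K x * fgen K y) (fgen K x' * fgen K y') ->
  pgen rels x * pgen rels y = pgen rels x' * pgen rels y'.
Proof.
move=> /presented_relE e; apply: etrans (etrans (esym (presented_piM rels _ _)) e) _.
exact: presented_piM.
Qed.

Lemma pgen_rel3 x y z x' y' z' :
    rels (fgen K x * fgen K y * fgen K z) (fgen K x' * fgen K y' * fgen K z') ->
  pgen rels x * pgen rels y * pgen rels z = pgen rels x' * pgen rels y' * pgen rels z'.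
Proof.
have pi3 a b c : pgen rels a * pgen rels b * pgen rels c =
    (\pi_A (fgen K a * fgen K b * fgen K c))%qT.
  apply: etrans (esym (presented_piM rels _ _)).
  by congr (_ * _); exact: esym (presented_piM rels _ _).
by move=> /presented_relE e; rewrite !pi3.
Qed.

Lemma pgen_quad x c e : rels (fgen K x ^+ 2) (c *: fgen K x + e%:MP) ->
  pgen rels x * pgen rels x = c *: pgen rels x + e *: (1 : A).
Proof.
move=> /presented_relE e1; apply: etrans (esym (presented_piM rels _ _)) _.
apply: etrans e1 _; apply: etrans (presented_piD rels _ _) _.
congr (_ + _); first exact: presented_piZ.
rewrite -[e%:MP]mulr1 mul_malgC; exact: presented_piZ.
Qed.

End WordRelations.

Section GeneratorFormulas.
Variables (n d : nat) (K : fieldType) (q : K).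
Variables (relU : free_alg K (Ugen n) -> free_alg K (Ugen n) -> Prop)
  (relH : free_alg K 'I_d -> free_alg K 'I_d -> Prop).
Hypotheses
  (relUP : forall a b, relU a b ->
     end_lift false (@Ugen_end n d K q) a = end_lift false (@Ugen_end n d K q) b)
  (relHP : forall a b, relH a b ->
     end_lift true (@htau_end n d K q) a = end_lift true (@htau_end n d K q) b).
Local Notation L := (rep_of relUP).
Local Notation R := (rep_of relHP).
Hypotheses (d2 : (1 < d)%N) (q0 : q != 0).
Implicit Types (r : multi n d) (j k : 'I_d).

Lemma L_multiplicative : L 1 = \1%VF /\ (forall x y, L (x * y) = (L x \o L y)%VF).
Proof. by split; [exact: rep_of1|exact: rep_ofM]. Qed.

Lemma R_antimultiplicative : R 1 = \1%VF /\ (forall x y, R (x * y) = (R y \o R x)%VF).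
Proof. by split; [exact: rep_of1|exact: rep_ofM]. Qed.

Lemma L_R_commute x h : (L x \o R h = R h \o L x)%VF.
Proof. exact: actions_commute (Ugen_end_htau d2 q0) x h. Qed.

Lemma L_E i r : L (pgen relU (UgenE i)) (delta K r) = E_sum q i r.
Proof. by rewrite rep_of_gen Ugen_endE -op_E_sum. Qed.

Lemma L_F i r : L (pgen relU (UgenF i)) (delta K r) = F_sum q i r.
Proof. by rewrite rep_of_gen Ugen_endE -op_F_sum. Qed.

Lemma L_H (a : 'I_n.+1) r : L (pgen relU (UgenH a)) (delta K r) =
  q ^- (\sum_j (ext r j == a :> nat)) *: delta K r.
Proof. by rewrite rep_of_gen Ugen_endE -(gd_false_sum _ _ (hletE a)). Qed.

Lemma L_Hinv (a : 'I_n.+1) r : L (pgen relU (UgenHinv a)) (delta K r) =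
  q ^+ (\sum_j (ext r j == a :> nat)) *: delta K r.
Proof. by rewrite rep_of_gen Ugen_endE -(gd_true_sum _ _ (hletE a)). Qed.

Lemma L_J al r : L (pgen relU (UgenJ n al)) (delta K r) =
  if J_type r == al then delta K r else 0.
Proof. by rewrite rep_of_gen Ugen_endE -jp_delta. Qed.

Lemma R_tau j r : R (pgen relH j) (delta K r) = htau q j (delta K r).
Proof. by rewrite rep_of_gen htau_endE. Qed.

Hypotheses (dn_qm : forall m, (0 < m)%N -> q ^+ m != 1)
  (squares : forall (I : finType) (a : I -> K), \sum_z a z ^+ 2 = 0 -> forall z, a z = 0).
Local Notation g := (pgen relH).
Hypotheses
  (quad : forall j, relH (fgen K j ^+ 2) ((q ^+ 2 - 1) *: fgen K j + (q ^+ 2)%:MP))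
  (braid_next : forall j k, k = j.+1 :> nat -> (k.+1 < d)%N ->
     relH (fgen K j * fgen K k * fgen K j) (fgen K k * fgen K j * fgen K k))
  (comm_far : forall i j : 'I_d, (j.+2 <= i)%N -> (i.+1 < d)%N ->
     relH (fgen K i * fgen K j) (fgen K j * fgen K i))
  (comm_last : forall k l : 'I_d, k.+1 = d -> l.+3 <> d ->
     relH (fgen K k * fgen K l) (fgen K l * fgen K k))
  (braid_last : forall k l : 'I_d, k.+1 = d -> l.+3 = d ->
     relH (fgen K k * fgen K l * fgen K k) (fgen K l * fgen K k * fgen K l)).

(* Over an abstract field, so that conversion never unfolds Q(v). *)
Lemma double_centralizer :
  exists (L : {linear presented_alg relU -> 'End({ffun multi n d -> K^o})})
         (R : {linear presented_alg relH -> 'End({ffun multi n d -> K^o})}),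
  [/\ L 1 = \1%VF /\ (forall x y, L (x * y) = (L x \o L y)%VF),
      [/\ forall i r, L (pgen relU (UgenE i)) (delta K r) = E_sum q i r,
          forall i r, L (pgen relU (UgenF i)) (delta K r) = F_sum q i r,
          forall a r, L (pgen relU (UgenH a)) (delta K r) =
             q ^- (\sum_j (ext r j == a :> nat)) *: delta K r,
          forall a r, L (pgen relU (UgenHinv a)) (delta K r) =
             q ^+ (\sum_j (ext r j == a :> nat)) *: delta K r
        & forall al r, L (pgen relU (UgenJ n al)) (delta K r) =
             if J_type r == al then delta K r else 0],
      R 1 = \1%VF /\ (forall x y, R (x * y) = (R y \o R x)%VF),
      forall j r, R (g j) (delta K r) = htau q j (delta K r)
    & (forall x h, (L x \o R h = R h \o L x)%VF) /\
      ((d <= n)%N ->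
       [/\ injective R,
           forall f, (forall x, (f \o L x = L x \o f)%VF) -> exists h, R h = f
         & forall f, (forall h, (f \o R h = R h \o f)%VF) -> exists x, L x = f])].
Proof.
exists L, R; split; [exact: L_multiplicative| |exact: R_antimultiplicative|exact: R_tau|split].
- split; [exact: L_E|exact: L_F|exact: L_H|exact: L_Hinv|exact: L_J].
- exact: L_R_commute.
move=> dn; split; [|exact: commutant_is_R|exact: commutant_is_L].
apply: (R_injective d2 q0 dn).
- by move=> j; exact: pgen_quad.
- by move=> j k kj kd; apply/pgen_rel3/braid_next.
- by move=> i j ij id; apply/pgen_rel2/comm_far.
- by move=> k l kd ld; apply/pgen_rel2/comm_last.
- by move=> k l kd ld; apply/pgen_rel3/braid_last.
Qed.

End GeneratorFormulas.

Local Open Scope classical_set_scope.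

Theorem proposition2p1p3 (n d : nat) (hn : (1 <= n)%N) (hd : (2 <= d)%N) :
  exists (L : {linear U n -> 'End(tensor n d)})
         (R : {linear Hecke d -> 'End(tensor n d)}),
    [/\ is_U_action L, is_Hecke_action R,
        forall (x : U n) (h : Hecke d), (L x \o R h = R h \o L x)%VF
      & (d <= n)%N ->
          set_bij [set: Hecke d] (commutant L) R /\
          set_surj [set: U n] (commutant R) L].
Proof.
(* Specialisation to [q = v], which is nonzero and not a root of unity, over Q(v), where a sum of
   squares vanishes only trivially. *)
have [L [R [L1 [LE LF LH LHinv LJ] R1 Rtau [LRC DC]]]] :=
  double_centralizer (@U_rel_hold n d) (@Hecke_rel_hold n d hd) hd v_neq0 v_not_unity
    (@fractions_sum_sqr_eq0 rat) (@Hrel_quad d) (@Hrel_braid d) (@Hrel_comm d)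
    (@Hrel_comm_last d) (@Hrel_braid_last d).
exists L, R; split; [split| |exact: LRC|].
- exact: L1.
- exact: LE.
- exact: LF.
- by move=> a r; split; [exact: LH|exact: LHinv].
- exact: LJ.
- split; first exact: R1.
  + by move=> r j k kj; exact: etrans (Rtau j r) (htau_next v hd r kj).
  + by move=> r j k jd kd; exact: etrans (Rtau k r) (htau_last v hd r jd kd).
move=> /DC[Rinj RC LC]; split; first split.
- by move=> h _ x; exact: esym (LRC x h).
- by move=> h h' _ _; exact: Rinj.
- by move=> f fC; have [h e] := RC f fC; exact: (ex_intro2 _ _ h I e).
- by move=> f fC; have [x e] := LC f fC; exact: (ex_intro2 _ _ x I e).
Qed.
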